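(* Let $L\geq 1$ be an integer, $\omega=(\omega_0,\ldots,\omega_{L-1})\in\{0,1\}^L$ and $0<\delta_1\leq\delta_2<2/3$. There exist $\eta>0$ and $C$ such that \[ \int_{D}^{2D}\max_{0\leq y\leq z,\ z-y\leq x}\ \max_{\beta\geq 0} \left| A_\omega(y,z;\alpha,\beta) - \frac{z-y}{2^L\alpha} \right| \,\mathrm d\alpha \leq Cx^{1-\eta} \] for all real $x$ and $D$ such that $x\geq 1$ and $x^{\delta_1}\leq D\leq x^{\delta_2}$. Here $y,z,\beta$ range over real numbers.
   Context: For a nonnegative integer $n$, $s(n)$ is the number of $1$s in the binary expansion of $n$. For nonnegative real numbers $\alpha,\beta,y,z$ with $\alpha\geq 1$, and $\omega\in\{0,1\}^L$, $A_\omega(y,z;\alpha,\beta)$ is the number of integers $m$ with $y\leq m<z$ for which there exists $n\in\mathbb Z$ such that $m=\lfloor n\alpha+\beta\rfloor$ and $s(\lfloor (n+\ell)\alpha+\beta\rfloor)\equiv \omega_\ell\bmod 2$ for all $0\leq \ell<L$. The maxima are to be read as suprema. *)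

(* Defs.v *)
From HB Require Import structures.
From mathcomp Require Import all_boot all_order all_algebra.
From mathcomp Require Import finmap.
From mathcomp Require Import all_classical all_reals all_analysis.
Set Implicit Arguments.
Unset Strict Implicit.
Unset Printing Implicit Defensive.
Import Order.TTheory GRing.Theory Num.Theory numFieldNormedType.Exports.
Local Open Scope classical_set_scope.
Local Open Scope ring_scope.

(** Number of 1s in the binary expansion of [n]; the range [i < n] reaches
    every nonzero digit because [n < 2 ^ n]. *)
Definition binary_digit_sum (n : nat) : nat :=
  (\sum_(i < n) (n %/ 2 ^ i) %% 2)%N.

Definition beatty {R : realType} (alpha beta : R) (n : int) : int :=
  Num.floor (n%:~R * alpha + beta).

(** If [0 <= y] and [0 <= alpha], the constraint [y <= m] forces all the values
    [beatty alpha beta (n + l)] below to be nonnegative, so that [absz] is only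
    the conversion to [nat]. *)
Definition beatty_pattern_set {R : realType} (L : nat) (omega : L.-tuple bool)
    (y z alpha beta : R) : set int :=
  [set m : int | y <= m%:~R < z /\
     exists n : int, m = beatty alpha beta n /\
       forall l : 'I_L,
         binary_digit_sum (absz (beatty alpha beta (n + l%:Z)))
           = tnth omega l %[mod 2]].

(** [fset_set] sends infinite sets to the empty set, but the set at hand is
    finite, being a bounded set of integers. *)
Definition beatty_pattern_count {R : realType} (L : nat)
    (omega : L.-tuple bool) (y z alpha beta : R) : nat :=
  #|` fset_set (beatty_pattern_set omega y z alpha beta)|%fset.

Definition discrepancy {R : realType} (L : nat) (omega : L.-tuple bool)
    (y z alpha beta : R) : R :=
  `| (beatty_pattern_count omega y z alpha beta)%:R
     - (z - y) / (2 ^+ L * alpha) |.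

Definition max_discrepancy {R : realType} (L : nat) (omega : L.-tuple bool)
    (x alpha : R) : \bar R :=
  ereal_sup
    [set ereal_sup
       [set (discrepancy omega yz.1 yz.2 alpha beta)%:E
          | beta in [set beta : R | 0 <= beta]]
       | yz in [set yz : R * R | 0 <= yz.1 <= yz.2 /\ yz.2 - yz.1 <= x]].

(* Main.v *)
Require Import Defs.
From HB Require Import structures.
From mathcomp Require Import all_boot all_order all_algebra finmap.
From mathcomp Require Import all_classical all_reals all_analysis.
From mathcomp Require Import measurable_realfun ring lra zify.
Set Implicit Arguments.
Unset Strict Implicit.
Unset Printing Implicit Defensive.
Import Order.TTheory GRing.Theory Num.Theory numFieldNormedType.Exports.
Local Open Scope classical_set_scope.
Local Open Scope ring_scope.

(** Expanding the indicator of the pattern reduces the count to correlation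
    sums, over [n < N], of products of Thue-Morse signs
    [t (floor ((n + l) alpha + beta))], [l] running through a nonempty set.
    Replacing [alpha] and [beta] by [a / 2 ^ q] and [b / 2 ^ q], these become
    sums over the integers [x_n = b + n a], read from bit [q] on; the bounds
    obtained are uniform in [b] and are averaged over [a] only.

    Averaging over [r] consecutive terms, a product of all the bits may be
    replaced by the product of the bits below some position [q + mu + rho],
    where [2 ^ (mu + rho)] slightly exceeds [alpha].  A Cauchy-Schwarz step over
    bins that fix the bits in [q, q + mu) then pairs [n] with [n + k] where
    [k a] is almost a multiple of [U = 2 ^ (q + mu)], so that only the window of
    bits [q + mu, q + mu + rho) survives; as [2 ^ mu] and [2 ^ rho] are both
    smaller than [N] (this is where [delta2 < 2/3] enters), the points [x_n] are
    equidistributed, for most [a], at the scale needed to replace the sum over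
    [n] by a mean over a full period.  On average over [a] the multiples [k a]
    behave like [M U] with [M] independent of [a], and a window average isolates
    the low bits of the window: there, for random base-[2 ^ m] digits of the
    position, of [a / U] and of [M], blocks of digits occur that force
    cancellation, which yields the power saving. *)

(** * Averages *)

(** The supremum over [beta] stands inside the integral, so every estimate must be a majorant in the
    slope alone, valid for every offset; only this majorant is averaged. Hence Cauchy-Schwarz is
    applied for fixed [a] and [b], and fourth powers are carried along until the slope is real
    again. Equidistribution is measured by indicators of windows, not by exponential sums: with
    lengths that are powers of two, the normalized window of length [H] evaluated at [c + k * a] has
    mean exactly [1] over [a] as soon as [0 < k <= H], so second moments reduce to their diagonals.
    The threshold [2/3] comes from cutting the exponent [d] of [2 ^ d], which is of the order of
    [D], into two halves [mu] and [rho]: as [N] is about [x / D], the condition is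
    [D ^ (1/2) < x / D]. One integer [T], with [2 ^ T] about [x ^ eta], measures every saving, and
    all other losses are bounded multiples of [T] in the exponents. *)

Definition avg (R : realFieldType) (n : nat) (F : nat -> R) : R :=
  (\sum_(i < n) F i) / n%:R.

Lemma eq_avg (R : realFieldType) n (F G : nat -> R) :
  (forall i, (i < n)%N -> F i = G i) -> avg n F = avg n G.
Proof. by move=> FG; congr (_ / _); apply: eq_bigr => i _; apply: FG. Qed.

Lemma avgD (R : realFieldType) n (F G : nat -> R) :
  avg n (fun i => F i + G i) = avg n F + avg n G.
Proof. by rewrite /avg big_split mulrDl. Qed.

Lemma avgN (R : realFieldType) n (F : nat -> R) :
  avg n (fun i => - F i) = - avg n F.
Proof. by rewrite /avg sumrN mulNr. Qed.

Lemma avgB (R : realFieldType) n (F G : nat -> R) :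
  avg n (fun i => F i - G i) = avg n F - avg n G.
Proof. by rewrite avgD avgN. Qed.

Lemma avgZ (R : realFieldType) n (c : R) (F : nat -> R) :
  avg n (fun i => c * F i) = c * avg n F.
Proof. by rewrite /avg -mulr_sumr mulrA. Qed.

Lemma avgZr (R : realFieldType) n (c : R) (F : nat -> R) :
  avg n (fun i => F i * c) = avg n F * c.
Proof. by rewrite /avg -mulr_suml mulrAC. Qed.

Lemma avg_const (R : realFieldType) n (c : R) :
  (0 < n)%N -> avg n (fun=> c) = c.
Proof.
by move=> n0; rewrite /avg sumr_const card_ord -[c *+ n]mulr_natr mulfK// pnatr_eq0 -lt0n.
Qed.

Lemma ler_avg (R : realFieldType) n (F G : nat -> R) :
  (forall i, (i < n)%N -> F i <= G i) -> avg n F <= avg n G.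
Proof.
move=> FG; rewrite /avg ler_wpM2r ?invr_ge0 ?ler0n//.
by apply: ler_sum => i _; apply: FG.
Qed.

Lemma avg_ge0 (R : realFieldType) n (F : nat -> R) :
  (forall i, (i < n)%N -> 0 <= F i) -> 0 <= avg n F.
Proof.
by move=> F0; rewrite /avg divr_ge0 ?ler0n ?sumr_ge0// => i _; apply: F0.
Qed.

Lemma avg_le (R : realFieldType) n (c : R) (F : nat -> R) : 0 <= c ->
  (forall i, (i < n)%N -> F i <= c) -> avg n F <= c.
Proof.
case: n => [|n] c0 Fc; first by rewrite /avg big_ord0 mul0r.
by apply: le_trans (ler_avg Fc) _; rewrite avg_const.
Qed.

Lemma ler_norm_avg (R : realFieldType) n (F : nat -> R) :
  `|avg n F| <= avg n (fun i => `|F i|).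
Proof.
rewrite /avg normrM normfV (ger0_norm (ler0n _ _)) ler_wpM2r ?invr_ge0 ?ler0n//.
exact: ler_norm_sum.
Qed.

Lemma norm_avg_le1 (R : realFieldType) n (F : nat -> R) :
  (forall i, (i < n)%N -> `|F i| <= 1) -> `|avg n F| <= 1.
Proof. by move=> F1; apply: le_trans (ler_norm_avg _ _) _; apply: avg_le. Qed.

Lemma exchange_avg (R : realFieldType) n m (F : nat -> nat -> R) :
  avg n (fun i => avg m (fun j => F i j)) =
  avg m (fun j => avg n (fun i => F i j)).
Proof.
rewrite /avg -!mulr_suml exchange_big /= -!mulrA; congr (_ * _).
by rewrite mulrC.
Qed.

Lemma avg_mul (R : realFieldType) n m (F G : nat -> R) :
  avg n F * avg m G = avg n (fun i => avg m (fun j => F i * G j)).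
Proof. by rewrite -avgZr; apply: eq_avg => i _; rewrite avgZ. Qed.

Lemma avg_sqr (R : realFieldType) n (F : nat -> R) :
  avg n F ^+ 2 = avg n (fun i => avg n (fun j => F i * F j)).
Proof. by rewrite expr2 avg_mul. Qed.

Lemma avg_CS (R : realFieldType) n (F G : nat -> R) :
  avg n (fun i => F i * G i) ^+ 2 <=
  avg n (fun i => F i ^+ 2) * avg n (fun i => G i ^+ 2).
Proof.
have : 0 <= avg n (fun i => avg n (fun j => (F i * G j - F j * G i) ^+ 2)).
  by do 2! (apply: avg_ge0 => ? _); apply: sqr_ge0.
have -> : avg n (fun i => avg n (fun j => (F i * G j - F j * G i) ^+ 2)) =
    avg n (fun i => F i ^+ 2) * avg n (fun i => G i ^+ 2) +
    avg n (fun i => G i ^+ 2) * avg n (fun i => F i ^+ 2)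
    - 2 * (avg n (fun i => F i * G i) * avg n (fun i => F i * G i)).
  rewrite !avg_mul -avgZ -avgD -avgB; apply: eq_avg => i _.
  by rewrite -avgZ -avgD -avgB; apply: eq_avg => j _; ring.
by rewrite expr2; lra.
Qed.

Lemma avg_sqr_le (R : realFieldType) n (F : nat -> R) :
  avg n F ^+ 2 <= avg n (fun i => F i ^+ 2).
Proof.
case: n => [|n]; first by rewrite /avg !big_ord0 !mul0r expr0n.
have := avg_CS n.+1 F (fun=> 1).
rewrite expr1n avg_const// mulr1.
by under [X in X ^+ 2 <= _]eq_avg do rewrite mulr1.
Qed.

(** * Periodic functions, blocks and translates *)

Definition periodic (T : Type) (W : nat) (F : nat -> T) :=
  forall x, F (x + W)%N = F x.

Lemma periodicM (T : Type) W (F : nat -> T) k x :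
  periodic W F -> F (x + k * W)%N = F x.
Proof.
move=> pF; elim: k => [|k IHk]; first by rewrite mul0n addn0.
by rewrite mulSn addnCA [(W + _)%N]addnC pF.
Qed.

Lemma periodic_mod (T : Type) W (F : nat -> T) x :
  periodic W F -> F (x %% W)%N = F x.
Proof. by move=> pF; rewrite {2}(divn_eq x W) addnC periodicM. Qed.

Lemma sum_shift (R : realFieldType) W (F : nat -> R) c : periodic W F ->
  \sum_(i < W) F (i + c)%N = \sum_(i < W) F i.
Proof.
move=> pF; elim: c => [|c IHc]; first by apply: eq_bigr => i _; rewrite addn0.
rewrite -{}IHc; case: W pF => [|W] pF; first by rewrite !big_ord0.
rewrite big_ord_recr [RHS]big_ord_recl /= addrC; congr (_ + _).
  by rewrite add0n addnS -addSn addnC pF.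
by apply: eq_bigr => i _; rewrite /bump /= addnS.
Qed.

Lemma avg_shift (R : realFieldType) W (F : nat -> R) c : periodic W F ->
  avg W (fun x => F (x + c)%N) = avg W F.
Proof. by move=> pF; rewrite /avg sum_shift. Qed.

Lemma sum_mul (R : realFieldType) m n (F : nat -> R) :
  \sum_(i < m * n) F i = \sum_(j < n) \sum_(i < m) F (i + m * j)%N.
Proof.
elim: n => [|n IHn]; first by rewrite muln0 !big_ord0.
rewrite mulnS addnC big_split_ord /= IHn big_ord_recr /=; congr (_ + _).
by apply: eq_bigr => i _; rewrite addnC.
Qed.

Lemma avg_mulE (R : realFieldType) m n (F : nat -> R) :
  avg (m * n) F = avg n (fun j => avg m (fun i => F (i + m * j)%N)).
Proof.
by rewrite /avg sum_mul -mulr_suml natrM invfM mulrA.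
Qed.

Lemma avg_divn (R : realFieldType) m n (F : nat -> R) : (0 < m)%N ->
  avg (m * n) (fun i => F (i %/ m)%N) = avg n F.
Proof.
move=> m0; rewrite avg_mulE; apply: eq_avg => j _.
rewrite -[RHS](avg_const (F j) m0); apply: eq_avg => i im.
by rewrite addnC (mulnC m) divnMDl// divn_small// addn0.
Qed.

Lemma avg_periodic (R : realFieldType) m n (F : nat -> R) : (0 < n)%N ->
  periodic m F -> avg (m * n) F = avg m F.
Proof.
move=> n0 pF; rewrite avg_mulE -[RHS](avg_const _ n0); apply: eq_avg => j _.
by apply: eq_avg => i _; rewrite (mulnC m) periodicM.
Qed.

Lemma avg_rev (R : realFieldType) W (F : nat -> R) : periodic W F ->
  avg W (fun x => F (W - x)%N) = avg W F.
Proof.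
case: W => [|W] pF; first by rewrite /avg !big_ord0.
rewrite /avg; congr (_ / _).
rewrite big_ord_recl [RHS]big_ord_recl /= subn0 -[X in F X]add0n pF; congr (_ + _).
rewrite (reindex_inj rev_ord_inj) /=; apply: eq_bigr => i _.
by congr F; rewrite /bump /=; have := ltn_ord i; lia.
Qed.

Lemma sum_translate (R : realFieldType) N k (g : nat -> R) :
  \sum_(i < N) g i + \sum_(i < k) g (N + i)%N =
  \sum_(i < k) g i + \sum_(i < N) g (i + k)%N.
Proof.
transitivity (\sum_(i < N + k) g i); first by rewrite big_split_ord.
rewrite addnC big_split_ord /=; congr (_ + _).
by apply: eq_bigr => i _; rewrite addnC.
Qed.

Lemma avg_translate (R : realFieldType) N k (g : nat -> R) :
  (forall n, `|g n| <= 1) ->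
  `|avg N g - avg N (fun n => g (n + k)%N)| <= 2 * k%:R / N%:R.
Proof.
move=> g1; rewrite /avg -mulrBl normrM normfV (ger0_norm (ler0n _ N)).
rewrite ler_wpM2r ?invr_ge0 ?ler0n//.
have E := sum_translate N k g.
have -> : \sum_(i < N) g i - \sum_(i < N) g (i + k)%N =
   \sum_(i < k) (g i - g (N + i)%N).
  by rewrite sumrB; lra.
apply: le_trans (ler_norm_sum _ _ _) _.
apply: (@le_trans _ _ (\sum_(i < k) 2)).
  apply: ler_sum => i _; apply: le_trans (ler_normB _ _) _.
  by have := g1 i; have := g1 (N + i)%N; lra.
by rewrite sumr_const card_ord mulr_natr.
Qed.

(* For each [k], every value of [|k - k'|] is taken at most twice. *)
Lemma avg_dist_le (R : realFieldType) K (F : nat -> R) :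
  (forall e, 0 <= F e) ->
  avg K (fun k => avg K (fun k' => F ((k - k') + (k' - k))%N)) <= 2 * avg K F.
Proof.
move=> F0; apply: avg_le => [|k kK].
  by rewrite mulr_ge0// avg_ge0.
rewrite /avg mulrA ler_wpM2r ?invr_ge0 ?ler0n//.
have [j ->] : exists j, K = (k.+1 + j)%N by exists (K - k.+1)%N; lia.
rewrite [X in X <= _]big_split_ord /=.
have -> : \sum_(i < k.+1) F (k - i + (i - k))%N = \sum_(i < k.+1) F i.
  rewrite (reindex_inj rev_ord_inj) /=; apply: eq_bigr => i _.
  by congr F; have := ltn_ord i; lia.
rewrite mulr_natl mulr2n lerD//.
  by rewrite [leRHS]big_split_ord /= lerDl sumr_ge0.
have -> : \sum_(i < j) F (k - (k.+1 + i) + (k.+1 + i - k))%N = \sum_(i < j) F i.+1.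
  by apply: eq_bigr => i _; congr F; lia.
have -> : (k.+1 + j = j.+1 + k)%N by lia.
rewrite big_split_ord /= big_ord_recl /= -addrA addrCA lerDl.
by rewrite addr_ge0// sumr_ge0.
Qed.

Lemma avg_markov (R : realFieldType) n (F : nat -> R) (c : R) : 0 < c ->
  (forall i, 0 <= F i) ->
  avg n (fun i => (c < F i)%R%:R) <= avg n F / c.
Proof.
move=> c0 F0; rewrite -avgZr; apply: ler_avg => i _.
case: ltP => [cF|_]; last by rewrite divr_ge0// ltW.
by rewrite ler_pdivlMr// mul1r ltW.
Qed.

(** * Thue-Morse signs *)

(** Cutting the digits below [i] removes the fractional bits, cutting them at [j] makes the sign
    periodic. *)
Definition sg (R : realFieldType) (i j x : nat) : R :=
  (-1) ^+ (\sum_(i <= l < j) (x %/ 2 ^ l) %% 2)%N.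

Definition tm (R : realFieldType) (n : nat) : R := sg R 0 n n.

Lemma sg_sqr (R : realFieldType) i j x : sg R i j x * sg R i j x = 1.
Proof. by rewrite -expr2 sqrr_sign. Qed.

Lemma norm_sg (R : realFieldType) i j x : `|sg R i j x| = 1.
Proof. exact: normr_sign. Qed.

Lemma sg_cat (R : realFieldType) i j k x : (i <= j <= k)%N ->
  sg R i k x = sg R i j x * sg R j k x.
Proof.
by case/andP=> ij jk; rewrite /sg (@big_cat_nat _ _ _ j i k)//= exprD.
Qed.

Lemma sg_div (R : realFieldType) i j x :
  sg R i (i + j) x = sg R 0 j (x %/ 2 ^ i).
Proof.
rewrite /sg -{1}[i]add0n big_addn addKn; congr (_ ^+ _).
by apply: eq_bigr => l _; rewrite -divnMA -expnD addnC.
Qed.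

Lemma sg_periodic (R : realFieldType) i j : periodic (2 ^ j) (sg R i j).
Proof.
move=> x; rewrite /sg; congr (_ ^+ _).
rewrite big_nat_cond [RHS]big_nat_cond; apply: eq_bigr => l /andP[/andP[_ lj] _].
rewrite -(subnKC lj) addSnnS expnD mulnC divnDMl ?expn_gt0// expnS.
by rewrite -modnDmr modnMr addn0.
Qed.

Lemma tmE (R : realFieldType) n k : (n < 2 ^ k)%N -> tm R n = sg R 0 k n.
Proof.
move=> nk.
have aux a b : (n < 2 ^ a)%N -> sg R 0 a n = sg R 0 (a + b) n.
  move=> na; rewrite [RHS](@sg_cat _ _ a)//; last by rewrite leq0n leq_addr.
  rewrite [X in _ * X]/sg big_nat_cond big1 ?mulr1// => l /andP[/andP[al _] _].
  by rewrite divn_small ?mod0n// (leq_trans na)// leq_exp2l.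
exact: etrans (aux n k (ltn_expl n (ltnSn 1))) (etrans (congr1 (fun c => sg R 0 c n) (addnC n k)) (esym (aux k n nk))).
Qed.

Lemma tm_cat (R : realFieldType) m y z : (z < 2 ^ m)%N ->
  tm R (2 ^ m * y + z) = tm R y * tm R z.
Proof.
move=> zm.
have ylt : (y < 2 ^ y)%N by apply: ltn_expl.
have h : (2 ^ m * y + z < 2 ^ (m + y))%N.
  rewrite expnD (@leq_trans (2 ^ m * y.+1))//; first by rewrite mulnS; lia.
  by rewrite leq_mul2l ylt orbT.
rewrite (tmE _ h) (@sg_cat _ 0 m)//; last by rewrite leq0n leq_addr.
rewrite sg_div mulrC; congr (_ * _).
  by rewrite mulnC divnMDl ?expn_gt0// divn_small// addn0.
rewrite (tmE _ zm) -[LHS](periodic_mod _ (sg_periodic R 0 m)) mulnC.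
by rewrite modnMDl modn_small.
Qed.

Lemma tm_small (R : realFieldType) :
  [/\ tm R 0 = 1, tm R 1 = -1, tm R 2 = -1, tm R 3 = 1 & tm R 4 = -1].
Proof.
split; rewrite /tm /sg; do ?rewrite big_nat_recr//=; rewrite big_geq//= ?addn0 ?expr0//.
all: by rewrite ?divn1 ?expr1 ?expr2 ?mulrNN ?mulr1.
Qed.

Lemma tm_sqr (R : realFieldType) x : tm R x * tm R x = 1.
Proof. exact: sg_sqr. Qed.

(* The largest element of [s] is the only one for which the addition of [w]
   at height [2 ^ p'] carries; this leaves the sign
   [t (w + 1) t (w + 2) (t w t (w + 1)) ^ (size s - 1)], which is not constant
   in [w < 3]. *)
Lemma block_cancel (R : realFieldType) (p p' : nat) (s : seq nat)
    (e e' : nat -> nat) :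
  s != [::] -> uniq s -> (forall l, l \in s -> (l < 2 ^ p')%N) ->
  (forall l, l \in s -> (e l < 2 ^ p)%N /\ (e' l < 2 ^ p)%N) ->
  let m := (p + p' + 3)%N in
  let P z := \prod_(l <- s) (sg R 0 m (z + l * 2 ^ p + e l) *
                             sg R 0 m (z + l * 2 ^ p + 2 ^ (p + p') + e' l)) in
  exists z1 z2, [/\ z1 != z2, P z1 = - P z2 &
    forall z l, z \in [:: z1; z2] -> l \in s ->
      (z + l * 2 ^ p + e l < 2 ^ m)%N /\
      (z + l * 2 ^ p + 2 ^ (p + p') + e' l < 2 ^ m)%N].
Proof.
move=> s0 us sp esp m P.
have [lm lms lmax] : exists2 lm, lm \in s & forall l, l \in s -> (l <= lm)%N.
  case: s s0 {us sp esp P} => // a s _; elim: s a => [|b s IHs] a.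
    by exists a; rewrite ?mem_head// => l; rewrite inE => /eqP->.
  have [lm lms H] := IHs b.
  have [ale|ale] := leqP a lm.
    exists lm; first by rewrite in_cons lms orbT.
    by move=> l; rewrite in_cons => /predU1P[->//|/H].
  exists a; rewrite ?mem_head// => l; rewrite in_cons => /predU1P[->//|/H].
  by move/leq_trans; apply; apply: ltnW.
have lmp := sp _ lms.
have pp : (0 < 2 ^ p)%N by rewrite expn_gt0.
pose q := (2 ^ p')%N; pose z w := (2 ^ p * (q * w + (q - lm)))%N.
(* The three top bits hold the part of height [2 ^ (p + p')], which is at most [4] after both
   additions and the carry; nothing leaves the block of [m] bits. *)
have mE : (2 ^ m = 2 ^ p * (q * 8))%N by rewrite /m !expnD -mulnA.
have low w l : l \in s -> (z w + l * 2 ^ p = 2 ^ p * (q * w + (q - (lm - l))))%N.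
  by move=> ls; have llm := lmax _ ls; rewrite /z (mulnC l) -mulnDr -addnA; congr (_ * (_ + _))%N; rewrite /q in lmp *; lia.
have high w l : (z w + l * 2 ^ p + 2 ^ (p + p') = z w.+1 + l * 2 ^ p)%N.
  by rewrite /z expnD -/q; ring.
have ltm w l c : (w <= 3)%N -> l \in s -> (c < 2 ^ p)%N -> (z w + l * 2 ^ p + c < 2 ^ m)%N.
  move=> w2 ls cp; rewrite low// mE.
  apply: (@leq_trans (2 ^ p * (q * w + (q - (lm - l))).+1)%N); first by rewrite mulnS; lia.
  by rewrite leq_mul2l; apply/orP; right; nia.
have bd w l : (w <= 2)%N -> l \in s -> (z w + l * 2 ^ p + e l < 2 ^ m)%N /\
      (z w + l * 2 ^ p + 2 ^ (p + p') + e' l < 2 ^ m)%N.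
  by move=> w2 ls; rewrite high; have [? ?] := esp _ ls; split; apply: ltm => //; lia.
have val w l c : (w <= 3)%N -> l \in s -> (c < 2 ^ p)%N ->
    sg R 0 m (z w + l * 2 ^ p + c) =
    (if l == lm then tm R w.+1 else tm R w * tm R (q - (lm - l))) * tm R c.
  move=> w3 ls cp; rewrite -tmE; last exact: ltm.
  rewrite low// tm_cat//; congr (_ * _).
  case: eqP => [->|/eqP lneq].
    by rewrite subnn subn0 -mulnSr -[(q * _)%N]addn0 tm_cat ?expn_gt0//
       (let: And5 h _ _ _ _ := tm_small R in h) mulr1.
  have := lmax _ ls; rewrite leq_eqVlt (negPf lneq) /= => llm.
  by rewrite tm_cat//; rewrite /q in lmp *; lia.
pose c := \prod_(l <- s) (tm R (e l) * tm R (e' l)).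
pose k := size (rem lm s).
have PE w : (w <= 2)%N ->
    P (z w) = c * (tm R w.+1 * tm R w.+2 * (tm R w * tm R w.+1) ^+ k).
  move=> w2; rewrite /P.
  transitivity (\prod_(l <- s) ((tm R (e l) * tm R (e' l)) *
    (if l == lm then tm R w.+1 * tm R w.+2 else tm R w * tm R w.+1))).
    rewrite big_seq [RHS]big_seq; apply: eq_bigr => l ls.
    have [? ?] := esp _ ls.
    rewrite high !val//; last by lia.
    case: eqP => _; first by ring.
    have := tm_sqr R (q - (lm - l)) => h.
    transitivity (tm R (e l) * tm R (e' l) * (tm R w * tm R w.+1) *
       (tm R (q - (lm - l)) * tm R (q - (lm - l)))); first by ring.
    by rewrite h mulr1.
  rewrite big_split /= -/c; congr (_ * _).
  rewrite (big_rem lm)//= eqxx; congr (_ * _).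
  rewrite big_seq; under eq_bigr => l.
    rewrite mem_rem_uniq// inE => /andP[/negPf -> _]; over.
  by rewrite -big_seq big_const_seq count_predT iter_mulr_1.
have [t0 t1 t2 t3 t4] := tm_small R.
have zinj a b : (a < b)%N -> z a != z b.
  move=> ab; rewrite /z; apply/eqP => /eqP; rewrite eqn_mul2l -leqn0 leqNgt pp /=.
  have : (0 < q)%N by rewrite expn_gt0.
  by move=> q0 /eqP; nia.
(* For [w = 0, 1, 2] the sign is [(-1) ^ k], [-1] and [- (-1) ^ k]; the parity of [k] tells which
   one is opposite to the sign at [w = 0]. *)
have [ek|ok] := boolP (odd k).
  exists (z 0%N), (z 2); split; first exact: zinj.
    rewrite !PE// t0 t1 t2 t3 t4 -mulrN; congr (_ * _).
    by rewrite !mul1r mulr1 -signr_odd ek /=; ring.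
  by move=> ? l; rewrite !inE => /orP[]/eqP-> ls; apply: bd.
exists (z 0%N), (z 1%N); split; first exact: zinj.
  rewrite !PE// t0 t1 t2 t3 -mulrN; congr (_ * _).
  by rewrite mulrNN !mul1r -signr_odd (negPf ok) /= expr1n; ring.
by move=> ? l; rewrite !inE => /orP[]/eqP-> ls; apply: bd.
Qed.

(** * Cancellation from random digits *)

Lemma avg_modn_divn (R : realFieldType) m n (F : nat -> nat -> R) : (0 < m)%N ->
  avg (m * n) (fun i => F (i %% m)%N (i %/ m)%N) =
  avg m (fun i => avg n (fun j => F i j)).
Proof.
move=> m0; rewrite avg_mulE exchange_avg; apply: eq_avg => i im.
apply: eq_avg => j _; rewrite addnC (mulnC m).
by rewrite divnMDl// modnMDl divn_small// addn0 modn_small.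
Qed.

Lemma avg_eqn (R : realFieldType) n c : (c < n)%N ->
  avg n (fun i => (i == c)%:R : R) = n%:R^-1.
Proof.
move=> cn; rewrite /avg (bigD1 (Ordinal cn))//= eqxx big1 ?addr0 ?mul1r//.
by move=> i; rewrite -val_eqE /= => /negPf->.
Qed.

(* The three numbers are read in base [2 ^ m], lowest digits first; each
   position that carries the digits [(0, a0, b0)] contributes a factor
   [1 - 2 / 2 ^ m]. *)
Fixpoint digit_weight (R : realFieldType) (m a0 b0 n x a b : nat) : R :=
  if n is n'.+1 then
    (1 - 2 / (2 ^ m)%:R * (((x %% 2 ^ m)%N == 0%N)%:R *
      (((a %% 2 ^ m)%N == a0)%:R * ((b %% 2 ^ m)%N == b0)%:R))) *
    digit_weight R m a0 b0 n' (x %/ 2 ^ m) (a %/ 2 ^ m) (b %/ 2 ^ m)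
  else 1.

Lemma digit_factor_ge0 (R : realFieldType) m (b1 b2 b3 : bool) : (0 < m)%N ->
  0 <= 1 - 2 / (2 ^ m)%:R * (b1%:R * (b2%:R * b3%:R)) :> R.
Proof.
move=> m0; have h : 2 / (2 ^ m)%:R <= 1 :> R.
  rewrite ler_pdivrMr ?ltr0n ?expn_gt0// mul1r ler_nat.
  by apply: (@leq_trans (2 ^ 1)%N) => //; rewrite leq_exp2l.
have h0 : 0 <= 2 / (2 ^ m)%:R :> R by rewrite divr_ge0.
by case: b1; case: b2; case: b3 => /=; lra.
Qed.

Lemma digit_weight_ge0 (R : realFieldType) m a0 b0 n x a b : (0 < m)%N ->
  0 <= digit_weight R m a0 b0 n x a b.
Proof.
move=> m0; elim: n x a b => [|n IHn] x a b //=.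
by rewrite mulr_ge0// digit_factor_ge0.
Qed.

(** Over full ranges the base-[2 ^ m] digits of the three numbers are independent and uniform, so
    the mean is a product over positions. The required triple of digits has probability
    [(2 ^ m) ^ -3], and its weight is [2 / 2 ^ m]. *)
Lemma avg_digit_weight (R : realFieldType) m a0 b0 n i j k :
  (a0 < 2 ^ m)%N -> (b0 < 2 ^ m)%N ->
  avg (2 ^ (m * n + i)) (fun x => avg (2 ^ (m * n + j)) (fun a =>
    avg (2 ^ (m * n + k)) (fun b => digit_weight R m a0 b0 n x a b))) =
  (1 - 2 / (2 ^ m)%:R ^+ 4) ^+ n.
Proof.
move=> am bm; have m0 : (0 < 2 ^ m)%N by rewrite expn_gt0.
elim: n => [|n IHn].
  by rewrite /= !avg_const ?expn_gt0.
set M := (2 ^ m)%N in am bm m0 *.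
have sz c : (2 ^ (m * n.+1 + c) = M * 2 ^ (m * n + c))%N.
  by rewrite mulnS -addnA expnD.
rewrite !sz.
pose f x a b : R := 1 - 2 / M%:R * ((x == 0%N)%:R * ((a == a0)%:R * (b == b0)%:R)).
pose g := digit_weight R m a0 b0 n.
set X := (2 ^ (m * n + i))%N; set Y := (2 ^ (m * n + j))%N; set Z := (2 ^ (m * n + k))%N.
transitivity (avg M (fun x => avg M (fun a => avg M (fun b => f x a b))) *
    avg X (fun x => avg Y (fun a => avg Z (fun b => g x a b)))).
  rewrite avg_mul.
  rewrite (avg_modn_divn _ (fun x x' => avg (M * Y) (fun a => avg (M * Z) (fun b =>
    f x (a %% M)%N (b %% M)%N * g x' (a %/ M)%N (b %/ M)%N))))//.
  apply: eq_avg => x _; apply: eq_avg => x' _; rewrite avg_mul.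
  rewrite (avg_modn_divn _ (fun a a' => avg (M * Z) (fun b =>
    f x a (b %% M)%N * g x' a' (b %/ M)%N)))//.
  apply: eq_avg => a _; apply: eq_avg => a' _; rewrite avg_mul.
  by rewrite (avg_modn_divn _ (fun b b' => f x a b * g x' a' b')).
rewrite IHn [RHS]exprS; congr (_ * _).
have -> : avg M (fun x => avg M (fun a => avg M (fun b => f x a b))) =
    1 - 2 / M%:R * (avg M (fun x => (x == 0%N)%:R) *
       (avg M (fun a => (a == a0)%:R) * avg M (fun b => (b == b0)%:R))).
  rewrite !avg_mul -avgZ -[X in X - _](avg_const _ m0) -avgB.
  apply: eq_avg => x _.
  rewrite -avgZ -[X in X - _](avg_const _ m0) -avgB.
  apply: eq_avg => a _.
  rewrite -!avgZ -[X in X - _](avg_const _ m0) -avgB.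
  by apply: eq_avg => b _.
rewrite !avg_eqn//.
have : M%:R != 0 :> R by rewrite pnatr_eq0 -lt0n.
by move=> Mn0; field.
Qed.

(** Induction on blocks of [m] bits from the bottom: the lowest block of [z] contributes a sign
    [lo], and the remaining average [B] sees this block only through carries. These are at most
    [l + 3], hence again below [2 ^ p]: this is the role of [2 ^ p' + 3 <= 2 ^ p]. When the lowest
    digits are the prescribed ones, [block_cancel] gives two values of the block without carries,
    hence with the same [B], and with opposite signs. Their terms cancel, which leaves the factor
    [1 - 2 / 2 ^ m]. *)
Lemma digit_contraction (R : realFieldType) (p p' : nat) (s : seq nat) :
  let m := (p + p' + 3)%N in
  (2 ^ p' + 3 <= 2 ^ p)%N ->
  s != [::] -> uniq s -> (forall l, l \in s -> (l < 2 ^ p')%N) ->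
  forall n k x a b (e e' : nat -> nat),
  (forall l, l \in s -> (e l < 2 ^ p)%N /\ (e' l < 2 ^ p)%N) ->
  `|avg (2 ^ (m * n)) (fun z => \prod_(l <- s)
     (sg R 0 (m * n + k) (z + x + l * a + e l) *
      sg R 0 (m * n + k) (z + x + l * a + b + e' l)))| <=
  digit_weight R m (2 ^ p) (2 ^ (p + p')) n x a b.
Proof.
move=> m pp' s0 us sp; elim=> [|n IHn] k x a b e e' es.
  rewrite /=; apply: norm_avg_le1 => z _.
  by rewrite normr_prod big1// => l _; rewrite normrM !norm_sg mulr1.
rewrite /=; set M := (2 ^ m)%N.
have M0 : (0 < M)%N by rewrite expn_gt0.
have pM : (2 ^ p <= M)%N by rewrite leq_exp2l// /m; lia.
have bM : (2 ^ (p + p') < M)%N by rewrite ltn_exp2l// /m; lia.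
set x0 := (x %% M)%N; set x1 := (x %/ M)%N.
set a0 := (a %% M)%N; set a1 := (a %/ M)%N.
set b0 := (b %% M)%N; set b1 := (b %/ M)%N.
have xE : x = (x1 * M + x0)%N by exact: divn_eq.
have aE : a = (a1 * M + a0)%N by exact: divn_eq.
have bE : b = (b1 * M + b0)%N by exact: divn_eq.
have x0M : (x0 < M)%N by rewrite ltn_mod.
have a0M : (a0 < M)%N by rewrite ltn_mod.
have b0M : (b0 < M)%N by rewrite ltn_mod.
pose E z l := ((z + x0 + l * a0 + e l) %/ M)%N.
pose E' z l := ((z + x0 + l * a0 + b0 + e' l) %/ M)%N.
pose lo z : R := \prod_(l <- s) (sg R 0 m (z + x + l * a + e l) *
                                 sg R 0 m (z + x + l * a + b + e' l)).
pose B z : R := avg (2 ^ (m * n)) (fun z1 => \prod_(l <- s)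
     (sg R 0 (m * n + k) (z1 + x1 + l * a1 + E z l) *
      sg R 0 (m * n + k) (z1 + x1 + l * a1 + b1 + E' z l))).
have -> : avg (2 ^ (m * n.+1)) (fun z => \prod_(l <- s)
     (sg R 0 (m * n.+1 + k) (z + x + l * a + e l) *
      sg R 0 (m * n.+1 + k) (z + x + l * a + b + e' l))) =
   avg M (fun z => lo z * B z).
  rewrite mulnS expnD avg_mulE exchange_avg; apply: eq_avg => z0 z0M.
  rewrite -avgZ; apply: eq_avg => z1 _.
  rewrite /lo -big_split /=; apply: eq_bigr => l _.
  have split1 y w : sg R 0 (m + m * n + k) (y + w * M) =
      sg R 0 m y * sg R 0 (m * n + k) (w + y %/ M).
    rewrite (@sg_cat _ 0 m)//; last by rewrite leq0n -addnA leq_addr.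
    rewrite -addnA sg_div (periodicM _ _ (@sg_periodic R 0 m)).
    by rewrite (addnC y) divnMDl.
  have -> : (z0 + 2 ^ m * z1 + x + l * a + e l =
     (z0 + x0 + l * a0 + e l) + (z1 + x1 + l * a1) * M)%N.
    by rewrite {1}xE {1}aE -/M; ring.
  have -> : (z0 + 2 ^ m * z1 + x + l * a + b + e' l =
     (z0 + x0 + l * a0 + b0 + e' l) + (z1 + x1 + l * a1 + b1) * M)%N.
    by rewrite {1}xE {1}aE {1}bE -/M; ring.
  have -> : (z0 + x + l * a + e l =
     (z0 + x0 + l * a0 + e l) + (x1 + l * a1) * M)%N.
    by rewrite {1}xE {1}aE; ring.
  have -> : (z0 + x + l * a + b + e' l =
     (z0 + x0 + l * a0 + b0 + e' l) + (x1 + l * a1 + b1) * M)%N.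
    by rewrite {1}xE {1}aE {1}bE; ring.
  rewrite !split1 !(periodicM _ _ (@sg_periodic R 0 m)) /E /E'.
  by rewrite mulrACA.
have lo1 z : `|lo z| = 1.
  by rewrite normr_prod big1// => l _; rewrite normrM !norm_sg mulr1.
set G := digit_weight _ _ _ _ n x1 a1 b1.
have G0 : 0 <= G by apply: digit_weight_ge0; rewrite /m addnC.
have BG z : (z < M)%N -> `|B z| <= G.
  move=> zM; apply: IHn => l ls; have := sp _ ls; have [] := es _ ls => h1 h2 h3.
  have e1 : (l * a0 <= l * M)%N by rewrite leq_mul2l ltnW ?orbT.
  split; rewrite /E /E' ltn_divLR//.
    apply: (@leq_trans ((l + 3) * M)); first by rewrite mulnDl; lia.
    by rewrite leq_mul2r; apply/orP; right; lia.
  apply: (@leq_trans ((l + 4) * M)); first by rewrite mulnDl; lia.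
  by rewrite leq_mul2r; apply/orP; right; lia.
have triv : `|avg M (fun z => lo z * B z)| <= G.
  apply: le_trans (ler_norm_avg _ _) _; apply: avg_le => // z zM.
  by rewrite normrM lo1 mul1r BG.
case: (x0 =P 0%N) => [x00|]; last by rewrite mul0r mulr0 subr0 mul1r.
case: (a0 =P (2 ^ p)%N) => [a00|]; last by rewrite mul0r !mulr0 subr0 mul1r.
case: (b0 =P (2 ^ (p + p'))%N) => [b00|]; last by rewrite !mulr0 subr0 mul1r.
rewrite !mulr1.
have [z1 [z2 [z12 Pz bz]]] := block_cancel R s0 us sp es.
have [l0 l0s] : exists l, l \in s by case: (s) s0 => // l s' _; exists l; rewrite mem_head.
have z1M : (z1 < M)%N by have [+ _] := bz z1 l0 (mem_head _ _) l0s; rewrite -/m -/M; lia.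
have z2M : (z2 < M)%N.
  by have [||+ _] := bz z2 l0; rewrite ?inE ?eqxx ?orbT// -/m -/M; lia.
have loE z : lo z = \prod_(l <- s) (sg R 0 m (z + l * 2 ^ p + e l) *
                             sg R 0 m (z + l * 2 ^ p + 2 ^ (p + p') + e' l)).
  apply: eq_bigr => l _.
  have -> : (z + x + l * a + e l = (z + l * 2 ^ p + e l) + (x1 + l * a1) * M)%N.
    by rewrite {1}xE {1}aE x00 a00; ring.
  have -> : (z + x + l * a + b + e' l =
     (z + l * 2 ^ p + 2 ^ (p + p') + e' l) + (x1 + l * a1 + b1) * M)%N.
    by rewrite {1}xE {1}aE {1}bE x00 a00 b00; ring.
  by rewrite !(periodicM _ _ (@sg_periodic R 0 m)).
have BE : B z1 = B z2.
  apply: eq_avg => z _; rewrite big_seq [RHS]big_seq; apply: eq_bigr => l ls.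
  have [h1 h2] := bz z1 l (mem_head _ _) ls.
  have [||h3 h4] := bz z2 l; rewrite ?inE ?eqxx ?orbT//.
  by rewrite /E /E' x00 a00 b00 !addn0 !divn_small.
rewrite /avg normrM normfV (ger0_norm (ler0n _ _)) ler_pdivrMr ?ltr0n//.
rewrite (bigD1 (Ordinal z1M))//= (bigD1 (Ordinal z2M))/=; last by rewrite eq_sym.
rewrite addrA BE !loE -/m Pz mulNr addNr add0r.
apply: le_trans (ler_norm_sum _ _ _) _.
have -> : (1 - 2 / M%:R) * G * M%:R = (M%:R - 2) * G.
  by have : M%:R != 0 :> R; [rewrite pnatr_eq0 -lt0n | move=> ?; field].
apply: (@le_trans _ _
  (\sum_(i < M | (i != Ordinal z1M) && (i != Ordinal z2M)) G)).
  by apply: ler_sum => i _; rewrite normrM lo1 mul1r BG.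
have : \sum_(i < M) G = M%:R * G by rewrite sumr_const card_ord mulr_natl.
rewrite (bigD1 (Ordinal z1M))//= (bigD1 (Ordinal z2M))/=; last by rewrite eq_sym.
by lra.
Qed.

(** * Equidistribution of arithmetic progressions on average *)

Lemma avg_coprime (R : realFieldType) (S k c : nat) (G : nat -> R) :
  coprime k S -> periodic S G ->
  avg S (fun s => G (c + k * s)%N) = avg S G.
Proof.
case: S => [|S] kS pG; first by rewrite /avg !big_ord0.
pose f (s : 'I_S.+1) : 'I_S.+1 := Ordinal (ltn_pmod (c + k * s) (ltn0Sn S)).
have finj : injective f.
  move=> i j [] /eqP; rewrite eqn_modDl => h; apply: val_inj => /=.
  wlog ij : i j h / (i <= j)%N.
    by move=> W; have [/W->//|/ltnW /W] := leqP i j; first by rewrite eq_sym => /(_ h) ->.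
  move: h; rewrite eq_sym eqn_mod_dvd; last by rewrite leq_mul2l ij orbT.
  rewrite -mulnBr Gauss_dvdr; last by rewrite coprime_sym.
  have jS := ltn_ord j.
  by move/dvdnP => [[|q]]; lia.
rewrite /avg; congr (_ / _); rewrite [RHS](reindex_inj finj) /=.
by apply: eq_bigr => i _; rewrite periodic_mod.
Qed.

(* Normalized to have mean [1] over a period. *)
Definition win (R : realFieldType) (W H z : nat) : R :=
  ((z %% W < H)%N)%:R * (W%:R / H%:R).

(** The autocorrelation of the window: up to normalization, the proportion of window positions that
    see two points at distance [e] together. *)
Definition Lam (R : realFieldType) (W H e : nat) : R :=
  avg W (fun y => win R W H y * win R W H (y + e)).

Lemma win_ge0 (R : realFieldType) W H z : 0 <= win R W H z.
Proof. by rewrite mulr_ge0 ?divr_ge0. Qed.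

Lemma win_periodic (R : realFieldType) W H : periodic W (win R W H).
Proof. by move=> x; rewrite /win modnDr. Qed.

Lemma Lam_ge0 (R : realFieldType) W H e : 0 <= Lam R W H e.
Proof. by apply: avg_ge0 => y _; rewrite mulr_ge0 ?win_ge0. Qed.

Lemma Lam_periodic (R : realFieldType) W H : periodic W (Lam R W H).
Proof. by move=> x; apply: eq_avg => y _; rewrite addnA win_periodic. Qed.

Lemma avg_ltn (R : realFieldType) W H : (H <= W)%N ->
  avg W (fun y => ((y < H)%N)%:R : R) = H%:R / W%:R.
Proof.
move=> HW; rewrite /avg -(subnKC HW) big_split_ord /=; congr (_ / _).
rewrite (eq_bigr (fun=> 1)) => [|i _]; last by rewrite ltn_ord.
rewrite sumr_const card_ord big1 ?addr0// => i _.
by rewrite ltnNge leq_addr.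
Qed.

Lemma avg_win (R : realFieldType) W H c : (0 < H <= W)%N ->
  avg W (fun y => win R W H (c + y)) = 1.
Proof.
case/andP=> H0 HW; have W0 := leq_trans H0 HW.
under eq_avg do rewrite addnC.
rewrite (avg_shift _ (@win_periodic R W H)) /win avgZr.
rewrite (eq_avg (G := fun y => ((y < H)%N)%:R)) => [|y yW]; last by rewrite modn_small.
have Hn0 : H%:R != 0 :> R by rewrite pnatr_eq0 -lt0n.
have Wn0 : W%:R != 0 :> R by rewrite pnatr_eq0 -lt0n.
by rewrite avg_ltn//; field; rewrite Hn0.
Qed.

Lemma Lam0 (R : realFieldType) W H : (0 < H <= W)%N ->
  Lam R W H 0 = W%:R / H%:R.
Proof.
move=> HW; rewrite /Lam.
transitivity (avg W (fun y => win R W H (0 + y) * (W%:R / H%:R))).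
  apply: eq_avg => y _; rewrite addn0 add0n /win.
  by case: (_ < _)%N; rewrite /= ?mul1r// !mul0r.
by rewrite avgZr avg_win// mul1r.
Qed.

(** Write [k = 2 ^ v * k'] with [k'] odd; [k <= 2 ^ h] forces [v <= h]. Moving [a] by [2 ^ (h - v)]
    moves [k * a] by [k'] window lengths, and [k'] is invertible modulo the number [S] of windows in
    a period. So exactly one of [S] successive moves lands in the window, whatever [c] and [a]. *)
Lemma avg_win_mul (R : realFieldType) w h c k : (h <= w)%N -> (0 < k <= 2 ^ h)%N ->
  avg (2 ^ w) (fun a => win R (2 ^ w) (2 ^ h) (c + k * a)) = 1.
Proof.
move=> hw /andP[k0 kh].
have [k' [v [kE ok]]] : exists k' v, k = (2 ^ v * k')%N /\ odd k'.
  have [m nm ->] := pfactor_coprime (isT : prime 2) k0.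
  by exists m, (logn 2 k); rewrite mulnC; split=> //; rewrite -coprime2n.
have vh : (v <= h)%N.
  rewrite -(@leq_exp2l 2)//; apply: leq_trans kh; rewrite kE.
  by case: k' ok {kE} => // n _; rewrite leq_pmulr.
set W := (2 ^ w)%N; set H := (2 ^ h)%N.
have H0 : (0 < H)%N by rewrite expn_gt0.
pose S := (2 ^ (w - h))%N.
have S0 : (0 < S)%N by rewrite expn_gt0.
have WE : W = (H * S)%N by rewrite /W /H /S -expnD subnKC.
have pF : periodic W (fun a => win R W H (c + k * a)).
  by move=> a; rewrite mulnDr addnA (periodicM _ _ (@win_periodic R W H)).
transitivity (avg S (fun s => avg W (fun a => win R W H (c + k * (a + 2 ^ (h - v) * s))))).
  rewrite -[LHS](avg_const _ S0); apply: eq_avg => s _.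
  by rewrite (avg_shift _ pF).
rewrite exchange_avg -[RHS](@avg_const R W); last by rewrite expn_gt0.
apply: eq_avg => a _.
pose G z : R := ((z %% S == 0)%N)%:R * (W%:R / H%:R).
have pG : periodic S G by move=> z; rewrite /G modnDr.
transitivity (avg S (fun s => G ((c + k * a) %/ H + k' * s)%N)).
  apply: eq_avg => s _; rewrite /win /G; congr (_%:R * _).
  have -> : (c + k * (a + 2 ^ (h - v) * s) = (k' * s) * H + (c + k * a))%N.
    rewrite mulnDr addnA addnC; congr (_ + _)%N.
    have -> : H = (2 ^ v * 2 ^ (h - v))%N by rewrite -expnD subnKC.
    by rewrite kE; ring.
  set z := (c + k * a)%N; rewrite {1}(divn_eq z H) addnA -mulnDl (addnC (k' * s)%N).
  set t := (z %/ H + k' * s)%N; rewrite {1}(divn_eq t S).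
  have -> : ((t %/ S * S + t %% S) * H + z %% H =
     t %/ S * W + (t %% S * H + z %% H))%N by rewrite WE; ring.
  have zH : (z %% H < H)%N by rewrite ltn_mod.
  have tS : (t %% S < S)%N by rewrite ltn_mod.
  rewrite modnMDl modn_small; last first.
    rewrite WE mulnC; apply: (@leq_trans (H * (t %% S).+1)%N); first by rewrite mulnS; lia.
    by rewrite leq_mul2l tS orbT.
  case: (t %% S)%N => [|t']; first by rewrite add0n zH.
  by rewrite mulSn -addnA ltnNge leq_addr.
have kS : coprime k' S.
  by rewrite coprime_sym; apply: coprimeXl; rewrite coprime2n.
rewrite (avg_coprime _ kS pG) /G avgZr.
rewrite (eq_avg (G := fun i => (i == 0%N)%:R)) => [|i iS]; last by rewrite modn_small.
rewrite avg_eqn// WE natrM.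
have Hn0 : H%:R != 0 :> R by rewrite pnatr_eq0 -lt0n.
have Sn0 : S%:R != 0 :> R by rewrite pnatr_eq0 -lt0n.
by field; rewrite Hn0.
Qed.

Lemma avg_Lam (R : realFieldType) w h k i : (h <= w)%N -> (0 < k <= 2 ^ h)%N ->
  avg (2 ^ (w + i)) (fun a => Lam R (2 ^ w) (2 ^ h) (k * a)) = 1.
Proof.
move=> hw kh; rewrite expnD avg_periodic ?expn_gt0//; last first.
  by move=> a; rewrite mulnDr (periodicM _ _ (@Lam_periodic _ _ _)).
rewrite exchange_avg.
under eq_avg do rewrite avgZ avg_win_mul// mulr1.
rewrite -[RHS](@avg_win R (2 ^ w) (2 ^ h) 0) ?expn_gt0 ?leq_exp2l//.
Qed.

Lemma avg_win_pair (R : realFieldType) W H u v :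
  avg W (fun y => win R W H (u + y) * win R W H (v + y)) =
  Lam R W H ((u - v) + (v - u)).
Proof.
wlog uv : u v / (u <= v)%N.
  move=> Wl; have [/Wl//|/ltnW /Wl] := leqP u v.
  by rewrite addnC => <-; apply: eq_avg => y _; rewrite mulrC.
have -> : (u - v + (v - u) = v - u)%N by lia.
rewrite /Lam -[RHS](avg_shift u) => [|y]; last by rewrite addnAC !win_periodic.
by apply: eq_avg => y _; congr (win _ _ _ _ * win _ _ _ _); lia.
Qed.

(** Mean square, over all positions of the window, of the deviation of the normalized count of the
    points [n * a] from its expected value [1]. *)
Definition Disc (R : realFieldType) (W H N a : nat) : R :=
  avg W (fun y => (avg N (fun n => win R W H (n * a + y)) - 1) ^+ 2).

Lemma Disc_ge0 (R : realFieldType) W H N a : 0 <= Disc R W H N a.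
Proof. by apply: avg_ge0 => y _; apply: sqr_ge0. Qed.

Lemma distn_mul n n' a :
  ((n * a - n' * a) + (n' * a - n * a) = ((n - n') + (n' - n)) * a)%N.
Proof. by rewrite mulnDl !mulnBl. Qed.

Lemma avg_win_sqr (R : realFieldType) W H N a b :
  avg W (fun y => avg N (fun n => win R W H (b + n * a + y)) ^+ 2) =
  avg N (fun n => avg N (fun n' => Lam R W H ((n - n' + (n' - n)) * a))).
Proof.
under eq_avg do rewrite avg_sqr.
rewrite exchange_avg; apply: eq_avg => n _.
rewrite exchange_avg; apply: eq_avg => n' _.
rewrite avg_win_pair; congr (Lam _ _ _ _).
by rewrite -distn_mul; lia.
Qed.

(** When the square is opened, a pair of distinct indices has mean exactly [1] over [a], because
    their distance is at most [2 ^ h]; this is cancelled by the subtracted [1]. The excess comes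
    from the diagonal alone, where [Lam] takes its value [W / H] at [0]. *)
Lemma avg_Disc (R : realFieldType) w h N : (h <= w)%N -> (0 < N <= 2 ^ h)%N ->
  avg (2 ^ w) (Disc R (2 ^ w) (2 ^ h) N) <= (2 ^ w)%:R / (2 ^ h)%:R / N%:R.
Proof.
move=> hw /andP[N0 Nh].
set W := (2 ^ w)%N; set H := (2 ^ h)%N.
have HW : (0 < H <= W)%N by rewrite expn_gt0 leq_exp2l.
have DE a : Disc R W H N a = avg N (fun n => avg N (fun n' =>
    Lam R W H ((n - n' + (n' - n)) * a))) - 1.
  rewrite -(avg_win_sqr _ _ _ _ _ 0).
  transitivity (avg W (fun y => avg N (fun n => win R W H (0 + n * a + y)) ^+ 2 -
     (2 * avg N (fun n => win R W H (0 + n * a + y)) - 1))).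
    by apply: eq_avg => y _; ring.
  rewrite avgB avgB avgZ exchange_avg (avg_const 1); last by rewrite expn_gt0.
  under [X in _ - (_ * X - _)]eq_avg do rewrite avg_win//.
  by rewrite avg_const//; ring.
rewrite (eq_avg (G := fun a => avg N (fun n => avg N (fun n' =>
    Lam R W H ((n - n' + (n' - n)) * a))) - 1)) => [|a _]; last exact: DE.
rewrite avgB (avg_const 1) ?expn_gt0// exchange_avg lerBlDr.
rewrite -[leRHS](avg_const _ N0).
apply: ler_avg => n nN; rewrite exchange_avg.
apply: (@le_trans _ _ (avg N (fun n' => (n' == n)%:R * (W%:R / H%:R) + 1))).
  apply: ler_avg => n' n'N; have [->|nn'] := eqVneq n' n.
    rewrite subnn (@avg_const _ W (Lam R W H 0)) ?expn_gt0// Lam0// mul1r.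
    by rewrite lerDl.
  rewrite mul0r add0r -[X in _ <= X](@avg_Lam R w h (n - n' + (n' - n))%N 0)//; last by lia.
  by rewrite addn0.
by rewrite avgD avgZr avg_eqn// avg_const// mulrC.
Qed.

Lemma avg_cross (R : realFieldType) U V c d : (0 < U)%N -> (0 < V)%N ->
  avg (U * V) (fun y => ((U <= (y + c) %% U + d)%N)%:R : R) <= d%:R / U%:R.
Proof.
move=> U0 V0.
have pF : periodic U (fun y => ((U <= y %% U + d)%N)%:R : R).
  by move=> y; rewrite modnDr.
rewrite avg_periodic//; last by move=> y; rewrite addnAC modnDr.
rewrite (avg_shift c pF).
have [dU|Ud] := leqP d U; last first.
  apply: (@le_trans _ _ 1); last by rewrite ler_pdivlMr ?ltr0n// mul1r ler_nat ltnW.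
  by apply: avg_le => // i _; case: (_ <= _)%N.
rewrite /avg ler_wpM2r ?invr_ge0 ?ler0n//.
have [j UE] : exists j, U = (j + d)%N by exists (U - d)%N; lia.
subst U; rewrite big_split_ord /= big1 => [|i _]; last first.
  have := ltn_ord i => iU; rewrite modn_small; last by lia.
  by rewrite leqNgt (_ : (i + d < j + d)%N)//; lia.
rewrite add0r; apply: (@le_trans _ _ (\sum_(i < d) 1)).
  by apply: ler_sum => i _; case: (_ <= _)%N.
by rewrite sumr_const card_ord.
Qed.

Lemma divn_shift_eq (T : Type) U (F : nat -> T) x d : (0 < U)%N ->
  (forall y z, (y %/ U = z %/ U)%N -> F y = F z) ->
  ~~ (U <= x %% U + d)%N -> forall i, (i <= d)%N -> F (x + i)%N = F x.
Proof.
move=> U0 FU; rewrite -ltnNge => xd i id; apply: FU.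
rewrite {1}(divn_eq x U) -addnA divnMDl// [((_ + _) %/ _)%N]divn_small ?addn0//.
by apply: leq_ltn_trans xd; rewrite leq_add2l.
Qed.

(** The two values can differ only if a multiple of [U] separates [x + c] from [x + c']. *)
Lemma avg_mismatch (R : realFieldType) U V (F : nat -> R) c c' :
  (0 < U)%N -> (0 < V)%N -> (forall x, `|F x| <= 1) ->
  (forall y z, (y %/ U = z %/ U)%N -> F y = F z) ->
  avg (U * V) (fun x => `|F (x + c)%N - F (x + c')%N|) <=
  2 * ((c - c') + (c' - c))%:R / U%:R.
Proof.
move=> U0 V0 F1 FU.
wlog cc' : c c' / (c <= c')%N.
  move=> W; have [/W//|/ltnW/W] := leqP c c'.
  by rewrite addnC; under eq_avg do rewrite distrC.
have -> : (c - c' + (c' - c) = c' - c)%N by lia.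
rewrite -mulrA; apply: le_trans (ler_wpM2l _ (avg_cross R c (c' - c) U0 V0)) => //.
rewrite -avgZ; apply: ler_avg => x _.
case: (boolP (U <= _)%N) => [_|h].
  by rewrite mulr1; apply: le_trans (ler_normB _ _) _; have := F1 (x + c)%N; have := F1 (x + c')%N; lra.
have := divn_shift_eq U0 FU h (leqnn _).
by rewrite -addnA subnKC// => ->; rewrite subrr normr0 mulr0.
Qed.

(** Each [phi (b + n * a)] is multiplied by the mean over [y] of the window placed at [- y], which
    is [1]. A point seen by that window lies less than [H] beyond [W - y] modulo [W], so [phi] takes
    there the value [phi (W - y)] unless [W - y] is bad. There remains the mean of [phi] weighted by
    the counts [c y], which are close to [1] on average because of [Disc]. *)
Lemma equidistribution (R : realFieldType) W H N a b (phi : nat -> R)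
    (bad : nat -> bool) (eps : R) :
  (0 < N)%N -> (0 < H <= W)%N -> periodic W phi -> periodic W bad ->
  (forall x, `|phi x| <= 1) ->
  (forall y i, ~~ bad y -> (i < H)%N -> phi (y + i)%N = phi y) ->
  0 <= eps -> Disc R W H N a <= eps ^+ 2 ->
  `|avg N (fun n => phi (b + n * a)%N) - avg W phi| <=
     3 * eps + 2 * avg W (fun y => (bad y)%:R).
Proof.
move=> N0 HW pphi pbad phi1 hbad eps0 hD; have W0 : (0 < W)%N by lia.
pose c y := avg N (fun n => win R W H (b + n * a + y)).
pose u y : R := (bad (W - y)%N)%:R.
have c0 y : 0 <= c y by apply: avg_ge0 => n _; apply: win_ge0.
have hc : avg W (fun y => `|c y - 1|) <= eps.
  rewrite -ler_sqr ?nnegrE ?avg_ge0//.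
  apply: le_trans (avg_sqr_le _ _) _.
  apply: le_trans hD; rewrite le_eqVlt; apply/orP; left; apply/eqP.
  have pF : periodic W (fun y => (avg N (fun n => win R W H (n * a + y)) - 1) ^+ 2).
    by move=> y; congr ((_ - _) ^+ 2); apply: eq_avg => n _; rewrite addnA win_periodic.
  rewrite /Disc -(avg_shift b pF); apply: eq_avg => y _.
  rewrite real_normK ?num_real//; congr ((_ - _) ^+ 2); apply: eq_avg => n _.
  by congr win; lia.
have -> : avg N (fun n => phi (b + n * a)%N) =
   avg W (fun y => avg N (fun n => win R W H (b + n * a + y) * phi (b + n * a)%N)).
  rewrite exchange_avg; apply: eq_avg => n _.
  by rewrite avgZr avg_win// mul1r.
have -> : avg W phi = avg W (fun y => phi (W - y)%N) by rewrite avg_rev.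
have -> : avg W (fun y => (bad y)%:R) = avg W u :> R.
  by rewrite -(avg_rev (F := fun y => (bad y)%:R))// => y; rewrite pbad.
rewrite -avgB; apply: le_trans (ler_norm_avg _ _) _.
apply: (@le_trans _ _ (avg W (fun y => 3 * `|c y - 1| + 2 * u y))); last first.
  by rewrite avgD !avgZ lerD2r ler_wpM2l.
apply: ler_avg => y yW.
have u01 : 0 <= u y <= 1 by rewrite /u; case: (bad _); rewrite /= ?ler01 ?lexx.
have h1 : `|avg N (fun n => win R W H (b + n * a + y) * phi (b + n * a)%N)
     - c y * phi (W - y)%N| <= 2 * (c y * u y).
  rewrite /c -avgZr -avgZr -avgB -avgZ; apply: le_trans (ler_norm_avg _ _) _.
  apply: ler_avg => n _; set x := (b + n * a)%N.
  rewrite -mulrBr normrM (ger0_norm (win_ge0 _ _ _ _)) [leRHS]mulrCA.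
  rewrite /win; case: (boolP ((x + y) %% W < H)%N) => [h|_]; last by rewrite !mul0r.
  apply: ler_wpM2l; first by rewrite mulr_ge0// divr_ge0.
  have := phi1 x; have := phi1 (W - y)%N => p1 p2.
  rewrite /u; case: (boolP (bad _)) => [_|nb].
    by rewrite mulr1; apply: le_trans (ler_normB _ _) _; lra.
  rewrite -(hbad _ _ nb h) -(periodicM 1 x pphi).
  have -> : (x + 1 * W = (W - y + (x + y) %% W) + (x + y) %/ W * W)%N.
    by have := divn_eq (x + y) W; lia.
  by rewrite (periodicM _ _ pphi) subrr normr0 mulr0.
have h2 : `|c y * phi (W - y)%N - phi (W - y)%N| <= `|c y - 1|.
  rewrite -[X in _ - X]mul1r -mulrBl normrM ler_piMr//.
(* Replacing the count by [1] on bad windows too costs two more deviations, whence the [3] in front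
   of [eps]. *)
have h3 : c y * u y <= `|c y - 1| + u y.
  have := ler_norm (c y - 1); have := normr_ge0 (c y - 1).
  by case/andP: u01; nra.
set A := avg N _ in h1 *; set B := c y * phi _ in h1 h2.
have -> : A - phi (W - y)%N = (A - B) + (B - phi (W - y)%N) by ring.
by apply: le_trans (ler_normD _ _) _; lra.
Qed.

(** * The Cauchy-Schwarz step over bins *)

Definition shift_prod (R : realFieldType) (F : nat -> R) (J : seq nat) (x : nat) : R :=
  \prod_(c <- J) F (x + c)%N.

Lemma shift_prod_le1 (R : realFieldType) (F : nat -> R) J x :
  (forall x, `|F x| <= 1) -> `|shift_prod F J x| <= 1.
Proof.
move=> F1; rewrite /shift_prod normr_prod; apply: prodr_ile1 => c _.
by rewrite normr_ge0 F1.
Qed.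

Lemma shift_prod_periodic (R : realFieldType) W (F : nat -> R) J :
  periodic W F -> periodic W (shift_prod F J).
Proof. by move=> pF x; apply: eq_bigr => c _; rewrite addnAC pF. Qed.

(** Some translate of [y] lies at most [d] below the next multiple of [U], where a function constant
    on blocks of length [U] may jump. *)
Definition crosses (U d : nat) (J : seq nat) (y : nat) : bool :=
  has (fun c => (U <= (y + c) %% U + d)%N) J.

Lemma crosses_periodic U V d J : periodic (U * V) (crosses U d J).
Proof.
move=> y; apply: eq_has => c.
by rewrite addnAC [(U * V)%N]mulnC -modnDmr modnMl addn0.
Qed.

Lemma avg_crosses (R : realFieldType) U V d J : (0 < U)%N -> (0 < V)%N ->
  avg (U * V) (fun y => (crosses U d J y)%:R : R) <= (size J)%:R * (d%:R / U%:R).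
Proof.
move=> U0 V0; elim: J => [|c J IHJ] /=.
  by rewrite mul0r; apply: avg_le => // y _.
apply: (@le_trans _ _ (avg (U * V) (fun y => ((U <= (y + c) %% U + d)%N)%:R) +
   avg (U * V) (fun y => (crosses U d J y)%:R))).
  rewrite -avgD; apply: ler_avg => y _; rewrite /crosses.
  by case: (_ <= _)%N; case: (has _ _); rewrite /= ?mulr1n ?mulr0n; lra.
by rewrite -nat1r mulrDl mul1r lerD// avg_cross.
Qed.

Lemma shift_prod_eq (R : realFieldType) U (F : nat -> R) J d y i : (0 < U)%N ->
  (forall y z, (y %/ U = z %/ U)%N -> F y = F z) ->
  ~~ crosses U d J y -> (i <= d)%N -> shift_prod F J (y + i) = shift_prod F J y.
Proof.
move=> U0 FU /hasPn nb id; rewrite /shift_prod big_seq [RHS]big_seq.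
apply: eq_bigr => c /nb cJ; rewrite addnAC.
exact: (divn_shift_eq U0 FU cJ).
Qed.

Lemma avg_win_sqr_weighted (R : realFieldType) W H N a b (w : nat -> R) :
  avg W (fun y => avg N (fun n => win R W H (b + n * a + y) * w n) ^+ 2) =
  avg N (fun n => avg N (fun n' =>
    Lam R W H ((n - n' + (n' - n)) * a) * (w n * w n'))).
Proof.
under eq_avg do rewrite avg_sqr.
rewrite exchange_avg; apply: eq_avg => n _.
rewrite exchange_avg; apply: eq_avg => n' _.
under eq_avg do rewrite mulrACA.
rewrite avgZr avg_win_pair; congr (Lam _ _ _ _ * _).
by rewrite -distn_mul; lia.
Qed.

Definition mean_Lam (R : realFieldType) (U B K a : nat) : R :=
  avg K (fun k => avg K (fun k' => Lam R U B ((k - k' + (k' - k)) * a))).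

Lemma mean_Lam_ge0 (R : realFieldType) U B K a : 0 <= mean_Lam R U B K a.
Proof. by do 2 (apply: avg_ge0 => ? _); apply: Lam_ge0. Qed.

(* On a bin the factor [flo] is constant, unless the bin meets one of the
   places where some translate of [flo] may jump. *)
Lemma bin_inequality (R : realFieldType) Q u B K a x (J : seq nat)
    (flo ghi : nat -> R) :
  (0 < Q)%N -> (0 < u)%N -> (0 < B <= Q * u)%N ->
  periodic (Q * u) flo -> (forall y z, (y %/ Q = z %/ Q)%N -> flo y = flo z) ->
  (forall x, `|flo x| <= 1) -> (forall x, `|ghi x| <= 1) ->
  avg K (fun k => shift_prod flo J (x + k * a) * ghi (x + k * a)%N) ^+ 2 <=
  2 * ((size J)%:R * (B%:R / Q%:R) * mean_Lam R (Q * u) B K a +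
    avg K (fun k => avg K (fun k' => Lam R (Q * u) B ((k - k' + (k' - k)) * a) *
      (ghi (x + k * a)%N * ghi (x + k' * a)%N)))).
Proof.
move=> Q0 u0 BU pflo floQ flo1 ghi1; set U := (Q * u)%N.
pose glo := shift_prod flo J.
have glo1 z : `|glo z| <= 1 by apply: shift_prod_le1.
have pglo : periodic U glo by apply: shift_prod_periodic.
pose bad y : R := (crosses Q B J (U - y))%:R.
pose c y := avg K (fun k => win R U B (x + k * a + y)).
pose h y := avg K (fun k => win R U B (x + k * a + y) * ghi (x + k * a)%N).
have c0 y : 0 <= c y by apply: avg_ge0 => k _; apply: win_ge0.
have bad0 y : 0 <= bad y by rewrite ler0n.
have main : `|avg K (fun k => glo (x + k * a)%N * ghi (x + k * a)%N)| <=
    avg U (fun y => bad y * c y) + avg U (fun y => `|h y|).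
  have -> : avg K (fun k => glo (x + k * a)%N * ghi (x + k * a)%N) =
     avg U (fun y => avg K (fun k => win R U B (x + k * a + y) *
        (glo (x + k * a)%N * ghi (x + k * a)%N))).
    rewrite exchange_avg; apply: eq_avg => k _.
    by rewrite avgZr avg_win// mul1r.
  rewrite -avgD; apply: le_trans (ler_norm_avg _ _) _; apply: ler_avg => y yU.
  rewrite /bad; case: (boolP (crosses _ _ _ _)) => [_|nb].
    rewrite mul1r; apply: (@le_trans _ _ (c y)); last by rewrite lerDl.
    apply: le_trans (ler_norm_avg _ _) _; apply: ler_avg => k _.
    rewrite normrM (ger0_norm (win_ge0 _ _ _ _)) ler_piMr ?win_ge0// normrM.
    by rewrite -[leRHS]mulr1 ler_pM.
  rewrite mul0r add0r.
  have -> : avg K (fun k => win R U B (x + k * a + y) *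
        (glo (x + k * a)%N * ghi (x + k * a)%N)) = glo (U - y)%N * h y.
    rewrite -avgZ; apply: eq_avg => k _.
    rewrite /win; case: (boolP (_ < B)%N) => [lt|_]; last by rewrite !mul0r mulr0.
    set z := (x + k * a)%N in lt *.
    suff -> : glo z = glo (U - y)%N by rewrite mulrCA.
    rewrite -[RHS](shift_prod_eq Q0 floQ nb (ltnW lt)) -[LHS](periodicM 1 z pglo).
    have -> : (z + 1 * U = (U - y + (z + y) %% U) + (z + y) %/ U * U)%N.
      by have := divn_eq (z + y) U; lia.
    by rewrite (periodicM _ _ pglo).
  by rewrite normrM ler_piMl.
have sq : avg K (fun k => glo (x + k * a)%N * ghi (x + k * a)%N) ^+ 2 <=
    2 * (avg U (fun y => bad y * c y) ^+ 2 + avg U (fun y => `|h y|) ^+ 2).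
  move: main; set X := avg K _; set A := avg U _; set C := avg U _ => main.
  have A0 : 0 <= A by apply: avg_ge0 => y _; rewrite mulr_ge0.
  have C0 : 0 <= C by apply: avg_ge0.
  apply: (@le_trans _ _ ((A + C) ^+ 2)).
    by rewrite -[X ^+ 2]real_normK ?num_real// ler_sqr ?nnegrE ?addr_ge0.
  by have := sqr_ge0 (A - C); rewrite !expr2; nra.
apply: le_trans sq _; rewrite ler_wpM2l// lerD//.
  (* Cauchy-Schwarz separates the proportion of bad bins, at most [size J * B / Q], from the counts,
     whose second moment is [mean_Lam]. *)
  apply: le_trans (avg_CS _ _ _) _; rewrite /c.
  have -> : avg U (fun y => avg K (fun k => win R U B (x + k * a + y)) ^+ 2) =
      mean_Lam R U B K a by rewrite avg_win_sqr.
  rewrite ler_wpM2r ?mean_Lam_ge0//.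
  have -> : avg U (fun y => bad y ^+ 2) = avg U bad.
    by apply: eq_avg => y _; rewrite /bad; case: crosses; rewrite ?expr1n ?expr0n.
  rewrite /bad (avg_rev (F := fun y => (crosses Q B J y)%:R)); first exact: avg_crosses.
  by move=> y; rewrite crosses_periodic.
apply: le_trans (avg_sqr_le _ _) _.
under eq_avg do rewrite real_normK ?num_real//.
by rewrite /h avg_win_sqr_weighted.
Qed.

(** Each [n] is replaced by its translates [n + k], [k < K], at the cost [2 * K / N], and
    [bin_inequality] is applied to every inner average over [k]. For a fixed pair [k], [k'] the
    weight [Lam] does not depend on [n], so the average over [n] reaches the product of two
    translates of [fhi], and [equidistribution] turns it into a mean over a full period. *)
Lemma van_der_corput_bins (R : realFieldType) Q u V B H K N a b (J : seq nat)
    (flo fhi : nat -> R) (eps : R) :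
  (0 < Q)%N -> (0 < u)%N -> (0 < V)%N -> (0 < N)%N ->
  (0 < B <= Q * u)%N -> (0 < H <= Q * u * V)%N -> (0 < K)%N ->
  periodic (Q * u) flo -> (forall y z, (y %/ Q = z %/ Q)%N -> flo y = flo z) ->
  (forall x, `|flo x| <= 1) ->
  periodic (Q * u * V) fhi ->
  (forall y z, (y %/ (Q * u) = z %/ (Q * u))%N -> fhi y = fhi z) ->
  (forall x, `|fhi x| <= 1) ->
  0 <= eps -> Disc R (Q * u * V) H N a <= eps ^+ 2 ->
  avg N (fun n => shift_prod flo J (b + n * a) * shift_prod fhi J (b + n * a)) ^+ 2 <=
  8 * (K%:R / N%:R) ^+ 2 + 4 * (((size J)%:R * (B%:R / Q%:R) +
     (3 * eps + 4 * (size J)%:R * (H%:R / (Q * u)%:R))) * mean_Lam R (Q * u) B K a +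
    avg K (fun k => avg K (fun k' => Lam R (Q * u) B ((k - k' + (k' - k)) * a) *
      avg (Q * u * V) (fun x => shift_prod fhi J (x + k * a) *
         shift_prod fhi J (x + k' * a))))).
Proof.
move=> Q0 u0 V0 N0 BU HW K0 pflo floQ flo1 pfhi fhiU fhi1 eps0 hD.
set U := (Q * u)%N in BU HW pflo pfhi fhiU hD *.
have U0 : (0 < U)%N by rewrite muln_gt0 Q0.
pose glo := shift_prod flo J; pose ghi := shift_prod fhi J.
have glo1 z : `|glo z| <= 1 by apply: shift_prod_le1.
have ghi1 z : `|ghi z| <= 1 by apply: shift_prod_le1.
pose g z := glo z * ghi z.
have g1 z : `|g z| <= 1 by rewrite normrM -[leRHS]mulr1 ler_pM.
pose G n := avg K (fun k => g (b + n * a + k * a)%N).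
have e1 : `|avg N (fun n => g (b + n * a)%N) - avg N G| <= 2 * K%:R / N%:R.
  rewrite [avg N G]exchange_avg -[X in `|X - _|](avg_const _ K0) -avgB.
  apply: le_trans (ler_norm_avg _ _) _.
  apply: avg_le => [|k kK]; first by rewrite divr_ge0 ?mulr_ge0.
  apply: (@le_trans _ _ (2 * k%:R / N%:R)); last first.
    by rewrite ler_pM2r ?invr_gt0 ?ltr0n// ler_pM2l// ler_nat ltnW.
  have -> : avg N (fun n => g (b + n * a + k * a)%N) =
      avg N (fun n => g (b + (n + k) * a)%N).
    by apply: eq_avg => n _; congr g; lia.
  exact: (avg_translate N k (g := fun n => g (b + n * a)%N)).
set X := avg N (fun n => g (b + n * a)%N) in e1 *.
have e2 : X ^+ 2 <= 8 * (K%:R / N%:R) ^+ 2 + 2 * avg N (fun n => G n ^+ 2).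
  apply: (@le_trans _ _ (8 * (K%:R / N%:R) ^+ 2 + 2 * avg N G ^+ 2)); last first.
    by rewrite lerD2l ler_wpM2l// avg_sqr_le.
  move: e1; rewrite -mulrA; set Y := avg N G; set k := K%:R / N%:R => e1.
  have : (X - Y) ^+ 2 <= (2 * k) ^+ 2.
    by rewrite -[leLHS]real_normK ?num_real// ler_sqr ?nnegrE ?(le_trans _ e1).
  by have := sqr_ge0 (X - 2 * Y); rewrite !expr2; nra.
apply: le_trans e2 _; rewrite lerD2l.
have E4 (y : R) : 4 * y = 2 * (2 * y) by ring.
rewrite {}[leRHS]E4 ler_wpM2l//.
set S := (size J)%:R.
set sl := S * _; set er := 3 * eps + _.
pose LL k k' := Lam R U B ((k - k' + (k' - k)) * a).
apply: (@le_trans _ _ (avg N (fun n => 2 * (sl * mean_Lam R U B K a +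
    avg K (fun k => avg K (fun k' => LL k k' *
      (ghi (b + n * a + k * a)%N * ghi (b + n * a + k' * a)%N))))))).
  by apply: ler_avg => n _; apply: bin_inequality.
rewrite avgZ ler_wpM2l// avgD avg_const// mulrDl -addrA lerD2l.
rewrite exchange_avg /mean_Lam -avgZ -avgD; apply: ler_avg => k _.
rewrite exchange_avg -avgZ -avgD; apply: ler_avg => k' _.
rewrite avgZ -/(LL k k') [er * _]mulrC -mulrDr.
apply: ler_wpM2l; first exact: Lam_ge0.
pose phi x := ghi (x + k * a)%N * ghi (x + k' * a)%N.
(* A product of two translates may jump at twice as many places; with the factor [2] of
   [equidistribution] this makes [4 * size J]. *)
pose J2 := [seq (c + k * a)%N | c <- J] ++ [seq (c + k' * a)%N | c <- J].
have phiE : phi =1 shift_prod fhi J2.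
  move=> x; rewrite /phi /ghi /shift_prod /J2 big_cat !big_map.
  by congr (_ * _); apply: eq_bigr => c _; congr fhi; lia.
have pphi : periodic (U * V) phi.
  by move=> x; rewrite !phiE shift_prod_periodic.
have phi1 x : `|phi x| <= 1 by rewrite normrM -[leRHS]mulr1 ler_pM.
have hb : forall y i, ~~ crosses U H J2 y -> (i < H)%N -> phi (y + i)%N = phi y.
  by move=> y i nb iH; rewrite !phiE (shift_prod_eq U0 fhiU nb (ltnW iH)).
have Eq := equidistribution b N0 HW pphi (@crosses_periodic U V H J2) phi1 hb
  eps0 hD.
have := avg_crosses R H J2 U0 V0.
rewrite /J2 size_cat !size_map natrD -/S => hc.
rewrite -lerBlDr; apply: le_trans (ler_norm _) _; apply: le_trans Eq _.
by rewrite /er lerD2l; move: hc; set w := avg _ _; set t := H%:R / _; lra.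
Qed.

(** What is left to bound once the low bits are gone: [y] stands for the distance, a multiple of
    [a], between two points paired in a bin. *)
Definition Psi (R : realFieldType) (W : nat) (F : nat -> R) (s : seq nat)
    (Rn a y : nat) : R :=
  avg W (fun x => avg Rn (fun r =>
    \prod_(l <- s) (F (x + (l + r) * a)%N * F (x + (l + r) * a + y)%N)) ^+ 2).

Lemma Psi_ge0 (R : realFieldType) W (F : nat -> R) s Rn a y :
  0 <= Psi W F s Rn a y.
Proof. by apply: avg_ge0 => x _; apply: sqr_ge0. Qed.

Lemma Psi_le1 (R : realFieldType) W (F : nat -> R) s Rn a y :
  (forall x, `|F x| <= 1) -> Psi W F s Rn a y <= 1.
Proof.
move=> F1; apply: avg_le => // x _.
rewrite -real_normK ?num_real// exprn_ile1// norm_avg_le1// => r _.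
rewrite normr_prod prodr_ile1// => l _.
by rewrite normr_ge0 normrM -[leRHS]mulr1 ler_pM.
Qed.

Lemma avg_Psi (R : realFieldType) W (F : nat -> R) s Rn a k k' :
  periodic W F ->
  avg W (fun x => avg Rn (fun r => \prod_(l <- s)
     (F (x + k * a + (l + r) * a)%N * F (x + k' * a + (l + r) * a)%N)) ^+ 2) =
  Psi W F s Rn a ((k - k' + (k' - k)) * a).
Proof.
move=> pF; wlog kk' : k k' / (k <= k')%N.
  move=> Wl; have [/Wl//|/ltnW/Wl] := leqP k k'.
  rewrite addnC => <-; apply: eq_avg => x _; congr (_ ^+ 2).
  by apply: eq_avg => r _; apply: eq_bigr => l _; rewrite mulrC.
have -> : (k - k' + (k' - k) = k' - k)%N by lia.
have pG : periodic W (fun x => avg Rn (fun r =>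
    \prod_(l <- s) (F (x + (l + r) * a)%N * F (x + (l + r) * a + (k' - k) * a)%N)) ^+ 2).
  move=> x; congr (_ ^+ 2); apply: eq_avg => r _; apply: eq_bigr => l _.
  by rewrite !(addnAC x W) (addnAC _ W) !pF.
rewrite /Psi -(avg_shift (k * a) pG); apply: eq_avg => x _; congr (_ ^+ 2).
apply: eq_avg => r _; apply: eq_bigr => l _; congr (_ * F _).
rewrite mulnBl -[LHS]addnA -[RHS]addnA [in RHS]addnC.
have : (k * a <= k' * a)%N by rewrite leq_mul2r kk' orbT.
by lia.
Qed.

(** The fourth power comes from two uses of Cauchy-Schwarz, over [n] and over the pairs [(r, r')].
    The second square falls on a correlation of [2 * size s] translates, to which
    [van_der_corput_bins] applies. In the resulting mean over a period the factors in [r] and in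
    [r'] separate, and the averages over both recombine into the square inside [Psi]. *)
Lemma truncated_sum_bound (R : realFieldType) Q u V B H K N Rn a b (s : seq nat)
    (flo fhi : nat -> R) (eps : R) :
  (0 < Q)%N -> (0 < u)%N -> (0 < V)%N -> (0 < N)%N -> (0 < Rn)%N ->
  (0 < B <= Q * u)%N -> (0 < H <= Q * u * V)%N -> (0 < K)%N ->
  periodic (Q * u) flo -> (forall y z, (y %/ Q = z %/ Q)%N -> flo y = flo z) ->
  (forall x, `|flo x| <= 1) ->
  periodic (Q * u * V) fhi ->
  (forall y z, (y %/ (Q * u) = z %/ (Q * u))%N -> fhi y = fhi z) ->
  (forall x, `|fhi x| <= 1) ->
  0 <= eps -> Disc R (Q * u * V) H N a <= eps ^+ 2 ->
  avg N (fun n => `|avg Rn (fun r => \prod_(l <- s)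
     (flo (b + n * a + (l + r) * a)%N * fhi (b + n * a + (l + r) * a)%N))|) ^+ 4 <=
  8 * (K%:R / N%:R) ^+ 2 +
  4 * (((2 * size s)%:R * (B%:R / Q%:R) +
     (3 * eps + 4 * (2 * size s)%:R * (H%:R / (Q * u)%:R))) *
        mean_Lam R (Q * u) B K a +
    2 * avg K (fun e => Lam R (Q * u) B (e * a) *
       Psi (Q * u * V) fhi s Rn a (e * a))).
Proof.
move=> Q0 u0 V0 N0 R0 BU HW K0 pflo floQ flo1 pfhi fhiU fhi1 eps0 hD.
set U := (Q * u)%N in BU HW pflo pfhi fhiU hD *.
pose p r x : R := \prod_(l <- s) (flo (x + (l + r) * a)%N * fhi (x + (l + r) * a)%N).
pose T r r' := avg N (fun n => p r (b + n * a)%N * p r' (b + n * a)%N).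
pose J r r' := [seq ((l + r) * a)%N | l <- s] ++ [seq ((l + r') * a)%N | l <- s].
have sJ r r' : size (J r r') = (2 * size s)%N.
  by rewrite size_cat !size_map mul2n addnn.
have TJ r r' : T r r' = avg N (fun n => shift_prod flo (J r r') (b + n * a) *
                                     shift_prod fhi (J r r') (b + n * a)).
  apply: eq_avg => n _; rewrite /shift_prod /J !big_cat !big_map /= /p !big_split /=.
  by ring.
have S4 : avg N (fun n => `|avg Rn (fun r => p r (b + n * a)%N)|) ^+ 4 <=
    avg Rn (fun r => avg Rn (fun r' => T r r' ^+ 2)).
  have -> : 4%N = (2 * 2)%N by [].
  rewrite exprM; apply: (@le_trans _ _ (avg Rn (fun r => avg Rn (fun r' => T r r')) ^+ 2)).
    rewrite ler_sqr ?nnegrE ?sqr_ge0//; last first.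
      have -> : avg Rn (fun r => avg Rn (fun r' => T r r')) =
          avg N (fun n => avg Rn (fun r => p r (b + n * a)%N) ^+ 2).
        under [RHS]eq_avg do rewrite avg_sqr.
        rewrite [RHS]exchange_avg; apply: eq_avg => r _.
        by rewrite [RHS]exchange_avg.
      by apply: avg_ge0 => n _; apply: sqr_ge0.
    apply: le_trans (avg_sqr_le _ _) _.
    under eq_avg do rewrite real_normK ?num_real// avg_sqr.
    rewrite exchange_avg; apply: ler_avg => r _.
    by rewrite exchange_avg.
  apply: le_trans (avg_sqr_le _ _) _; apply: ler_avg => r _.
  exact: avg_sqr_le.
apply: le_trans S4 _.
set c1 := 8 * _; set c2 := (_ + _) * _.
pose I r r' := avg K (fun k => avg K (fun k' => Lam R U B ((k - k' + (k' - k)) * a) *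
      avg (U * V) (fun x => shift_prod fhi (J r r') (x + k * a) *
         shift_prod fhi (J r r') (x + k' * a)))).
apply: (@le_trans _ _ (avg Rn (fun r => avg Rn (fun r' => c1 + 4 * (c2 + I r r'))))).
  apply: ler_avg => r _; apply: ler_avg => r' _; rewrite TJ /c1 /c2 -(sJ r r').
  exact: van_der_corput_bins.
have -> : avg Rn (fun r => avg Rn (fun r' => c1 + 4 * (c2 + I r r'))) =
    c1 + 4 * (c2 + avg Rn (fun r => avg Rn (fun r' => I r r'))).
  rewrite -[in RHS](avg_const c2 R0) -avgD -avgZ -[in RHS](avg_const c1 R0) -avgD.
  apply: eq_avg => r _.
  rewrite -[in RHS](avg_const c2 R0) -avgD -avgZ -[in RHS](avg_const c1 R0) -avgD.
  exact: eq_avg.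
rewrite lerD2l ler_wpM2l// lerD2l.
pose G e := Lam R U B (e * a) * Psi (U * V) fhi s Rn a (e * a).
apply: le_trans (avg_dist_le _ (F := G) _); last first.
  by move=> e; rewrite mulr_ge0 ?Lam_ge0 ?Psi_ge0.
rewrite le_eqVlt; apply/orP; left; apply/eqP.
under eq_avg do rewrite exchange_avg.
rewrite exchange_avg; apply: eq_avg => k _.
under eq_avg do rewrite exchange_avg.
rewrite exchange_avg; apply: eq_avg => k' _.
under eq_avg do rewrite avgZ.
rewrite avgZ /G -avg_Psi//; congr (_ * _).
under eq_avg do rewrite exchange_avg.
rewrite exchange_avg; apply: eq_avg => x _.
rewrite avg_sqr; apply: eq_avg => r _; apply: eq_avg => r' _.
rewrite /shift_prod /J !big_cat !big_map /= !big_split /=.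
by ring.
Qed.

(** * Averaging over the slope *)

Lemma prod_dist (R : realFieldType) (I : Type) (s : seq I) (u v : I -> R) :
  (forall i, `|u i| <= 1) -> (forall i, `|v i| <= 1) ->
  `|\prod_(i <- s) u i - \prod_(i <- s) v i| <= \sum_(i <- s) `|u i - v i|.
Proof.
move=> u1 v1; elim: s => [|i s IHs]; first by rewrite !big_nil subrr normr0.
rewrite !big_cons.
set A := \prod_(_ <- _) _ in IHs *; set B := \prod_(_ <- _) _ in IHs *.
have B1 : `|B| <= 1.
  by rewrite /B normr_prod; apply: prodr_ile1 => j _; rewrite normr_ge0 v1.
have -> : u i * A - v i * B = u i * (A - B) + (u i - v i) * B by ring.
apply: le_trans (ler_normD _ _) _; rewrite !normrM addrC lerD//.
  by rewrite ler_piMr.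
by apply: le_trans IHs; rewrite ler_piMl.
Qed.

Lemma avg_sum (R : realFieldType) (I : Type) n (s : seq I) (P : pred I)
    (F : nat -> I -> R) :
  avg n (fun x => \sum_(l <- s | P l) F x l) =
  \sum_(l <- s | P l) avg n (fun x => F x l).
Proof. by rewrite /avg exchange_big /= mulr_suml. Qed.

Lemma sumr_le_size (R : realFieldType) (I : eqType) (s : seq I) (F : I -> R) c :
  (forall l, l \in s -> F l <= c) -> \sum_(l <- s) F l <= (size s)%:R * c.
Proof.
elim: s => [|i s IHs] H; first by rewrite big_nil mul0r.
rewrite big_cons /= -nat1r mulrDl mul1r lerD// ?H ?mem_head//.
by apply: IHs => l ls; rewrite H// in_cons ls orbT.
Qed.

(** The arguments of [F] move by at most [J] times the change of [a], plus the change of [y] in the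
    second factor; as [F] is constant on blocks of length [U], a move by [d] affects it on a
    proportion at most [d / U] of the period. *)
Lemma Psi_lipschitz (R : realFieldType) U V (F : nat -> R) s Rn J a a' y y' :
  (0 < U)%N -> (0 < V)%N -> (forall x, `|F x| <= 1) ->
  (forall y z, (y %/ U = z %/ U)%N -> F y = F z) ->
  (forall l r, l \in s -> (r < Rn)%N -> (l + r <= J)%N) ->
  Psi (U * V) F s Rn a y <= Psi (U * V) F s Rn a' y' +
    (size s)%:R * (4 * (2 * J * ((a - a') + (a' - a)) + ((y - y') + (y' - y)))%:R / U%:R).
Proof.
move=> U0 V0 F1 FU hJ; rewrite -lerBlDl /Psi -avgB.
pose P a y x r := \prod_(l <- s) (F (x + (l + r) * a)%N * F (x + (l + r) * a + y)%N).
have P1 b z x r : `|P b z x r| <= 1.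
  rewrite normr_prod prodr_ile1// => l _.
  by rewrite normr_ge0 normrM -[leRHS]mulr1 ler_pM.
pose D x r : R := \sum_(l <- s) (`|F (x + (l + r) * a)%N - F (x + (l + r) * a')%N| +
   `|F (x + ((l + r) * a + y))%N - F (x + ((l + r) * a' + y'))%N|).
have step x : avg Rn (P a y x) ^+ 2 - avg Rn (P a' y' x) ^+ 2 <= avg Rn (fun r => 2 * D x r).
  rewrite subr_sqr avgZ mulrC.
  have h1 : `|avg Rn (P a y x) + avg Rn (P a' y' x)| <= 2.
    apply: le_trans (ler_normD _ _) _.
    by have -> : 2 = 1 + 1 :> R; [ring | rewrite lerD// norm_avg_le1].
  have h2 : `|avg Rn (P a y x) - avg Rn (P a' y' x)| <= avg Rn (D x).
    rewrite -avgB; apply: le_trans (ler_norm_avg _ _) _; apply: ler_avg => r _.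
    have bd1 b c : `|F b * F c| <= 1 by rewrite normrM -[leRHS]mulr1 ler_pM.
    apply: le_trans (prod_dist _ _ _) _ => //.
    apply: ler_sum => l _; rewrite !addnA.
    set A := F _; set B := F _; set A' := F _; set B' := F _.
    have -> : A * B - A' * B' = (A - A') * B + A' * (B - B') by ring.
    apply: le_trans (ler_normD _ _) _; rewrite !normrM lerD//.
      by rewrite ler_piMr// F1.
    by rewrite ler_piMl// F1.
  by apply: le_trans (ler_norm _) _; rewrite normrM ler_pM.
apply: (@le_trans _ _ (avg (U * V) (fun x => avg Rn (fun r => 2 * D x r)))).
  by apply: ler_avg => x _; apply: step.
rewrite exchange_avg; apply: avg_le.
  by rewrite mulr_ge0// divr_ge0// mulr_ge0.
move=> r rR; rewrite avgZ /D avg_sum.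
rewrite [leRHS](_ : _ = 2 * ((size s)%:R * (2 * (2 * J * (a - a' + (a' - a)) +
   (y - y' + (y' - y)))%:R / U%:R))); last by field; rewrite pnatr_eq0 -lt0n.
rewrite ler_wpM2l//; apply: sumr_le_size => l ls; rewrite avgD.
apply: le_trans (lerD (avg_mismatch _ _ U0 V0 F1 FU) (avg_mismatch _ _ U0 V0 F1 FU)) _.
rewrite -mulrDl ler_pM2r ?invr_gt0 ?ltr0n// -mulrDr ler_pM2l// -natrD ler_nat.
have := hJ _ _ ls rR => lr.
have h1 : ((l + r) * a - (l + r) * a' + ((l + r) * a' - (l + r) * a) <=
    J * (a - a' + (a' - a)))%N.
  by rewrite -!mulnBr -mulnDr leq_mul2r lr orbT.
rewrite -mulnA; set Jd := (J * _)%N in h1 *.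
by move: h1; set u := ((l + r) * a)%N; set v := ((l + r) * a')%N; lia.
Qed.

(** Two points seen by one window are at distance less than [B] modulo [U], on either side; adding
    [B] makes the condition one-sided. *)
Lemma Lam_le (R : realFieldType) U B z : (0 < B <= U)%N ->
  Lam R U B z <= ((z + B) %% U < 2 * B)%N%:R * (U%:R / B%:R).
Proof.
move=> BU; have U0 : (0 < U)%N by lia.
have C0 : 0 <= U%:R / B%:R :> R by rewrite divr_ge0.
rewrite -[leRHS]mul1r -[X in _ <= X * _](@avg_win R U B 0 BU) -avgZr.
apply: ler_avg => y yU; rewrite add0n.
have [h|h] := boolP ((z + B) %% U < 2 * B)%N.
  apply: ler_wpM2l; first exact: win_ge0.
  rewrite [leRHS]mul1r.
  by rewrite /win; case: (_ < _)%N; rewrite /= ?mul1r// mul0r.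
rewrite mul0r mulr0 /win modn_small//.
have [yB|] := boolP (y < B)%N; last by rewrite !mul0r.
have [hz|] := boolP ((y + z) %% U < B)%N; last by rewrite mul0r mulr0.
exfalso; move/negP: h; apply.
have -> : ((z + B) %% U = ((y + z) %% U + (B - y)) %% U)%N.
  by rewrite modnDml; congr (_ %% _)%N; lia.
by apply: leq_ltn_trans (leq_mod _ _) _; lia.
Qed.

Lemma count_progression z0 e C x D : (0 < e)%N ->
  (\sum_(i < C) (x <= z0 + e * i < x + D)%N <= D %/ e + 1)%N.
Proof.
move=> e0; pose i0 := ((x - z0 + e.-1) %/ e)%N.
have aux n : (\sum_(i < C) (i0 <= i < i0 + n)%N <= n)%N.
  elim: n => [|n IHn].
    by rewrite big1// => i _; rewrite addn0 (_ : _ && _ = false)//; lia.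
  apply: (@leq_trans (\sum_(i < C) ((i0 <= i < i0 + n)%N + (nat_of_ord i == i0 + n)%N))).
    by apply: leq_sum => i _; lia.
  rewrite big_split /= -addn1 leq_add//.
  have [h|h] := boolP (i0 + n < C)%N.
    rewrite (bigD1 (Ordinal h))//= eqxx big1// => i; rewrite -val_eqE /=.
    by move=> /negPf->.
  by rewrite big1// => i _; have := ltn_ord i; lia.
apply: leq_trans (aux _); apply: leq_sum => i _.
have [/andP[h1 h2]|//] := boolP (x <= z0 + e * i < x + D)%N.
rewrite lt0b; apply/andP; split.
  rewrite /i0 -ltnS ltn_divLR//; lia.
have hi : (x - z0 <= i0 * e)%N.
  by have := divn_eq (x - z0 + e.-1) e; have := ltn_pmod (x - z0 + e.-1) e0; rewrite -/i0; lia.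
have hD : (D < (D %/ e).+1 * e)%N by rewrite mulSn addnC {1}(divn_eq D e) ltn_add2l ltn_mod.
rewrite -(ltn_pmul2r e0) addn1 mulnDl; lia.
Qed.

(** The condition selects one interval of length [2 * B] in each period [U * V]. The progression
    meets at most [n] periods, and each interval at most [2 * B / e + 1] times. *)
Lemma count_cell U V B e C z0 M : (0 < e)%N -> (0 < U)%N -> (M < V)%N ->
  (\sum_(i < C) [&& (z0 + e * i) %% U < 2 * B & ((z0 + e * i) %/ U) %% V == M]%N
    <= ((e * C) %/ (U * V) + 2) * ((2 * B) %/ e + 1))%N.
Proof.
move=> e0 U0 MV; set W := (U * V)%N; set n := ((e * C) %/ W + 2)%N.
have W0 : (0 < W)%N by rewrite muln_gt0 U0; lia.
pose X q := ((q + z0 %/ W) * W + M * U)%N.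
apply: (@leq_trans (\sum_(i < C) \sum_(q < n) (X q <= z0 + e * i < X q + 2 * B)%N)).
  apply: leq_sum => i _; set z := (z0 + e * i)%N.
  have [/andP[h1 /eqP h2]|//] := boolP (_ && _).
  have q1 : (z0 %/ W <= z %/ W)%N by rewrite leq_div2r// leq_addr.
  have q2 : (z %/ W - z0 %/ W < n)%N.
    have aux (a1 b1 c1 d1 : nat) : (a1 <= b1 + c1 + 1 -> c1 <= d1 -> a1 - b1 < d1 + 2)%N by clear; lia.
    apply: aux (leq_divDl W z0 (e * i)) _.
    by rewrite leq_div2r// leq_mul2l ltnW ?orbT.
  rewrite (bigD1 (Ordinal q2))//= {1}/X subnK//.
  rewrite (_ : (_ <= z < _)%N = true)// /X subnK//.
  have E1 : z = (z %/ U * U + z %% U)%N by exact: divn_eq.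
  have E2 : (z %/ U = z %/ W * V + M)%N by rewrite {1}(divn_eq (z %/ U) V) h2 /W divnMA.
  have -> : (z %/ W * W + M * U = z %/ U * U)%N by rewrite E2 /W; ring.
  by rewrite leq_divM/= {1}E1 ltn_add2l.
rewrite exchange_big /=.
apply: (@leq_trans (\sum_(q < n) ((2 * B) %/ e + 1))).
  by apply: leq_sum => q _; apply: count_progression.
by rewrite sum_nat_const card_ord.
Qed.

Lemma Psi_periodic (R : realFieldType) W (F : nat -> R) s Rn a :
  periodic W F -> periodic W (Psi W F s Rn a).
Proof.
move=> pF y; apply: eq_avg => x _; congr (_ ^+ 2); apply: eq_avg => r _.
by apply: eq_bigr => l _; rewrite addnA pF.
Qed.

Lemma divn_le (R : realFieldType) m d : (0 < d)%N ->
  (m %/ d)%:R <= m%:R / d%:R :> R.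
Proof.
by move=> d0; rewrite ler_pdivlMr ?ltr0n// -natrM ler_nat leq_divM.
Qed.

(* While [a] runs through a cell of length [C], the multiple [e a] winds
   around modulo [U V], whereas [Psi _ y] hardly depends on [a]. *)
Lemma avg_cell (R : realFieldType) U V B C A1 e (F : nat -> R) s Rn J :
  (0 < U)%N -> (0 < V)%N -> (0 < B <= U)%N -> (0 < C)%N ->
  (0 < e <= B)%N -> (U * V <= e * C)%N ->
  (forall x, `|F x| <= 1) -> periodic (U * V) F ->
  (forall y z, (y %/ U = z %/ U)%N -> F y = F z) ->
  (forall l r, l \in s -> (r < Rn)%N -> (l + r <= J)%N) ->
  avg (C * A1) (fun a => Lam R U B (e * a) * Psi (U * V) F s Rn a (e * a)) <=
  9 * avg A1 (fun a1 => avg V (fun M => Psi (U * V) F s Rn (C * a1) (M * U)) +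
     (size s)%:R * (4 * (2 * J * C + B)%:R / U%:R)).
Proof.
move=> U0 V0 BU C0 /andP[e0 eB] eC F1 pF FU hJ.
set err := (size s)%:R * _.
rewrite avg_mulE -avgZ; apply: ler_avg => a1 _.
pose z0 := (e * (C * a1) + B)%N.
pose z a0 := (z0 + e * a0)%N.
pose ind a0 : R := ((z a0 %% U < 2 * B)%N)%:R.
pose M a0 := ((z a0 %/ U) %% V)%N.
pose h M := Psi (U * V) F s Rn (C * a1) (M * U) + err.
have err0 : 0 <= err by rewrite mulr_ge0// divr_ge0// mulr_ge0.
have h0 m : 0 <= h m by rewrite addr_ge0// Psi_ge0.
have UB0 : 0 <= U%:R / B%:R :> R by rewrite divr_ge0.
apply: (@le_trans _ _ (avg C (fun a0 => U%:R / B%:R * (ind a0 * h (M a0))))).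
  apply: ler_avg => a0 a0C; set a := (a0 + C * a1)%N.
  have zE : (e * a + B = z a0)%N by rewrite /a /z /z0; lia.
  apply: le_trans (ler_wpM2r (Psi_ge0 _ _ _ _ _ _) (Lam_le R (e * a) BU)) _.
  rewrite zE /ind; case: (boolP (_ < _)%N) => [zB|_]; last by rewrite !mul0r mulr0.
  rewrite [X in X * _]mul1r [X in _ <= _ * X]mul1r ler_wpM2l//.
  apply: le_trans (Psi_lipschitz _ (C * a1) (e * a) (z a0 %/ U * U) U0 V0 F1 FU hJ) _.
  have -> : Psi (U * V) F s Rn (C * a1) (z a0 %/ U * U) =
            Psi (U * V) F s Rn (C * a1) (M a0 * U).
    rewrite /M {1}(divn_eq (z a0 %/ U) V) mulnDl addnC.
    have -> : ((z a0 %/ U) %/ V * V * U = (z a0 %/ U) %/ V * (U * V))%N by ring.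
    by rewrite (periodicM _ _ (@Psi_periodic _ _ _ _ _ _ pF)).
  rewrite lerD2l /err ler_wpM2l// ler_pM2r ?invr_gt0 ?ltr0n// ler_pM2l// ler_nat.
  rewrite leq_add//.
    by rewrite leq_mul2l; apply/orP; right; rewrite /a; lia.
  have := divn_eq (z a0) U; rewrite -zE => d1; rewrite zE in d1 *.
  by move: d1 zB; rewrite -{1}zE; set t := (_ * U)%N; lia.
rewrite avgZ -[X in _ <= 9 * X](_ : avg V h = _); last first.
  by rewrite /h avgD (avg_const err V0).
have -> : avg C (fun a0 => ind a0 * h (M a0)) =
    (\sum_(m < V) h m * (\sum_(i < C) [&& (z i %% U < 2 * B) & ((z i %/ U) %% V == m)]%N)%:R) / C%:R.
  rewrite /avg; congr (_ / _).
  under [RHS]eq_bigr do rewrite natr_sum mulr_sumr.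
  rewrite exchange_big /=; apply: eq_bigr => i _.
  have MV : (M i < V)%N by rewrite ltn_mod.
  rewrite (bigD1 (Ordinal MV))//= -/(M i) eqxx andbT big1 ?addr0.
    by rewrite mulrC.
  by move=> m; rewrite -val_eqE /= eq_sym => /negPf; rewrite /M => ->; rewrite andbF mulr0.
set W := (U * V)%N in eC *.
have W0 : (0 < W)%N by rewrite muln_gt0 U0.
pose cnt := (((e * C) %/ W + 2) * ((2 * B) %/ e + 1))%N.
(* [U * V <= e * C] absorbs the [2] and [e <= B] the [1]: the two factors are at most
   [3 * (e * C / W)] and [3 * (B / e)], whence the [9]. *)
have cntE : cnt%:R <= 9 * (C%:R * B%:R / W%:R) :> R.
  have eR : 0 < e%:R :> R by rewrite ltr0n.
  have WR : 0 < W%:R :> R by rewrite ltr0n.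
  rewrite /cnt natrM !natrD.
  have c1 : ((e * C) %/ W)%:R + 2 <= 3 * (e%:R * C%:R / W%:R) :> R.
    have := divn_le R (e * C) W0; rewrite natrM.
    have : 1 <= e%:R * C%:R / W%:R :> R by rewrite ler_pdivlMr// mul1r -natrM ler_nat.
    by lra.
  have c2 : ((2 * B) %/ e)%:R + 1 <= 3 * (B%:R / e%:R) :> R.
    have := divn_le R (2 * B) e0; rewrite natrM.
    have : 1 <= B%:R / e%:R :> R by rewrite ler_pdivlMr// mul1r ler_nat.
    by lra.
  apply: le_trans (ler_pM _ _ c1 c2) _; rewrite ?addr_ge0//.
  by rewrite le_eqVlt; apply/orP; left; apply/eqP; field; rewrite !gt_eqF.
apply: (@le_trans _ _ (U%:R / B%:R * ((\sum_(m < V) h m * (9 * (C%:R * B%:R / W%:R))) / C%:R))).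
  rewrite ler_wpM2l// ler_wpM2r ?invr_ge0//; apply: ler_sum => m _.
  rewrite ler_wpM2l//; apply: le_trans cntE; rewrite ler_nat.
  exact: count_cell.
rewrite -mulr_suml /avg /W natrM.
rewrite le_eqVlt; apply/orP; left; apply/eqP; field.
have BN0 : (0 < B)%N by case/andP: BU.
by rewrite !pnatr_eq0 -!lt0n U0 V0 BN0 C0.
Qed.

Lemma avg_mean_Lam (R : realFieldType) m1 beta j K : (beta <= m1)%N ->
  (0 < K <= 2 ^ beta)%N ->
  avg (2 ^ (m1 + j)) (mean_Lam R (2 ^ m1) (2 ^ beta) K) <=
  2 * ((2 ^ m1)%:R / (2 ^ beta)%:R / K%:R + 1).
Proof.
move=> bm /andP[K0 KB].
have BU : (0 < 2 ^ beta <= 2 ^ m1)%N by rewrite expn_gt0 leq_exp2l.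
apply: (@le_trans _ _ (avg (2 ^ (m1 + j)) (fun a => 2 * avg K (fun e =>
   Lam R (2 ^ m1) (2 ^ beta) (e * a))))).
  by apply: ler_avg => a _; apply: (avg_dist_le K (F := fun e => Lam R (2 ^ m1) (2 ^ beta) (e * a))) => e; apply: Lam_ge0.
rewrite avgZ ler_wpM2l// exchange_avg.
apply: (@le_trans _ _ (avg K (fun e => (e == 0%N)%:R * ((2 ^ m1)%:R / (2 ^ beta)%:R) + 1))).
  apply: ler_avg => e eK; case: (eqVneq e 0%N) => [->|e0].
    by rewrite [X in avg _ X <= _](_ : _ = fun=> Lam R (2 ^ m1) (2 ^ beta) 0)// avg_const ?expn_gt0// Lam0// mul1r lerDl.
  by rewrite avg_Lam//; [rewrite mul0r add0r|lia].
by rewrite avgD avgZr avg_eqn// avg_const// mulrC.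
Qed.

Lemma avg_Lam_Psi (R : realFieldType) m1 beta V C A1 j K k0 (F : nat -> R) s Rn J :
  let U := (2 ^ m1)%N in let B := (2 ^ beta)%N in
  (beta <= m1)%N -> (0 < V)%N -> (0 < C)%N -> (2 ^ (m1 + j) = C * A1)%N ->
  (0 < K <= B)%N -> (k0 <= K)%N -> (U * V <= k0 * C)%N ->
  (forall x, `|F x| <= 1) -> periodic (U * V) F ->
  (forall y z, (y %/ U = z %/ U)%N -> F y = F z) ->
  (forall l r, l \in s -> (r < Rn)%N -> (l + r <= J)%N) ->
  avg (2 ^ (m1 + j)) (fun a => avg K (fun e =>
     Lam R U B (e * a) * Psi (U * V) F s Rn a (e * a))) <=
  U%:R / B%:R / K%:R + k0%:R / K%:R +
  9 * avg A1 (fun a1 => avg V (fun M => Psi (U * V) F s Rn (C * a1) (M * U)) +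
     (size s)%:R * (4 * (2 * J * C + B)%:R / U%:R)).
Proof.
move=> U B bm V0 C0 AE /andP[K0 KB] k0K UV F1 pF FU hJ.
have BU : (0 < B <= U)%N by rewrite expn_gt0 leq_exp2l.
have U0 : (0 < U)%N by rewrite expn_gt0.
rewrite exchange_avg; set X := 9 * _.
have X0 : 0 <= X.
  apply: mulr_ge0 => //; apply: avg_ge0 => a _; apply: addr_ge0.
    by apply: avg_ge0 => M _; apply: Psi_ge0.
  by apply: mulr_ge0 => //; apply: divr_ge0 => //; apply: mulr_ge0.
have triv e : avg (2 ^ (m1 + j)) (fun a => Lam R U B (e * a) *
      Psi (U * V) F s Rn a (e * a)) <= avg (2 ^ (m1 + j)) (fun a => Lam R U B (e * a)).
  by apply: ler_avg => a _; rewrite ler_piMr ?Lam_ge0 ?Psi_le1.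
apply: (@le_trans _ _ (avg K (fun e => (e == 0%N)%:R * (U%:R / B%:R) +
   ((e < k0)%N)%:R + X))).
  apply: ler_avg => e eK; have [ek|ke] := ltnP e k0; last first.
    apply: (@le_trans _ _ X); last by rewrite lerDr addr_ge0// mulr_ge0// divr_ge0.
    rewrite AE; apply: avg_cell => //.
      apply/andP; split; last by lia.
      case: (e) ke => //; rewrite leqn0 => /eqP k00.
      by move: UV; rewrite k00 mul0n leqn0 muln_eq0 !eqn0Ngt U0 V0.
    by apply: leq_trans UV _; rewrite leq_mul2r ke orbT.
  apply: le_trans (triv e) _; case: (eqVneq e 0%N) => [->|e0].
    rewrite [X in avg _ X <= _](_ : _ = fun=> Lam R U B 0)// avg_const ?expn_gt0// Lam0// mul1r.
    by rewrite -addrA lerDl addr_ge0.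
  rewrite avg_Lam//; last by rewrite -/B; lia.
  by rewrite mul0r add0r lerDl.
by rewrite !avgD avgZr avg_eqn// avg_const// avg_ltn// [K%:R^-1 * _]mulrC.
Qed.

(** * Isolating the low bits of the window *)

Definition twisted (R : realFieldType) (F : nat -> R) (s : seq nat) (a y x : nat) : R :=
  \prod_(l <- s) (F (x + l * a)%N * F (x + l * a + y)%N).

Lemma twisted_le1 (R : realFieldType) (F : nat -> R) s a y x :
  (forall x, `|F x| <= 1) -> `|twisted F s a y x| <= 1.
Proof.
move=> F1; rewrite normr_prod prodr_ile1// => l _.
by rewrite normr_ge0 normrM -[leRHS]mulr1 ler_pM.
Qed.

Lemma twisted_periodic (R : realFieldType) W (F : nat -> R) s a y :
  periodic W F -> periodic W (twisted F s a y).
Proof.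
move=> pF x; apply: eq_bigr => l _.
by rewrite (addnAC x W) (addnAC _ W y) !pF.
Qed.

Lemma twisted_lipschitz (R : realFieldType) U V (F : nat -> R) s a a' y c c' d :
  (0 < U)%N -> (0 < V)%N -> (forall x, `|F x| <= 1) ->
  (forall y z, (y %/ U = z %/ U)%N -> F y = F z) ->
  (forall l, l \in s -> (c + l * a - (c' + l * a') + (c' + l * a' - (c + l * a)) <= d)%N) ->
  avg (U * V) (fun x => `|twisted F s a y (x + c) - twisted F s a' y (x + c')|) <=
  (size s)%:R * (4 * (d%:R / U%:R)).
Proof.
move=> U0 V0 F1 FU hd.
have bd1 b e : `|F b * F e| <= 1 by rewrite normrM -[leRHS]mulr1 ler_pM.
pose D x l := `|F (x + (c + l * a))%N - F (x + (c' + l * a'))%N| +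
  `|F (x + (c + l * a + y))%N - F (x + (c' + l * a' + y))%N|.
apply: (@le_trans _ _ (avg (U * V) (fun x => \sum_(l <- s) D x l))).
  apply: ler_avg => x _; apply: le_trans (prod_dist _ _ _) _ => //.
  apply: ler_sum => l _; rewrite /D !addnA.
  set A := F _; set B := F _; set A' := F _; set B' := F _.
  have -> : A * B - A' * B' = (A - A') * B + A' * (B - B') by ring.
  apply: le_trans (ler_normD _ _) _; rewrite !normrM lerD//.
    by rewrite ler_piMr// F1.
  by rewrite ler_piMl// F1.
rewrite avg_sum; apply: sumr_le_size => l ls; rewrite avgD.
apply: le_trans (lerD (avg_mismatch _ _ U0 V0 F1 FU) (avg_mismatch _ _ U0 V0 F1 FU)) _.
rewrite -mulrDl mulrA ler_pM2r ?invr_gt0 ?ltr0n// -mulrDr.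
have -> : 4 = 2 * 2 :> R by ring.
rewrite -mulrA ler_pM2l// -natrD -natrM ler_nat.
by have := hd _ ls; lia.
Qed.

(** [r] enters only as a translation by [r * a], so the opened square consists of autocorrelations
    of [twisted]. *)
Lemma Psi_twisted (R : realFieldType) W (F : nat -> R) s Rn a y :
  Psi W F s Rn a y = avg Rn (fun r => avg Rn (fun r' => avg W (fun x =>
    twisted F s a y (x + r * a) * twisted F s a y (x + r' * a)))).
Proof.
rewrite /Psi.
under eq_avg do rewrite avg_sqr.
rewrite exchange_avg; apply: eq_avg => r _.
rewrite exchange_avg; apply: eq_avg => r' _; apply: eq_avg => x _.
by rewrite /twisted; congr (_ * _); apply: eq_bigr => l _;
  congr (F _ * F _); lia.
Qed.

(** A progression of total length [st * I] hardly changes under a translation by [z * U] with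
    [z < Z]: up to a remainder below [st], which costs [mis], this is a translation by whole steps.
    So an average over steps of length [U] can be inserted and the original one dropped. A step of
    [U] adds exactly [1] to [x %/ U], which is what the digit argument needs. *)
Lemma window_average (R : realFieldType) U V Z I st (Q : nat -> R) (mis : R) :
  (0 < I)%N -> (0 < Z)%N -> (0 < st)%N ->
  periodic (U * V) Q -> (forall x, `|Q x| <= 1) ->
  (forall c, (c < st)%N -> avg (U * V) (fun x => `|Q (x + 0)%N - Q (x + c)%N|) <= mis) ->
  avg (U * V) (fun x => `|avg I (fun i => Q (x + i * st)%N)|) <=
  avg (U * V) (fun x => `|avg Z (fun z => Q (x + z * U)%N)|) +
  (2 * (Z * U)%:R / (st * I)%:R + mis).
Proof.
move=> I0 Z0 st0 pQ Q1 hm.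
have step z : (z < Z)%N -> avg (U * V) (fun x => `|avg I (fun i => Q (x + i * st)%N) -
    avg I (fun i => Q (x + i * st + z * U)%N)|) <= 2 * (Z * U)%:R / (st * I)%:R + mis.
  move=> zZ; set z1 := ((z * U) %/ st)%N; set z0 := ((z * U) %% st)%N.
  have zE : (z * U = z1 * st + z0)%N by exact: divn_eq.
  have z0s : (z0 < st)%N by rewrite ltn_mod.
  pose G x := avg I (fun i => `|Q (x + i * st + 0)%N - Q (x + i * st + z0)%N|).
  apply: (@le_trans _ _ (avg (U * V) (fun x => 2 * (Z * U)%:R / (st * I)%:R + G x))).
    apply: ler_avg => x _.
    set A := avg I _; set B := avg I _; pose A' := avg I (fun i => Q (x + i * st + z0)%N).
    have -> : A - B = (A' - B) + (A - A') by ring.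
    apply: le_trans (ler_normD _ _) _; rewrite lerD//.
      have -> : B = avg I (fun i => Q (x + (i + z1) * st + z0)%N).
        by apply: eq_avg => i _; congr Q; rewrite zE; ring.
      apply: le_trans (avg_translate I z1 (g := fun i => Q (x + i * st + z0)%N) _) _ => //.
      rewrite (natrM _ st I) invfM mulrA ler_pM2r ?invr_gt0 ?ltr0n// -mulrA ler_pM2l//.
      apply: le_trans (divn_le R _ st0) _.
      by rewrite ler_pM2r ?invr_gt0 ?ltr0n// ler_nat leq_mul2r ltnW ?orbT.
    rewrite /A /A' -avgB; apply: le_trans (ler_norm_avg _ _) _.
    by apply: ler_avg => i _; rewrite addn0.
  have W0 : (0 < U * V)%N \/ (U * V = 0)%N by lia.
  case: W0 => [W0|W0]; last first.
    rewrite W0 /avg !big_ord0 !mul0r addr_ge0// ?divr_ge0 ?mulr_ge0//.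
    by have := hm 0%N st0; rewrite W0 /avg big_ord0 mul0r.
  rewrite avgD avg_const// lerD2l /G exchange_avg; apply: avg_le.
    apply: le_trans (hm 0%N st0); apply: avg_ge0 => x _; exact: normr_ge0.
  move=> i _; apply: le_trans (hm _ z0s); rewrite le_eqVlt; apply/orP; left; apply/eqP.
  have pG : periodic (U * V) (fun x => `|Q (x + 0)%N - Q (x + z0)%N|).
    by move=> x; rewrite (addnAC x _ 0%N) (addnAC x _ z0) !pQ.
  by rewrite -[RHS](avg_shift (i * st) pG).
set E := _ + mis.
have pH : periodic (U * V) (fun x => `|avg Z (fun z => Q (x + z * U)%N)|).
  by move=> x; congr `|_|; apply: eq_avg => z _; rewrite addnAC pQ.
apply: (@le_trans _ _ (avg (U * V) (fun x =>
    avg I (fun i => `|avg Z (fun z => Q (x + i * st + z * U)%N)|) +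
    avg Z (fun z => `|avg I (fun i => Q (x + i * st)%N) -
       avg I (fun i => Q (x + i * st + z * U)%N)|)))).
  apply: ler_avg => x _; set A := avg I (fun i => Q (x + i * st)%N).
  pose B := avg I (fun i => avg Z (fun z => Q (x + i * st + z * U)%N)).
  have h : `|A| <= `|B| + `|A - B|.
    have := ler_normD B (A - B); have -> : B + (A - B) = A by ring.
    by [].
  apply: le_trans h _; rewrite lerD//; first exact: ler_norm_avg.
  rewrite /B exchange_avg -[X in `|X - _|](avg_const A Z0) -avgB.
  exact: ler_norm_avg.
rewrite avgD lerD//.
  rewrite exchange_avg; apply: avg_le; first by apply: avg_ge0.
  by move=> i _; rewrite (avg_shift (i * st) pH).
rewrite exchange_avg; apply: avg_le => //.
by apply: le_trans (step _ Z0); apply: avg_ge0 => x _; apply: normr_ge0.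
Qed.

Definition quot_sg (R : realFieldType) (rho U z : nat) : R := sg R 0 rho (z %/ U).

(** Since [U = C * T], the quotients of [x], [C * a] and [M * U] by [U] are [x %/ U], [a %/ T] and
    [M], three independent uniform numbers. The remainders only create carries [e l <= l], below
    [2 ^ p], so [digit_contraction] applies for all [x], [a] and [M]. *)
Lemma avg_twisted_digits (R : realFieldType) (p p' : nat) (s : seq nat)
    n i j C T U :
  let m := (p + p' + 3)%N in
  (2 ^ p' + 3 <= 2 ^ p)%N ->
  s != [::] -> uniq s -> (forall l, l \in s -> (l < 2 ^ p')%N) ->
  (0 < C)%N -> (0 < T)%N -> U = (C * T)%N ->
  avg (T * 2 ^ (m * n + j)) (fun a => avg (2 ^ (m * n + i)) (fun M =>
    avg (U * 2 ^ (m * n + i)) (fun x => `|avg (2 ^ (m * n)) (fun z =>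
      twisted (quot_sg R (m * n + i) U) s (C * a) (M * U) (x + z * U)%N)|))) <=
  (1 - 2 / (2 ^ m)%:R ^+ 4) ^+ n.
Proof.
move=> m pp' s0 us sp C0 T0 UE.
set V := (2 ^ (m * n + i))%N; set F := quot_sg R _ U.
have U0 : (0 < U)%N by rewrite UE muln_gt0 C0.
have p0M : (2 ^ p < 2 ^ m)%N by rewrite ltn_exp2l// /m; lia.
have p1M : (2 ^ (p + p') < 2 ^ m)%N by rewrite ltn_exp2l// /m; lia.
pose dw := digit_weight R m (2 ^ p) (2 ^ (p + p')) n.
have key a M x : `|avg (2 ^ (m * n)) (fun z => twisted F s (C * a) (M * U) (x + z * U)%N)| <=
    dw (x %/ U)%N (a %/ T)%N M.
  pose e l := ((x %% U + l * ((C * a) %% U)) %/ U)%N.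
  have aT : ((C * a) %/ U = a %/ T)%N by rewrite UE divnMl.
  have es l : l \in s -> (e l < 2 ^ p)%N /\ (e l < 2 ^ p)%N.
    move=> /sp lp.
    suff : (e l < 2 ^ p)%N by [].
    rewrite /e ltn_divLR//; apply: (@leq_trans (l.+1 * U)).
      have h1 := ltn_pmod x U0; have h2 := ltn_pmod (C * a) U0.
      rewrite mulSn; have : (l * ((C * a) %% U) <= l * U)%N by rewrite leq_mul2l ltnW ?orbT.
      by move: h1; set u := (_ %% U)%N; set v := (l * _)%N; lia.
    by rewrite leq_mul2r; apply/orP; right; lia.
  apply: le_trans (@digit_contraction R p p' s pp' s0 us sp n i _ _ _ e e es).
  rewrite le_eqVlt; apply/orP; left; apply/eqP; congr `|_|; apply: eq_avg => z _.
  apply: eq_bigr => l _; rewrite /F /quot_sg -aT.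
  have E1 : (x + z * U + l * (C * a) =
     (z + x %/ U + l * ((C * a) %/ U)) * U + (x %% U + l * ((C * a) %% U)))%N.
    by rewrite {1}(divn_eq x U) {1}(divn_eq (C * a) U); ring.
  rewrite E1 divnMDl// -/(e l).
  have -> : ((z + x %/ U + l * ((C * a) %/ U)) * U + (x %% U + l * ((C * a) %% U)) + M * U =
    (z + x %/ U + l * ((C * a) %/ U) + M) * U + (x %% U + l * ((C * a) %% U)))%N by ring.
  by rewrite divnMDl// -/(e l).
apply: (@le_trans _ _ (avg (T * 2 ^ (m * n + j)) (fun a => avg V (fun M => avg (U * V) (fun x =>
    dw (x %/ U)%N (a %/ T)%N M))))).
  by apply: ler_avg => a _; apply: ler_avg => M _; apply: ler_avg => x _; apply: key.
rewrite (avg_divn _ (fun a => avg V (fun M => avg (U * V) (fun x => dw (x %/ U)%N a M))))//.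
rewrite -(@avg_digit_weight R m (2 ^ p) (2 ^ (p + p')) n i j i)//.
rewrite [leRHS]exchange_avg; apply: ler_avg => a _.
rewrite [leRHS]exchange_avg; apply: ler_avg => M _.
by rewrite (avg_divn _ (fun x => dw x a M)).
Qed.

Lemma avg_autocorrelation (R : realFieldType) W (Q : nat -> R) u v : periodic W Q ->
  avg W (fun x => Q (x + u)%N * Q (x + v)%N) =
  avg W (fun x => Q x * Q (x + (u - v + (v - u)))%N).
Proof.
move=> pQ; wlog uv : u v / (u <= v)%N.
  move=> Wl; have [/Wl//|/ltnW /Wl] := leqP u v.
  by rewrite addnC => <-; apply: eq_avg => y _; rewrite mulrC.
rewrite -[RHS](avg_shift u) => [|x]; last by rewrite addnAC !pQ.
by apply: eq_avg => x _; congr (_ * Q _); lia.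
Qed.

(** After the square is opened only the distance [e] of [r] and [r'] matters, and [e < e0] is
    bounded trivially. For larger [e] the slopes [C * a] are cut into runs of [I]. Along a run the
    slope inside [twisted] is frozen, at the cost [2 * c1], while the translation by [e * C * a]
    still advances in steps [e * C] over a length at least [e0 * C * I], meant to be long compared
    with [2 ^ (m * n) * U]; [window_average] turns these into steps of [U]. *)
Lemma avg_Psi_bound (R : realFieldType) (p p' : nat) (s : seq nat)
    n i j C I T U Rn e0 Lb :
  let m := (p + p' + 3)%N in
  (2 ^ p' + 3 <= 2 ^ p)%N ->
  s != [::] -> uniq s -> (forall l, l \in s -> (l < 2 ^ p')%N) ->
  (forall l, l \in s -> (l <= Lb)%N) ->
  (0 < C)%N -> (0 < I)%N -> (0 < T)%N -> U = (C * I * T)%N ->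
  (0 < e0 <= Rn)%N ->
  avg (I * (T * 2 ^ (m * n + j))) (fun a => avg (2 ^ (m * n + i)) (fun M =>
     Psi (U * 2 ^ (m * n + i)) (quot_sg R (m * n + i) U) s Rn (C * a) (M * U))) <=
  2 * (e0%:R / Rn%:R + ((size s)%:R * (8 * ((Lb * (C * I))%:R / U%:R)) +
     2 * (2 ^ (m * n) * U)%:R / (e0 * C * I)%:R +
     (size s)%:R * (4 * ((Rn * C)%:R / U%:R)) +
     (1 - 2 / (2 ^ m)%:R ^+ 4) ^+ n)).
Proof.
move=> m pp' s0 us sp sL C0 I0 T0 UE /andP[e00 e0R].
set V := (2 ^ (m * n + i))%N; set F := quot_sg R _ U.
have R0 := leq_trans e00 e0R.
have U0 : (0 < U)%N by rewrite UE !muln_gt0 C0 I0.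
have V0 : (0 < V)%N by rewrite expn_gt0.
have W0 : (0 < U * V)%N by rewrite muln_gt0 U0.
set W := (U * V)%N in W0 *.
have F1 x : `|F x| <= 1 by rewrite norm_sg.
have FU y z : (y %/ U = z %/ U)%N -> F y = F z by rewrite /F /quot_sg => ->.
have pF : periodic W F.
  by move=> x; rewrite /F /quot_sg /W (mulnC U) divnDMl// (sg_periodic R 0).
set A1 := (I * _)%N; set A2 := (T * 2 ^ _)%N in A1 *.
pose Q a M := twisted F s a (M * U).
have Q1 a M x : `|Q a M x| <= 1 by apply: twisted_le1.
have pQ a M : periodic W (Q a M) by apply: twisted_periodic.
pose G e := `|avg A1 (fun a => avg V (fun M => avg W (fun x =>
    Q (C * a)%N M x * Q (C * a)%N M (x + e * (C * a))%N)))|.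
have G0 e : 0 <= G e by exact: normr_ge0.
have G1 e : G e <= 1.
  do 3 (apply: norm_avg_le1 => ? _).
  by rewrite normrM -[leRHS]mulr1 ler_pM.
set bnd := _ + (1 - _) ^+ n.
have bnd0 : 0 <= bnd.
  have th0 : 0 <= 1 - 2 / (2 ^ m)%:R ^+ 4 :> R.
    rewrite subr_ge0 ler_pdivrMr ?exprn_gt0 ?ltr0n ?expn_gt0// mul1r -natrX ler_nat.
    by rewrite -expnM; apply: (@leq_trans (2 ^ 1)%N); rewrite // leq_exp2l// /m; lia.
  by rewrite /bnd !addr_ge0 ?exprn_ge0 ?mulr_ge0 ?invr_ge0 ?ler0n.
apply: (@le_trans _ _ (2 * avg Rn (fun e => G e))).
  apply: (le_trans _ (avg_dist_le Rn G0)).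
  apply: (@le_trans _ _ (avg Rn (fun r => avg Rn (fun r' => avg A1 (fun a => avg V (fun M =>
     avg W (fun x => Q (C * a)%N M (x + r * (C * a))%N * Q (C * a)%N M (x + r' * (C * a))%N))))))).
    rewrite le_eqVlt; apply/orP; left; apply/eqP.
    have E1 a : avg V (fun M => Psi W F s Rn (C * a) (M * U)) =
        avg Rn (fun r => avg Rn (fun r' => avg V (fun M => avg W (fun x =>
          Q (C * a)%N M (x + r * (C * a))%N * Q (C * a)%N M (x + r' * (C * a))%N)))).
      under eq_avg do rewrite Psi_twisted.
      by rewrite exchange_avg; apply: eq_avg => r _; rewrite exchange_avg.
    rewrite [LHS](eq_avg (fun a _ => E1 a)).
    by rewrite exchange_avg; apply: eq_avg => r _; rewrite exchange_avg.
  apply: ler_avg => r _; apply: ler_avg => r' _.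
  apply: le_trans (ler_norm _) _; rewrite /G le_eqVlt; apply/orP; left; apply/eqP.
  congr `|_|; apply: eq_avg => a _; apply: eq_avg => M _.
  by rewrite avg_autocorrelation// distn_mul.
rewrite ler_wpM2l//.
apply: (@le_trans _ _ (avg Rn (fun e => ((e < e0)%N)%:R + bnd))); last first.
  by rewrite avgD avg_ltn// avg_const.
apply: ler_avg => e eR; have [ee0|e0e] := ltnP e e0.
  by apply: le_trans (G1 e) _; rewrite lerDl.
rewrite add0r /G; have ep : (0 < e)%N by exact: leq_trans e0e.
pose a' a2 := (C * I * a2)%N.
pose H a2 M := avg W (fun x => `|avg (2 ^ (m * n)) (fun z => Q (a' a2) M (x + z * U)%N)|).
pose c1 : R := (size s)%:R * (4 * ((Lb * (C * I))%:R / U%:R)).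
pose c2 : R := 2 * (2 ^ (m * n) * U)%:R / (e0 * C * I)%:R.
pose c3 : R := (size s)%:R * (4 * ((Rn * C)%:R / U%:R)).
have cell a2 M : `|avg I (fun i0 => avg W (fun x =>
    Q (C * (i0 + I * a2))%N M x *
    Q (C * (i0 + I * a2))%N M (x + e * (C * (i0 + I * a2)))%N))| <=
    2 * c1 + (c2 + c3 + H a2 M).
  pose A i0 := avg W (fun x => Q (C * (i0 + I * a2))%N M x *
    Q (C * (i0 + I * a2))%N M (x + e * (C * (i0 + I * a2)))%N).
  pose B i0 := avg W (fun x => Q (a' a2) M x *
    Q (a' a2) M (x + (i0 * (e * C) + e * a' a2))%N).
  have AB i0 : (i0 < I)%N -> `|A i0 - B i0| <= 2 * c1.
    move=> i0I; rewrite /A /B -avgB; apply: le_trans (ler_norm_avg _ _) _.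
    set a := (C * (i0 + I * a2))%N.
    have aa : (a - a' a2 <= C * I)%N /\ (a' a2 <= a)%N.
      have -> : a = (a' a2 + C * i0)%N by rewrite /a /a'; ring.
      by rewrite leq_addr addKn leq_mul2l ltnW ?orbT.
    have ea : (i0 * (e * C) + e * a' a2 = e * a)%N by rewrite /a /a'; ring.
    rewrite ea.
    have lip c : avg W (fun x => `|Q a M (x + c)%N - Q (a' a2) M (x + c)%N|) <= c1.
      apply: twisted_lipschitz => // l /sL lL.
      have -> : (c + l * a - (c + l * a' a2) + (c + l * a' a2 - (c + l * a)) =
         l * (a - a' a2))%N.
        rewrite !subnDl -!mulnBr (_ : a' a2 - a = 0)%N ?muln0 ?addn0//.
        by apply/eqP; rewrite subn_eq0; case: aa.
      by apply: leq_mul => //; case: aa.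
    apply: (@le_trans _ _ (avg W (fun x => `|Q a M (x + 0)%N - Q (a' a2) M (x + 0)%N| +
       `|Q a M (x + e * a)%N - Q (a' a2) M (x + e * a)%N|))).
      apply: ler_avg => x _; rewrite addn0.
      set u := Q a M x; set v := Q a M _; set u' := Q (a' a2) M x; set v' := Q (a' a2) M _.
      have -> : u * v - u' * v' = (u - u') * v + u' * (v - v') by ring.
      apply: le_trans (ler_normD _ _) _; rewrite !normrM lerD//.
        by rewrite ler_piMr// Q1.
      by rewrite ler_piMl// Q1.
    by rewrite avgD mulr_natl mulr2n lerD.
  have hB : `|avg I B| <= c2 + c3 + H a2 M.
    rewrite /B exchange_avg.
    apply: (@le_trans _ _ (avg W (fun x => `|avg I (fun i0 => Q (a' a2) M (x + i0 * (e * C))%N)|))).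
      pose K x := `|avg I (fun i0 => Q (a' a2) M (x + i0 * (e * C))%N)|.
      have pK : periodic W K.
        by move=> x; congr `|_|; apply: eq_avg => i0 _; rewrite addnAC pQ.
      rewrite -[leRHS](avg_shift (e * a' a2) pK); apply: le_trans (ler_norm_avg _ _) _.
      apply: ler_avg => x _; rewrite avgZ normrM /K.
      rewrite (eq_avg (G := fun i0 => Q (a' a2) M (x + e * a' a2 + i0 * (e * C))%N)).
        by rewrite ler_piMl.
      by move=> i0 _; congr Q; lia.
    apply: le_trans (window_average (U := U) (V := V) (Z := 2 ^ (m * n)) (mis := c3) I0 _ _ (pQ _ _) (Q1 _ _) _) _.
    - by rewrite expn_gt0.
    - by rewrite muln_gt0 ep.
    - move=> c cs; apply: le_trans (twisted_lipschitz (d := (e * C)%N) _ _ _ _ _ _) _ => //.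
        by move=> l _; rewrite add0n; lia.
      rewrite /c3 ler_wpM2l// ler_pM2l// ler_pM2r ?invr_gt0 ?ltr0n// ler_nat.
      by rewrite leq_mul2r ltnW ?orbT.
    rewrite -/(H a2 M) addrC lerD2r lerD2r /c2 -!(mulrA 2) ler_pM2l//.
    rewrite ler_pM2l ?ltr0n ?muln_gt0 ?expn_gt0//.
    rewrite lef_pV2 ?posrE ?ltr0n ?muln_gt0 ?ep ?e00 ?C0// ler_nat.
    by rewrite leq_mul2r leq_mul2r e0e !orbT.
  rewrite -/(avg I A) (_ : avg I A = (avg I A - avg I B) + avg I B); last by ring.
  apply: le_trans (ler_normD _ _) _; rewrite lerD// -avgB.
  apply: le_trans (ler_norm_avg _ _) _; apply: avg_le => //.
  by rewrite /c1 !mulr_ge0 ?invr_ge0 ?ler0n.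
apply: (@le_trans _ _ (avg A2 (fun a2 => avg V (fun M => 2 * c1 + (c2 + c3 + H a2 M))))).
  rewrite /A1 avg_mulE; apply: le_trans (ler_norm_avg _ _) _; apply: ler_avg => a2 _.
  rewrite exchange_avg; apply: le_trans (ler_norm_avg _ _) _; apply: ler_avg => M _.
  exact: cell.
have dig := @avg_twisted_digits R p p' s n i j (C * I) T U pp' s0 us sp.
have {}dig : avg A2 (fun a2 => avg V (fun M => H a2 M)) <= (1 - 2 / (2 ^ m)%:R ^+ 4) ^+ n.
  by apply: dig; rewrite ?muln_gt0 ?C0.
have A20 : (0 < A2)%N by rewrite muln_gt0 T0 expn_gt0.
rewrite (_ : avg A2 _ = 2 * c1 + (c2 + c3 + avg A2 (fun a2 => avg V (fun M => H a2 M)))); last first.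
  rewrite -[X in _ = 2 * c1 + (X + _)](avg_const _ A20) -avgD.
  rewrite -[X in _ = X + _](avg_const _ A20) -avgD; apply: eq_avg => a2 _.
  rewrite -[X in _ = 2 * c1 + (X + _)](avg_const _ V0) -avgD.
  by rewrite -[X in _ = X + _](avg_const _ V0) -avgD.
have c1E : 2 * c1 = (size s)%:R * (8 * ((Lb * (C * I))%:R / U%:R)) by rewrite /c1; ring.
rewrite /bnd -c1E -/c2 -/c3; move: dig; lra.
Qed.

(** * The integer model *)

Lemma tm_divn (R : realFieldType) q w x : (q <= w)%N ->
  tm R (x %/ 2 ^ q) = sg R q w x * tm R (x %/ 2 ^ w).
Proof.
move=> qw; have xk k : (x %/ 2 ^ k < 2 ^ x)%N.
  by apply: leq_ltn_trans (leq_div _ _) _; apply: ltn_expl.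
rewrite (tmE _ (xk w)) -sg_div -sg_cat; last by rewrite qw leq_addr.
rewrite (@tmE _ _ (w - q + x)); last first.
  by apply: leq_trans (xk q) _; rewrite leq_exp2l// leq_addl.
by rewrite -sg_div addnA subnKC.
Qed.

Lemma norm_tm (R : realFieldType) x : `|tm R x| = 1.
Proof. exact: norm_sg. Qed.

(** The product of all bits from [q] on is that of the bits below [w] times the sign of [u n], the
    quotient by [2 ^ w]. If [u] is constant along the next [J] terms, this sign is a common factor
    of the inner average and disappears in the absolute value. Otherwise [u] grows by at least [1],
    so the number of exceptions is bounded by a telescoping sum. *)
Lemma truncation (R : realFieldType) q w N Rn J (s : seq nat) a b :
  (q <= w)%N -> (0 < N)%N -> (0 < Rn)%N ->
  (forall l r, l \in s -> (r < Rn)%N -> (l + r <= J)%N) ->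
  `|avg N (fun n => \prod_(l <- s) tm R ((b + n * a + l * a) %/ 2 ^ q))| <=
  avg N (fun n => `|avg Rn (fun r =>
     \prod_(l <- s) sg R q w (b + n * a + (l + r) * a))|) +
  (2 * Rn%:R / N%:R + J%:R * (a%:R / (2 ^ w)%:R + N%:R^-1)).
Proof.
move=> qw N0 R0 hJ.
pose g n := \prod_(l <- s) tm R ((b + n * a + l * a) %/ 2 ^ q).
have g1 n : `|g n| <= 1.
  by rewrite normr_prod prodr_ile1// => l _; rewrite norm_tm ler01 lexx.
pose u n := ((b + n * a) %/ 2 ^ w)%N.
have w0 : (0 < 2 ^ w)%N by rewrite expn_gt0.
have umono i k : (u i <= u (i + k))%N.
  by rewrite /u leq_div2r// leq_add2l leq_mul2r leq_addr orbT.
set S := avg N _; set SL := avg N _.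
have e1 : `|S - avg N (fun n => avg Rn (fun r => g (n + r)%N))| <= 2 * Rn%:R / N%:R.
  rewrite exchange_avg -[X in `|X - _|](avg_const _ R0) -avgB.
  apply: le_trans (ler_norm_avg _ _) _.
  apply: avg_le => [|r rR]; first by rewrite divr_ge0 ?mulr_ge0.
  apply: (@le_trans _ _ (2 * r%:R / N%:R)); first exact: avg_translate.
  by rewrite ler_pM2r ?invr_gt0 ?ltr0n// ler_pM2l// ler_nat ltnW.
have e2 : `|avg N (fun n => avg Rn (fun r => g (n + r)%N))| <=
    SL + avg N (fun n => (u (n + J))%:R - (u n)%:R).
  rewrite /SL -avgD; apply: le_trans (ler_norm_avg _ _) _; apply: ler_avg => n _.
  have := umono n J; rewrite leq_eqVlt => /predU1P[uE|ult]; last first.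
    rewrite -[leLHS]add0r lerD//.
    apply: (@le_trans _ _ 1); first exact: norm_avg_le1.
    by rewrite lerBrDr nat1r ler_nat.
  rewrite uE subrr addr0.
  have -> : avg Rn (fun r => g (n + r)%N) =
    tm R (u n) ^+ size s * avg Rn (fun r => \prod_(l <- s) sg R q w (b + n * a + (l + r) * a)).
    rewrite -avgZ; apply: eq_avg => r rR; rewrite /g.
    have -> : tm R (u n) ^+ size s = \prod_(l <- s) tm R (u n).
      by rewrite big_const_seq count_predT iter_mulr_1.
    rewrite -big_split /= big_seq [RHS]big_seq; apply: eq_bigr => l ls.
    have -> : (b + (n + r) * a + l * a = b + n * a + (l + r) * a)%N by ring.
    rewrite (tm_divn _ _ qw) mulrC; congr (tm _ _ * _).
    apply/eqP; rewrite eqn_leq {2}/u leq_div2r ?leq_addr// andbT uE /u.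
    rewrite leq_div2r// (mulnDl n) addnA leq_add2l leq_mul2r.
    by rewrite hJ// orbT.
  by rewrite normrM normrX norm_tm expr1n mul1r.
have e3 : avg N (fun n => (u (n + J))%:R - (u n)%:R) <=
    J%:R * (a%:R / (2 ^ w)%:R + N%:R^-1) :> R.
  rewrite /avg sumrB.
  have E := sum_translate N J (fun n => (u n)%:R : R).
  have -> : \sum_(i < N) (u (i + J)%N)%:R - \sum_(i < N) (u i)%:R =
     \sum_(i < J) ((u (N + i)%N)%:R - (u i)%:R) :> R by rewrite sumrB; lra.
  rewrite ler_pdivrMr ?ltr0n//.
  have -> : J%:R * (a%:R / (2 ^ w)%:R + N%:R^-1) * N%:R =
     \sum_(i < J) ((N * a)%:R / (2 ^ w)%:R + 1) :> R.
    rewrite sumr_const card_ord -mulr_natl natrM.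
    by field; rewrite !pnatr_eq0 -!lt0n N0 w0.
  apply: ler_sum => i _; rewrite lerBlDr.
  have h : (u (N + i) <= (N * a) %/ 2 ^ w + 1 + u i)%N.
    rewrite /u; have -> : (b + (N + i) * a = N * a + (b + i * a))%N by ring.
    by have := leq_divDl (2 ^ w) (N * a) (b + i * a); rewrite addnAC.
  apply: (@le_trans _ _ ((N * a) %/ 2 ^ w + 1 + u i)%:R); first by rewrite ler_nat.
  by rewrite !natrD lerD2r lerD2r divn_le.
set X := avg N (fun n => avg Rn _) in e1 e2.
have -> : S = (S - X) + X by ring.
by apply: le_trans (ler_normD _ _) _; lra.
Qed.

Lemma pow2_ratio (R : realFieldType) T i j : (i + T <= j)%N ->
  (2 ^ i)%:R / (2 ^ j)%:R <= ((2 ^ T)%:R)^-1 :> R.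
Proof.
move=> ij; rewrite ler_pdivrMr ?ltr0n ?expn_gt0// mulrC.
rewrite ler_pdivlMr ?ltr0n ?expn_gt0// -natrM -expnD ler_nat leq_exp2l//.
Qed.

Lemma avg_widen (R : realFieldType) A W (F : nat -> R) : (0 < A <= W)%N ->
  (forall x, 0 <= F x) -> avg A F <= W%:R / A%:R * avg W F.
Proof.
case/andP=> A0 AW F0; have W0 := leq_trans A0 AW.
rewrite /avg [leRHS](_ : _ = (\sum_(i < W) F i) / A%:R); last first.
  by field; rewrite !pnatr_eq0 -!lt0n A0.
rewrite ler_wpM2r ?invr_ge0//.
have [k ->] : exists k, W = (A + k)%N by exists (W - A)%N; lia.
by rewrite big_split_ord /= lerDl sumr_ge0.
Qed.

Lemma add_exp4 (R : realFieldType) (x y : R) :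
  (x + y) ^+ 4 <= 8 * (x ^+ 4 + y ^+ 4).
Proof.
have h (u v : R) : (u + v) ^+ 2 <= 2 * (u ^+ 2 + v ^+ 2).
  by have := sqr_ge0 (u - v); rewrite !expr2; nra.
have -> : 4%N = (2 * 2)%N by []; rewrite !exprM.
apply: (@le_trans _ _ ((2 * (x ^+ 2 + y ^+ 2)) ^+ 2)).
  by rewrite ler_sqr ?nnegrE ?sqr_ge0 ?mulr_ge0 ?addr_ge0 ?sqr_ge0.
by rewrite exprMn; have := h (x ^+ 2) (y ^+ 2); lra.
Qed.

Lemma pow2_div (R : realFieldType) i j : (j <= i)%N ->
  (2 ^ i)%:R / (2 ^ j)%:R = (2 ^ (i - j))%:R :> R.
Proof.
move=> ji; rewrite -{1}(subnK ji) expnD natrM mulfK// pnatr_eq0 -lt0n expn_gt0//.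
Qed.

(* Everything is of relative size [2 ^ - T]: the truncation averages over
   [2 ^ r] terms, the bins of the Cauchy-Schwarz step have length [2 ^ (q - T)]
   and its shifts [k] are below [2 ^ (mu + 2 T)], equidistribution is used at
   scale [2 ^ (q + mu - T)], and [nd] blocks of [m] digits are exploited. *)
Lemma integer_model_bound (R : realFieldType) (p p' : nat) (s : seq nat)
    T nd r mu rho n d q i j :
  let m := (p + p' + 3)%N in
  let t : R := ((2 ^ T)%:R)^-1 in
  let S : R := (size s)%:R in
  let Lb : R := (2 ^ p')%:R in
  (2 ^ p' + 3 <= 2 ^ p)%N ->
  s != [::] -> uniq s -> (forall l, l \in s -> (l < 2 ^ p')%N) ->
  (1 - 2 / (2 ^ m)%:R ^+ 4) ^+ nd <= t ->
  rho = (m * nd + i)%N -> r = (m * nd + 3 * T)%N -> (p' <= r)%N ->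
  (rho + r <= mu)%N -> (mu + rho = d + r + T)%N -> d = (mu + m * nd + j)%N ->
  (mu + 3 * T <= n)%N -> (rho + r + 5 * T <= n)%N -> (mu + 3 * T <= q)%N ->
  (n + T <= q)%N ->
  exists G : nat -> R, [/\ forall a, 0 <= G a,
    forall a b, (a < 2 ^ (q + d))%N ->
      avg (2 ^ n) (fun k => \prod_(l <- s) tm R ((b + k * a + l * a) %/ 2 ^ q)) ^+ 4 <= G a
    & avg (2 ^ (q + d)) G <= (20000 + 20000 * S + 10000 * S * Lb) * t].
Proof.
move=> m t S Lb pp' s0 us sp ht rhoE rE p'r rmu muE dE n1 n2 q1 q2.
have x1 : (r + T <= n)%N by lia.
have x2 : (r + (q + d) + T <= q + mu + rho)%N by lia.
have x3 : (q - T + T <= q)%N by lia.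
have x4 : (q + mu - T + T <= q + mu)%N by lia.
have x5 : (mu + 2 * T + T <= n)%N by lia.
have x6 : (q - T <= q + mu)%N by lia.
have x7 : (q + mu - T <= q + mu + rho)%N by lia.
have x8 : (q + d <= q + mu + rho)%N by lia.
have x9 : (n <= q + mu - T)%N by lia.
have x10 : ((q + mu + rho - (q + d)) + (q + mu + rho - (q + mu - T)) + T * 3 <= n)%N by lia.
have x11 : (q + d = q + mu + (m * nd + j))%N by lia.
have x12 : (mu + 2 * T <= q - T)%N by lia.
have x13 : (q + mu - (q - T) + T <= mu + 2 * T)%N by lia.
have x14 : (r - T <= r)%N by lia.
have x15 : (r - T + T <= r)%N by lia.
have x16 : (q + mu = q + mu - r - T + r + T)%N by lia.
have x17 : (q + mu - r - T + r + T <= q + mu)%N by lia.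
have x18 : (m * nd + (q + mu) + T <= r - T + (q + mu - r - T) + r)%N by lia.
have x19 : (r + (q + mu - r - T) + T <= q + mu)%N by lia.
have x20 : (rho + r + T <= mu + 2 * T)%N by lia.
have x21 : (rho + r + T + T <= mu + 2 * T)%N by lia.
have x22 : (q + mu + (m * nd + j) = (q + mu - r - T) + (r + (T + (m * nd + j))))%N by lia.
have x23 : (q + mu + rho <= rho + r + T + (q + mu - r - T))%N by lia.
have x24 : (q - T + T <= q + mu)%N by lia.
have t0 : 0 < t by rewrite invr_gt0 ltr0n expn_gt0.
have t1 : t <= 1 by rewrite invf_le1 ?ltr0n ?expn_gt0// ler1n expn_gt0.
have S0 : 0 <= S by [].
have Lb0 : 0 <= Lb by [].
pose N := (2 ^ n)%N; pose Rn := (2 ^ r)%N; pose K := (2 ^ (mu + 2 * T))%N.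
pose B := (2 ^ (q - T))%N; pose H := (2 ^ (q + mu - T))%N.
(* [C] is chosen so that [Rn * C = t * U]: along a cell even the multiples [r * a] with [r < Rn]
   move by at most [t * U]. *)
pose C := (2 ^ (q + mu - r - T))%N; pose U := (2 ^ (q + mu))%N; pose V := (2 ^ rho)%N.
pose w := (q + mu + rho)%N; pose W := (2 ^ w)%N; pose A := (2 ^ (q + d))%N.
have pos k : (0 < 2 ^ k)%N by rewrite expn_gt0.
have U0 : (0 < U)%N by exact: pos.
have W0 : (0 < W)%N by exact: pos.
have UE : (2 ^ q * 2 ^ mu = U)%N by rewrite -expnD.
have WE : (U * V = W)%N by rewrite -expnD.
pose flo := sg R q (q + mu); pose fhi := quot_sg R rho U.
have F1 x : `|fhi x| <= 1 by rewrite norm_sg.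
have FU y z : (y %/ U = z %/ U)%N -> fhi y = fhi z by rewrite /fhi /quot_sg => ->.
have pF : periodic (U * V) fhi.
  by move=> x; rewrite /fhi /quot_sg (mulnC U) divnDMl// /V (sg_periodic R 0).
have sgE x : sg R q w x = flo x * fhi x.
  rewrite /flo /fhi /quot_sg -sg_div -sg_cat//.
  by rewrite !leq_addr.
have hJ l r0 : l \in s -> (r0 < Rn)%N -> (l + r0 <= 2 ^ p' + Rn)%N.
  by move=> /sp lp rR; rewrite leq_add// ltnW.
have JR : (2 ^ p' + Rn <= 2 * Rn)%N.
  by rewrite mul2n -addnn leq_add2r leq_exp2l.
pose SL a b := avg N (fun k => `|avg Rn (fun r0 =>
     \prod_(l <- s) sg R q w (b + k * a + (l + r0) * a))|).
have SL0 a b : 0 <= SL a b by apply: avg_ge0.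
have SL1 a b : SL a b <= 1.
  apply: avg_le => // k _; apply: norm_avg_le1 => r0 _.
  by rewrite normr_prod prodr_ile1// => l _; rewrite norm_sg ler01 lexx.
(* [mu + rho = d + r + T] makes [Rn * A / W] equal to [t]; with [Rn / N <= t] and
   [2 ^ p' + Rn <= 2 * Rn] the error is [2 + 2 + 2] times [t]. *)
have trunc a b : (a < A)%N ->
    `|avg N (fun k => \prod_(l <- s) tm R ((b + k * a + l * a) %/ 2 ^ q))| <= SL a b + 6 * t.
  move=> aA; apply: le_trans (@truncation R q w N Rn (2 ^ p' + Rn) s a b _ _ _ hJ) _;
    rewrite ?expn_gt0//; first by rewrite /w -addnA leq_addr.
  rewrite lerD2l.
  have h1 : Rn%:R / N%:R <= t by apply: pow2_ratio.
  have h2 : (2 ^ p' + Rn)%:R * (a%:R / W%:R + N%:R^-1) <=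
      2 * Rn%:R * (A%:R / W%:R + N%:R^-1) :> R.
    apply: ler_pM; [by [] | by rewrite addr_ge0 ?divr_ge0 ?invr_ge0 | | ].
      by rewrite -natrM ler_nat.
    by rewrite lerD2r ler_pM2r ?invr_gt0 ?ltr0n// ler_nat ltnW.
  have h3 : Rn%:R * (A%:R / W%:R) <= t.
    by rewrite mulrA -natrM -expnD; apply: pow2_ratio.
  by move: h1 h2 h3; rewrite -!mulrA !(mulrDr _ _ N%:R^-1); lra.
pose cs := (2 * size s)%:R * (B%:R / (2 ^ q)%:R) +
     (3 * t + 4 * (2 * size s)%:R * (H%:R / U%:R)).
have cs0 : 0 <= cs.
  by rewrite /cs !addr_ge0 ?mulr_ge0 ?invr_ge0 ?ler0n ?ltW.
have csE : cs <= (10 * S + 3) * t.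
  have h1 : B%:R / (2 ^ q)%:R <= t by apply: pow2_ratio.
  have h2 : H%:R / U%:R <= t by apply: pow2_ratio.
  rewrite /cs natrM -/S; move: h1 h2; set x := B%:R / _; set y := H%:R / _ => h1 h2.
  have := ler_wpM2l S0 h1; have := ler_wpM2l S0 h2; lra.
pose AL a := avg K (fun e => Lam R U B (e * a) * Psi (U * V) fhi s Rn a (e * a)).
have AL0 a : 0 <= AL a by apply: avg_ge0 => e _; rewrite mulr_ge0 ?Lam_ge0 ?Psi_ge0.
pose ML a := mean_Lam R U B K a.
have ML0 a : 0 <= ML a by apply: mean_Lam_ge0.
(* For slopes that fail to equidistribute only [SL <= 1] is used; their proportion is small. *)
pose exc a : R := (t ^+ 2 < Disc R W H N a)%R%:R.
have exc0 a : 0 <= exc a by rewrite ler0n.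
pose KN : R := K%:R / N%:R.
have KNt : KN <= t by apply: pow2_ratio.
have KN0 : 0 <= KN by rewrite divr_ge0.
have BU : (0 < B <= U)%N by rewrite pos leq_exp2l.
have rest0 a : 0 <= 8 * KN ^+ 2 + 4 * (cs * ML a + 2 * AL a).
  have h1 := mulr_ge0 cs0 (ML0 a); have h2 := AL0 a; have h3 := sqr_ge0 KN; lra.
have main a b : (a < A)%N -> SL a b ^+ 4 <= exc a + (8 * KN ^+ 2 + 4 * (cs * ML a + 2 * AL a)).
  move=> aA; rewrite /exc; case: ltP => [_|hD].
    by rewrite -[leLHS]addr0 lerD ?exprn_ile1.
  rewrite add0r.
  have := @truncated_sum_bound R (2 ^ q) (2 ^ mu) V B H K N Rn a b s flo fhi t.
  rewrite UE WE /SL => TB.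
  have -> : avg N (fun k => `|avg Rn (fun r0 =>
     \prod_(l <- s) sg R q w (b + k * a + (l + r0) * a))|) =
    avg N (fun k => `|avg Rn (fun r0 => \prod_(l <- s)
     (flo (b + k * a + (l + r0) * a)%N * fhi (b + k * a + (l + r0) * a)%N))|).
    apply: eq_avg => k _; congr `|_|; apply: eq_avg => r0 _.
    by apply: eq_bigr => l _; rewrite sgE.
  rewrite /AL WE.
  apply: TB => //; try exact: ltW; rewrite ?pos//.
  - by rewrite leq_exp2l.
  - exact: sg_periodic.
  - by move=> y z yz; rewrite /flo (@sg_div R q mu y) (@sg_div R q mu z) yz.
  - by move=> x; rewrite norm_sg.
  - by rewrite -WE.
pose G a := 8 * (exc a + (8 * KN ^+ 2 + 4 * (cs * ML a + 2 * AL a))) + 8 * (6 * t) ^+ 4.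
exists G; split.
- move=> a; have h1 : 0 <= (6 * t) ^+ 4 by rewrite exprn_ge0// mulr_ge0// ltW.
  by have h2 := exc0 a; have h3 := rest0 a; rewrite /G; lra.
- move=> a b aA; have := trunc a b aA.
  set X := avg _ _ => hX.
  have -> : X ^+ 4 = `|X| ^+ 4.
    by rewrite -[4%N]/(2 * 2)%N !exprM real_normK ?num_real.
  apply: (@le_trans _ _ ((SL a b + 6 * t) ^+ 4)).
    by rewrite lerXn2r ?nnegrE// addr_ge0// mulr_ge0// ltW.
  apply: le_trans (add_exp4 _ _) _; rewrite /G mulrDr lerD2r ler_pM2l//.
  exact: main.
have A0 : (0 < A)%N by apply: pos.
(* Markov's inequality costs [t ^ -2], passing from [A] to the full period [W] costs [2 ^ (r + T)],
   and [W / H = 2 ^ (rho + T)]; staying below [t] requires [N] to be at least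
   [2 ^ (rho + r + 5 * T)]. *)
have hexc : avg A exc <= t.
  have t20 : 0 < t ^+ 2 by rewrite exprn_gt0.
  apply: le_trans (avg_markov A t20 (Disc_ge0 _ _ _ _)) _.
  rewrite ler_pdivrMr// -exprS.
  have AW : (0 < A <= W)%N by rewrite A0 leq_exp2l.
  apply: le_trans (avg_widen AW (Disc_ge0 R W H N)) _.
  have HD : avg W (Disc R W H N) <= W%:R / H%:R / N%:R.
    by apply: avg_Disc; rewrite ?pos ?leq_exp2l.
  apply: (@le_trans _ _ (W%:R / A%:R * (W%:R / H%:R / N%:R))).
    by rewrite ler_wpM2l// divr_ge0.
  rewrite pow2_div; last by [].
  rewrite pow2_div; last by [].
  rewrite mulrA -natrM -expnD /t exprVn -natrX -expnM.
  by apply: pow2_ratio.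
have AE : A = (2 ^ (q + mu + (m * nd + j)))%N by rewrite /A x11; congr (2 ^ _)%N.
have KB : (0 < K <= B)%N by rewrite pos leq_exp2l.
have UBK : U%:R / B%:R / K%:R <= t.
  rewrite pow2_div; last by [].
  by apply: pow2_ratio.
have hML : avg A ML <= 4.
  have := @avg_mean_Lam R (q + mu) (q - T) (m * nd + j) K _ KB.
  rewrite -AE -/U -/B => /(_ x6) h; apply: le_trans h _.
  by move: UBK; lra.
pose X := avg (Rn * (2 ^ T * 2 ^ (m * nd + j))) (fun a1 =>
  avg V (fun M => Psi (U * V) fhi s Rn (C * a1) (M * U))).
have hX : X <= 2 * (t + (S * (8 * (Lb * t)) + 2 * t + S * (4 * t) + t)).
  have e0R : (0 < 2 ^ (r - T) <= Rn)%N by rewrite pos leq_exp2l.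
  have UCE : U = (C * Rn * 2 ^ T)%N by rewrite /C /Rn -!expnD; congr (2 ^ _)%N.
  have sL l : l \in s -> (l <= 2 ^ p')%N by move=> /sp /ltnW.
  have := @avg_Psi_bound R p p' s nd i j C Rn (2 ^ T) U Rn (2 ^ (r - T)) (2 ^ p')
     pp' s0 us sp sL (pos _) (pos _) (pos _) UCE e0R.
  rewrite -/m -rhoE -/V -/fhi -/X => h; apply: le_trans h _.
  rewrite ler_pM2l// lerD//; first by apply: pow2_ratio.
  rewrite lerD// lerD//; first rewrite lerD//.
  - rewrite ler_wpM2l// ler_pM2l// natrM -mulrA ler_wpM2l//.
    by rewrite /C /Rn -expnD; apply: pow2_ratio.
  - rewrite -mulrA ler_pM2l// /U /C /Rn -!expnD.
    by apply: pow2_ratio.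
  - rewrite ler_wpM2l// ler_pM2l// /C /Rn -expnD.
    by apply: pow2_ratio.
have hAL : avg A AL <= t + t + 9 * (X + S * (4 * (5 * t))).
  (* [2 ^ (rho + r + T)] is the first multiplier for which [C] reaches the period [U * V]; by
     [rho + r <= mu] it is at most [t * K]. *)
  have k0K : (2 ^ (rho + r + T) <= K)%N by rewrite leq_exp2l.
  have A1E : (2 ^ (q + mu + (m * nd + j)) = C * (Rn * (2 ^ T * 2 ^ (m * nd + j))))%N.
    by rewrite /C /Rn -!expnD; congr (2 ^ _)%N.
  have UVC : (U * V <= 2 ^ (rho + r + T) * C)%N by rewrite /U /V /C -!expnD leq_exp2l.
  have bq := x6.
  have h := @avg_Lam_Psi R (q + mu) (q - T) V C _ (m * nd + j) K (2 ^ (rho + r + T))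
    fhi s Rn (2 ^ p' + Rn) bq (pos _) (pos _) A1E KB k0K UVC F1 pF FU hJ.
  rewrite AE; apply: le_trans h _; rewrite lerD//; first rewrite lerD//.
    by apply: pow2_ratio.
  rewrite ler_pM2l// avgD avg_const; last by rewrite !muln_gt0 !pos.
  rewrite lerD2l -/S ler_wpM2l// -mulrA ler_pM2l//.
  apply: (@le_trans _ _ ((4 * (Rn * C) + B)%:R / U%:R)).
    rewrite ler_pM2r ?invr_gt0 ?ltr0n// ler_nat leq_add2r.
    have -> : (4 * (Rn * C) = 2 * (2 * Rn * C))%N by ring.
    by rewrite -[leqLHS]mulnA leq_mul2l /= leq_mul2r JR orbT.
  have h1 : (Rn * C)%:R / U%:R <= t by rewrite /C /Rn -expnD; apply: pow2_ratio.
  have h2 : B%:R / U%:R <= t by apply: pow2_ratio.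
  by rewrite natrD natrM mulrDl -mulrA; lra.
have -> : avg A G = 8 * (avg A exc + (8 * KN ^+ 2 +
     4 * (cs * avg A ML + 2 * avg A AL))) + 8 * (6 * t) ^+ 4.
  rewrite /G avgD (avg_const (8 * (6 * t) ^+ 4))// avgZ avgD avgD.
  by rewrite (avg_const (8 * KN ^+ 2))// avgZ avgD !avgZ.
have k2 : KN ^+ 2 <= t.
  by apply: (le_trans _ KNt); rewrite expr2 ler_piMl// (le_trans KNt).
have c4 : cs * avg A ML <= (10 * S + 3) * t * 4.
  by apply: ler_pM => //; apply: avg_ge0.
have t4 : (6 * t) ^+ 4 <= 1296 * t.
  have t3 : t ^+ 3 <= 1 by apply: exprn_ile1 => //; apply: ltW.
  have -> : (6 * t) ^+ 4 = 1296 * (t * t ^+ 3) by ring.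
  by apply: ler_wpM2l; [apply: ler0n | apply: ler_piMr t3; apply: ltW].
have St : 0 <= S * t by rewrite mulr_ge0// ltW.
have SLt : 0 <= S * Lb * t by rewrite !mulr_ge0// ltW.
move: hexc k2 c4 hAL hX t4 St SLt (ltW t0); clear.
set e := avg A exc; set M := cs * _; set L := avg A AL; set k := KN ^+ 2.
set f := (6 * t) ^+ 4 => *; lra.
Qed.

(** Bernoulli's inequality gives [(1 + x) ^ k >= 2], and [(1 - x) * (1 + x) <= 1]. *)
Lemma exp_one_sub_le_half (R : realFieldType) (x : R) k : 0 <= x <= 1 ->
  1 <= k%:R * x -> (1 - x) ^+ k <= 2^-1.
Proof.
case/andP=> x0 x1 kx.
have bern : 1 + k%:R * x <= (1 + x) ^+ k.
  elim: (k) => [|i IHi]; first by rewrite mul0r addr0 expr0.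
  rewrite exprS; apply: le_trans (_ : (1 + x) * (1 + i%:R * x) <= _).
    rewrite -nat1r; have : 0 <= i%:R :> R by []; set y : R := i%:R => y0.
    by have := mulr_ge0 y0 (sqr_ge0 x); rewrite expr2; nra.
  by rewrite ler_wpM2l// addr_ge0.
have prod1 : (1 - x) ^+ k * (1 + x) ^+ k <= 1.
  by rewrite -exprMn; apply: exprn_ile1; nra.
have y0 : 0 <= (1 - x) ^+ k by rewrite exprn_ge0// subr_ge0.
have : 2 * (1 - x) ^+ k <= 1; last by lra.
apply: le_trans prod1; rewrite mulrC ler_wpM2l//.
by apply: le_trans bern; lra.
Qed.

Lemma integer_model (R : realFieldType) (L : nat) :
  exists c : nat, forall s : seq nat,
  s != [::] -> uniq s -> (forall l, l \in s -> (l < L)%N) ->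
  exists Cst : R, 0 <= Cst /\
  forall T n d q, (c * T <= d)%N -> ((0 < T)%N -> (d + c * T <= 2 * n)%N) ->
  (n + d + c * T <= q)%N ->
  exists G : nat -> R, [/\ forall a, 0 <= G a,
    forall a b, (a < 2 ^ (q + d))%N ->
      avg (2 ^ n) (fun k => \prod_(l <- s) tm R ((b + k * a + l * a) %/ 2 ^ q)) ^+ 4 <= G a
    & avg (2 ^ (q + d)) G <= Cst / (2 ^ T)%:R].
Proof.
pose p' := L; pose p := (L + 2)%N; pose m := (p + p' + 3)%N.
(* [c1 = (2 ^ m) ^ 4 / 2] is the inverse of the loss at one digit position: [c1] blocks halve the
   mean weight, and [c1 * T] blocks bring it below [2 ^ - T]. *)
pose c1 := (2 ^ (4 * m).-1)%N.
exists (4 * m * c1 + 20)%N => s s0 us sL.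
pose S : R := (size s)%:R; pose Lb : R := (2 ^ p')%:R.
pose Cst := 20000 + 20000 * S + 10000 * S * Lb.
have S0 : 0 <= S by [].
have SL0 : 0 <= S * Lb by rewrite mulr_ge0.
have C1 : 1 <= Cst.
  have gen (u v w : R) : 1 <= u -> 0 <= v -> 0 <= w -> 1 <= u + v + w.
    by clear; lra.
  rewrite /Cst; apply: gen; first by rewrite ler1n.
    by apply: mulr_ge0; [apply: ler0n | apply: S0].
  by rewrite -mulrA; apply: mulr_ge0; [apply: ler0n | apply: SL0].
exists Cst; split; first exact: le_trans C1.
move=> [|T'] n d q; set T := (X in (_ * X)%N).
  move=> _ _ _; exists (fun=> 1); split => //.
    move=> a b _; set X := avg _ _.
    have -> : X ^+ 4 = `|X| ^+ 4.
      by rewrite -[4%N]/(2 * 2)%N !exprM real_normK ?num_real.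
    apply: exprn_ile1 => //; apply: norm_avg_le1 => k _.
    by rewrite normr_prod prodr_ile1// => l _; rewrite norm_tm ler01 lexx.
  by rewrite avg_const ?expn_gt0// expn0 divr1.
move=> hd /(_ isT) hn hq.
have pp : (2 ^ p' + 3 <= 2 ^ p)%N.
  rewrite /p expnD; have : (0 < 2 ^ p')%N by rewrite expn_gt0.
  by rewrite /p'; lia.
have sp l : l \in s -> (l < 2 ^ p')%N.
  by move=> /sL lL; apply: ltn_trans lL _; apply: ltn_expl.
pose kap := (m * (c1 * T))%N.
(* Both [rho] and [mu = d + r + T - rho] equal [d / 2] up to a multiple of [T], so
   [d + c * T <= 2 * n] keeps [2 ^ mu] and [2 ^ rho] below [2 ^ n] with room to spare. *)
pose rho := ((d + T) %/ 2)%N; pose r := (kap + 3 * T)%N.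
have kapE : (4 * m * c1 * T = 4 * kap)%N by rewrite /kap; ring.
have hd' : (4 * kap + 20 * T <= d)%N by rewrite -kapE -mulnDl.
have hn' : (d + (4 * kap + 20 * T) <= 2 * n)%N by rewrite -kapE -mulnDl.
have hq' : (n + d + (4 * kap + 20 * T) <= q)%N by rewrite -kapE -mulnDl.
have T0 : (0 < T)%N by [].
have kapL : (p' <= kap)%N.
  have c10 : (0 < c1)%N by rewrite expn_gt0.
  rewrite /kap; apply: (@leq_trans m); first by rewrite /m; lia.
  by rewrite leq_pmulr// muln_gt0 c10.
have rho1 : (2 * rho <= d + T)%N by rewrite /rho; lia.
have rho2 : (d + T <= 2 * rho + 1)%N by rewrite /rho; lia.
have half : (1 - 2 / (2 ^ m)%:R ^+ 4) ^+ (c1 * T) <= ((2 ^ T)%:R)^-1 :> R.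
  have m0 : (0 < 4 * m)%N by rewrite /m; lia.
  have c1n0 : c1%:R != 0 :> R by rewrite pnatr_eq0 -lt0n expn_gt0.
  have xE : 2 / (2 ^ m)%:R ^+ 4 = (c1%:R)^-1 :> R.
    by rewrite -natrX -expnM mulnC -(prednK m0) expnS natrM -/c1; field.
  have c1g : 1 <= c1%:R :> R by rewrite ler1n expn_gt0.
  rewrite xE exprM natrX -exprVn lerXn2r ?nnegrE ?invr_ge0 ?exprn_ge0//.
    by rewrite subr_ge0 invf_le1// (lt_le_trans ltr01).
  apply: exp_one_sub_le_half.
    by rewrite invr_ge0 ler0n invf_le1 ?(lt_le_trans ltr01).
  by rewrite divff.
have [G [G0 GS GA]] := @integer_model_bound R p p' s T (c1 * T) r (d + r + T - rho)
   rho n d q (rho - kap) (rho - r - T - kap) pp s0 us sp half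
   ltac:(rewrite -/m -/kap; lia) ltac:(rewrite -/m -/kap; lia) ltac:(lia) ltac:(lia)
   ltac:(lia) ltac:(rewrite -/m -/kap; lia) ltac:(lia) ltac:(lia) ltac:(lia) ltac:(lia).
by exists G.
Qed.

(** * From real to integer slopes *)

(* All the points counted on the left lie in a window of length [H], so they
   are seen together by [H] of the windows of length [2 H]. *)
Lemma near_carry_count (R : realFieldType) q h N a b : (h < q)%N -> (0 < N)%N ->
  avg N (fun k => ((2 ^ q <= (b + k * a) %% 2 ^ q + 2 ^ h)%N)%:R) ^+ 2 <=
  4 * ((2 ^ h)%:R / (2 ^ q)%:R) * mean_Lam R (2 ^ q) (2 ^ h.+1) N a.
Proof.
move=> hq N0; set U := (2 ^ q)%N; set H := (2 ^ h)%N.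
have U0 : (0 < U)%N by rewrite expn_gt0.
have H0 : (0 < H)%N by rewrite expn_gt0.
have E2 : (2 ^ h.+1 = 2 * H)%N by rewrite expnS.
have HU : (2 * H <= U)%N by rewrite -E2 leq_exp2l.
have UR : 0 < U%:R :> R by rewrite ltr0n.
have HR : 0 < H%:R :> R by rewrite ltr0n.
rewrite E2 /mean_Lam -(avg_win_sqr _ _ _ _ _ b).
set P := avg N _; pose c := U%:R / (2 * H)%:R : R.
have c0 : 0 <= c by rewrite divr_ge0.
have P0 : 0 <= P by apply: avg_ge0.
pose ind y : R := ((y < H)%N)%:R.
have pF : periodic U (fun y => avg N (fun k => win R U (2 * H) (b + k * a + y)) ^+ 2).
  by move=> y; congr (_ ^+ 2); apply: eq_avg => k _; rewrite addnA win_periodic.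
rewrite -(avg_shift H pF).
have h1 : avg U (fun y => ind y * (c * P) ^+ 2) <=
    avg U (fun y => avg N (fun k => win R U (2 * H) (b + k * a + (y + H))) ^+ 2).
  apply: ler_avg => y yU; rewrite /ind; case: (ltnP y H) => [yH|_]; last first.
    by rewrite mul0r sqr_ge0.
  have w0 : 0 <= avg N (fun k => win R U (2 * H) (b + k * a + (y + H))).
    by apply: avg_ge0 => k _; apply: win_ge0.
  rewrite mul1r ler_sqr ?nnegrE//; last exact: mulr_ge0.
  rewrite -avgZ; apply: ler_avg => k _.
  case: (boolP (_ <= _)%N) => [hx|_]; last by rewrite mulr0 win_ge0.
  rewrite mulr1 /win; set x := (b + k * a)%N in hx *.
  have xU := ltn_pmod x U0.
  rewrite (_ : (_ < 2 * H)%N = true) ?mul1r//.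
  rewrite -modnDml.
  have -> : (x %% U + (y + H) = 1 * U + (x %% U + (y + H) - U))%N.
    by rewrite mul1n subnKC//; lia.
  by rewrite modnMDl; apply: leq_ltn_trans (leq_mod _ _) _; lia.
rewrite avgZr avg_ltn in h1; last by lia.
have E : P ^+ 2 = 4 * (H%:R / U%:R) * (H%:R / U%:R * (c * P) ^+ 2).
  by rewrite /c natrM; field; rewrite !gt_eqF.
by rewrite E ler_wpM2l// mulr_ge0// divr_ge0.
Qed.

(** Truncating [alpha] and [beta] to [q] bits lowers [2 ^ q * (k * alpha + beta)] by less than
    [k + 1], which leaves the integer part unchanged unless the truncated value is just below a
    multiple of [2 ^ q]. *)
Lemma beatty_nat (R : realType) (alpha beta : R) q k :
  0 <= alpha -> 0 <= beta ->
  let a := Num.truncn (2 ^+ q * alpha) in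
  let b := Num.truncn (2 ^+ q * beta) in
  ((b + k * a) %% 2 ^ q + k.+1 <= 2 ^ q)%N ->
  `|beatty alpha beta k%:Z|%N = ((b + k * a) %/ 2 ^ q)%N.
Proof.
move=> a0 b0 a b hk; pose Q : R := 2 ^+ q.
have Q0 : 0 < Q by rewrite exprn_gt0.
have QE : Q = (2 ^ q)%:R by rewrite natrX.
have /andP[a1 a2] : a%:R <= Q * alpha < a.+1%:R.
  by apply: truncn_itv; rewrite mulr_ge0// ltW.
have /andP[b1 b2] : b%:R <= Q * beta < b.+1%:R.
  by apply: truncn_itv; rewrite mulr_ge0// ltW.
rewrite /beatty; set x := (b + k * a)%N in hk *.
suff -> : Num.floor (k%:Z%:~R * alpha + beta) = (x %/ 2 ^ q)%N%:Z by [].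
apply: floor_def; rewrite intrD -!pmulrn.
have k0 : 0 <= k%:R :> R by [].
have xE : x%:R = (x %/ 2 ^ q)%:R * Q + (x %% 2 ^ q)%:R :> R.
  by rewrite {1}(divn_eq x (2 ^ q)) natrD natrM -QE.
have hk' : (x %% 2 ^ q)%:R + (k%:R + 1) <= Q :> R.
  by rewrite QE natr1 -natrD ler_nat.
have xl : x%:R <= Q * (k%:R * alpha + beta).
  rewrite /x natrD natrM mulrDr mulrCA.
  have := ler_wpM2l k0 a1; lra.
have xu : Q * (k%:R * alpha + beta) < x%:R + (k%:R + 1).
  rewrite /x natrD natrM mulrDr mulrCA.
  have := ler_wpM2l k0 (ltW a2); move: b2; rewrite -!natr1; lra.
have m0 : 0 <= (x %% 2 ^ q)%:R :> R by [].
apply/andP; split.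
  by rewrite -(ler_pM2l Q0); apply: le_trans xl; rewrite xE; lra.
rewrite -(ltr_pM2l Q0); apply: lt_le_trans xu _.
by rewrite xE; lra.
Qed.

Definition beatty_sg (R : realType) (s : seq nat) (alpha beta : R) (k : nat) : R :=
  \prod_(l <- s) tm R `|beatty alpha beta (k + l)%N%:Z|%N.

Lemma beatty_sg_le1 (R : realType) s (alpha beta : R) k :
  `|beatty_sg s alpha beta k| <= 1.
Proof.
by rewrite normr_prod prodr_ile1// => l _; rewrite norm_tm ler01 lexx.
Qed.

Lemma beatty_sg_avg (R : realType) (L : nat) (s : seq nat) (alpha beta : R) q h N :
  (forall l, l \in s -> (l < L)%N) -> 0 <= alpha -> 0 <= beta ->
  (N + L <= 2 ^ h)%N ->
  `|avg N (beatty_sg s alpha beta) -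
    avg N (fun k => \prod_(l <- s) tm R ((Num.truncn (2 ^+ q * beta) +
       k * Num.truncn (2 ^+ q * alpha) + l * Num.truncn (2 ^+ q * alpha)) %/ 2 ^ q))| <=
  \sum_(l <- s) 2 * avg N (fun k => ((2 ^ q <= (Num.truncn (2 ^+ q * beta) +
     l * Num.truncn (2 ^+ q * alpha) + k * Num.truncn (2 ^+ q * alpha)) %% 2 ^ q + 2 ^ h)%N)%:R).
Proof.
move=> sL a0 b0 NL; set a := Num.truncn (2 ^+ q * alpha); set b := Num.truncn _.
rewrite -avgB; apply: le_trans (ler_norm_avg _ _) _.
under [leRHS]eq_bigr do rewrite -avgZ.
rewrite -avg_sum; apply: ler_avg => k kN; rewrite /beatty_sg.
have norm1 x : `|tm R x| <= 1 by rewrite norm_tm.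
apply: le_trans (prod_dist _ _ _) _ => //.
rewrite big_seq [leRHS]big_seq; apply: ler_sum => l /sL lL.
have -> : (b + k * a + l * a = b + (k + l) * a)%N by ring.
have -> : (b + l * a + k * a = b + (k + l) * a)%N by ring.
case: (boolP (_ <= _)%N) => [_|hk].
  rewrite mulr1; apply: le_trans (ler_normB _ _) _.
  by rewrite !norm_tm.
rewrite mulr0 (@beatty_nat _ _ _ q)// ?subrr ?normr0//.
by move: hk; rewrite -ltnNge => /ltnW; apply: leq_trans; rewrite leq_add2l; lia.
Qed.

(** The fourth power is removed by [|Y| <= t + Y ^ 4 / t ^ 3], whose right-hand side is linear in
    the majorant and can be averaged; the integer model is used with [4 * T], so that after division
    by [t ^ 3] a factor [t] is left. The proportion [P] of terms spoilt by truncation is treated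
    likewise, by [P <= t + P ^ 2 / t]. *)
Lemma beatty_model (R : realType) (L : nat) :
  exists c : nat, forall s : seq nat,
  s != [::] -> uniq s -> (forall l, l \in s -> (l < L)%N) ->
  exists Cst : R, 0 <= Cst /\
  forall T n d q, (c * T <= d)%N -> ((0 < T)%N -> (d + c * T <= 2 * n)%N) ->
  (2 * n + d + c * T + L < q)%N ->
  exists G : nat -> R, [/\ forall a, 0 <= G a,
    forall alpha beta : R, 0 <= alpha < 2 ^+ d -> 0 <= beta ->
      `|avg (2 ^ n) (beatty_sg s alpha beta)| <=
         Cst / (2 ^ T)%:R + G (Num.truncn (2 ^+ q * alpha))
    & avg (2 ^ (q + d)) G <= Cst / (2 ^ T)%:R].
Proof.
have [c0 H0] := @integer_model R L.
exists (4 * c0 + 4)%N => s s0 us sL; have [C0 [C00 H]] := H0 s s0 us sL.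
pose S : R := (size s)%:R; have S0 : 0 <= S by [].
exists (C0 + 1 + 24 * S); split; first by lra.
move=> T n d q; rewrite mulnDl -mulnA (mulnCA 4 c0) => hd hn hqq.
have hd' : (c0 * (4 * T) <= d)%N by apply: leq_trans hd; apply: leq_addr.
have hn' : (0 < 4 * T)%N -> (d + c0 * (4 * T) <= 2 * n)%N by lia.
have nT : (2 * T <= n)%N by case: (posnP T) => [->//|/hn]; lia.
pose h := (n + L)%N.
have hlt : (h < q)%N by rewrite /h; lia.
have hqT : (h + 2 * T <= q)%N by rewrite /h; lia.
have hq' : (n + d + c0 * (4 * T) <= q)%N by lia.
have [G0 [G00 GS GA]] := H (4 * T)%N n d q hd' hn' hq'.
pose t : R := ((2 ^ T)%:R)^-1.
have t0 : 0 < t by rewrite invr_gt0 ltr0n expn_gt0.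
have t1 : t <= 1 by rewrite invf_le1 ?ltr0n ?expn_gt0// ler1n expn_gt0.
pose N := (2 ^ n)%N; have N0 : (0 < N)%N by rewrite expn_gt0.
pose hq : R := (2 ^ h)%:R / (2 ^ q)%:R.
have hq0 : 0 <= hq by rewrite divr_ge0.
pose ML a := mean_Lam R (2 ^ q) (2 ^ h.+1) N a.
have ML0 a : 0 <= ML a by apply: mean_Lam_ge0.
pose G a := G0 a / t ^+ 3 + S * (8 * hq / t * ML a).
have t30 : 0 < t ^+ 3 by rewrite exprn_gt0.
exists G; split.
- move=> a; rewrite /G addr_ge0 ?divr_ge0 ?(ltW t30)// mulr_ge0// mulr_ge0//.
  by rewrite divr_ge0 ?(ltW t0)// mulr_ge0.
- move=> alpha beta /andP[a0 ad] b0.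
  have NL : (2 ^ n + L <= 2 ^ h)%N.
    rewrite /h expnD; apply: (@leq_trans (N * L.+1)).
      by rewrite mulnS leq_add2l leq_pmull.
    by rewrite leq_mul2l ltn_expl ?orbT.
  have Main := beatty_sg_avg q sL a0 b0 NL.
  set a := Num.truncn (2 ^+ q * alpha) in Main *.
  set b := Num.truncn (2 ^+ q * beta) in Main.
  have aA : (a < 2 ^ (q + d))%N.
    have Q0 : 0 < 2 ^+ q :> R by rewrite exprn_gt0.
    rewrite -(ltr_nat R); have /andP[h1 _] := truncn_itv (mulr_ge0 (ltW Q0) a0).
    by apply: le_lt_trans h1 _; rewrite natrX exprD ltr_pM2l.
  set Y := avg (2 ^ n) (fun k => \prod_(l <- s) _) in Main.
  have Y4 : Y ^+ 4 <= G0 a by apply: GS.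
  have Yb : `|Y| <= t + G0 a / t ^+ 3.
    have [Yt|tY] := lerP `|Y| t.
      by apply: le_trans Yt _; rewrite lerDl; apply: divr_ge0 => //; apply: ltW.
    apply: (@le_trans _ _ (G0 a / t ^+ 3)); last by rewrite lerDr ltW.
    rewrite ler_pdivlMr//; apply: le_trans Y4.
    have -> : Y ^+ 4 = `|Y| * `|Y| ^+ 3.
      by rewrite -exprS -[4%N]/(2 * 2)%N !exprM real_normK ?num_real.
    by rewrite ler_wpM2l// lerXn2r ?nnegrE// ltW.
  have Pb l : 2 * avg N (fun k => ((2 ^ q <= (b + l * a + k * a) %% 2 ^ q + 2 ^ h)%N)%:R) <=
     2 * t + 8 * hq / t * ML a.
    set P := avg N _.
    have P0 : 0 <= P by apply: avg_ge0.
    have P2 : P ^+ 2 <= 4 * hq * ML a by apply: near_carry_count.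
    have E : 8 * hq / t * ML a = 2 * ((4 * hq * ML a) / t) by field; rewrite gt_eqF.
    rewrite E -mulrDr ler_pM2l//.
    have [Pt|tP] := lerP P t.
      apply: le_trans Pt _; rewrite lerDl; apply: divr_ge0; last exact: ltW.
      by apply: mulr_ge0; [apply: mulr_ge0 | apply: ML0].
    apply: (@le_trans _ _ ((4 * hq * ML a) / t)); last by rewrite lerDr ltW.
    rewrite ler_pdivlMr//; apply: le_trans P2.
    by rewrite expr2 ler_wpM2l// ltW.
  have Sb : \sum_(l <- s) 2 * avg N (fun k => ((2 ^ q <= (b + l * a + k * a) %% 2 ^ q + 2 ^ h)%N)%:R)
     <= S * (2 * t + 8 * hq / t * ML a).
    by apply: sumr_le_size => l _; apply: Pb.
  set X := avg _ _ in Main *.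
  have hX : `|X| <= `|Y| + S * (2 * t + 8 * hq / t * ML a).
    have := ler_normD (X - Y) Y; rewrite subrK => h1.
    apply: le_trans h1 _; rewrite addrC lerD2l.
    exact: le_trans Main Sb.
  apply: le_trans hX _; rewrite /G -/t.
  have St : 0 <= S * t by rewrite mulr_ge0// ltW.
  have Ct : 0 <= C0 * t by rewrite mulr_ge0// ltW.
  by move: Yb; set u := G0 a / _; set v := 8 * hq / t * ML a; lra.
rewrite /G avgD avgZr !avgZ -/t.
have hML : avg (2 ^ (q + d)) ML <= 2 * ((2 ^ q)%:R / (2 ^ h.+1)%:R / N%:R + 1).
  by apply: avg_mean_Lam => //; rewrite N0 leq_exp2l//; apply/leqW/leq_addr.
have e1 : avg (2 ^ (q + d)) G0 / t ^+ 3 <= C0 * t.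
  rewrite ler_pdivrMr//; apply: le_trans GA _.
  have -> : C0 / (2 ^ (4 * T))%:R = C0 * t * t ^+ 3.
    by rewrite -mulrA -exprS /t exprVn -natrX -expnM mulnC.
  by [].
have Nt : (N%:R)^-1 <= t * t.
  rewrite /t -invfM -natrM -expnD lef_pV2 ?posrE ?ltr0n ?expn_gt0// ler_nat leq_exp2l//.
  by rewrite addnn -mul2n.
have qt : hq <= t * t.
  rewrite /t -invfM -natrM -expnD; apply: pow2_ratio.
  by rewrite addnn -mul2n.
have e2 : 8 * hq / t * avg (2 ^ (q + d)) ML <= 24 * t.
  apply: (@le_trans _ _ (8 * hq / t * (2 * ((2 ^ q)%:R / (2 ^ h.+1)%:R / N%:R + 1)))).
    by rewrite ler_wpM2l// divr_ge0 ?mulr_ge0// ltW.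
  have gen (x y z v : R) : x != 0 -> y != 0 -> z != 0 -> v != 0 ->
      8 * (x / y) / v * (2 * (y / (2 * x) / z + 1)) = (8 * z^-1 + 16 * (x / y)) / v.
    by move=> x0 y0 z0 v0; field; rewrite x0 y0 z0 v0.
  have nz k : (0 < k)%N -> k%:R != 0 :> R by rewrite pnatr_eq0 lt0n.
  have pos k : (0 < 2 ^ k)%N by rewrite expn_gt0.
  rewrite /hq expnS natrM (gen _ _ _ _ (nz _ (pos h)) (nz _ (pos q)) (nz _ N0) (lt0r_neq0 t0)).
  rewrite -/hq.
  by rewrite ler_pdivrMr//; lra.
have e3 := ler_wpM2l S0 e2.
by lra.
Qed.

(** * Integration over the slope *)

(** The integral of a nonnegative function is the supremum of the integrals of the simple functions
    below it, hence monotone without measurability. Thus [max_discrepancy] can be compared with a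
    step function although nothing is proved about its measurability in [alpha]. *)
Lemma ge0_le_integral_nonmeasurable d (T : measurableType d) (R : realType)
    (mu : {measure set T -> \bar R}) (f g : T -> \bar R) :
  (forall x, (0 <= f x)%E) -> (forall x, (f x <= g x)%E) ->
  (\int[mu]_x f x <= \int[mu]_x g x)%E.
Proof.
move=> f0 fg; have g0 x : (0 <= g x)%E by apply: le_trans (f0 x) (fg x).
rewrite !ge0_integralTE//; apply: ereal_sup_le => _ [h /= hf <-].
by exists h => //= x; apply: le_trans (hf x) (fg x).
Qed.

Lemma integral_step (R : realType) (h : nat -> R) (A : nat) (w : R) :
  0 <= w -> (forall a, 0 <= h a) ->
  (\int[lebesgue_measure]_(x in setT) (\sum_(a < A)
     (h a * \1_(`[a%:R * w, a.+1%:R * w[%classic : set R) x))%:E =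
  (\sum_(a < A) h a * w)%:E)%E.
Proof.
move=> w0 h0.
under eq_integral do rewrite -sumEFin.
rewrite ge0_integral_sum//; last first.
- by move=> a x _; rewrite lee_fin mulr_ge0.
- move=> a; apply/measurable_EFinP; apply: measurable_funM => //.
rewrite -sumEFin; apply: eq_bigr => a _.
under eq_integral do rewrite EFinM.
rewrite ge0_integralZl_EFin//; last exact/measurable_EFinP.
have mE : lebesgue_measure (`[a%:R * w, a.+1%:R * w[%classic : set R) = w%:E.
  rewrite lebesgue_measure_itv/= lte_fin; case: ifPn => [_|].
    by rewrite -EFinB -mulrBl -natr1 addrAC subrr add0r mul1r.
  rewrite -leNgt -natr1 mulrDl mul1r gerDl => w1.
  by congr _%:E; apply/eqP; rewrite eq_le w0 w1.
by rewrite integral_indic// setIT EFinM; congr (_ * _)%E.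
Qed.

(** The majorant depends only on the integer part of [2 ^ q * x]: it is a step function with steps
    of length [2 ^ - q], and [2 ^ (q + d)] of them cover [[0, 2 ^ d)]. *)
Lemma integral_le_step (R : realType) (f : R -> \bar R) (h : nat -> R) q d (D : R) :
  0 <= D -> 2 * D < 2 ^+ d -> (forall a, 0 <= h a) ->
  (forall x, D <= x <= 2 * D -> (0 <= f x <= (h (Num.truncn (2 ^+ q * x)))%:E)%E) ->
  (\int[lebesgue_measure]_(x in `[D, (2 * D)%R]) f x <=
     (2 ^+ d * avg (2 ^ (q + d)) h)%:E)%E.
Proof.
move=> D0 D2 h0 hf; rewrite integral_mkcond.
pose w : R := (2 ^+ q)^-1.
have Q0 : 0 < 2 ^+ q :> R by rewrite exprn_gt0.
have w0 : 0 <= w by rewrite invr_ge0 ltW.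
have -> : 2 ^+ d * avg (2 ^ (q + d)) h = \sum_(a < 2 ^ (q + d)) h a * w.
  rewrite /avg -mulr_suml /w natrX exprD.
  by field; rewrite !gt_eqF ?exprn_gt0.
rewrite -integral_step//.
apply: ge0_le_integral_nonmeasurable => x; rewrite patchE.
  by case: ifPn => // /set_mem; rewrite /= in_itv /= => /hf /andP[].
case: ifPn => [/set_mem|_]; last first.
  by rewrite lee_fin sumr_ge0// => a _; rewrite mulr_ge0.
rewrite /= in_itv /= => xD; have /andP[_ hx] := hf _ xD; apply: le_trans hx _.
case/andP: xD => xD1 xD2; have x0 : 0 <= x by exact: le_trans xD1.
have /andP[a1 a2] := truncn_itv (mulr_ge0 (ltW Q0) x0).
set a := Num.truncn _ in a1 a2 *.
have aA : (a < 2 ^ (q + d))%N.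
  rewrite -(ltr_nat R); apply: le_lt_trans a1 _.
  by rewrite natrX exprD ltr_pM2l//; apply: le_lt_trans D2.
rewrite lee_fin (bigD1 (Ordinal aA))//= indicE mem_set.
  by rewrite mulr1 lerDl sumr_ge0// => i _; rewrite mulr_ge0.
rewrite /= in_itv /= /w ler_pdivrMr// ltr_pdivlMr//.
by rewrite (mulrC x) a1 a2.
Qed.

(** * Counting patterns *)

(** The indices whose value is at least [u] form a half-line, so the values in [[y, z)] come from a
    block of consecutive indices. *)
Lemma beatty_ge (R : realType) (alpha beta u : R) (n : int) : 0 < alpha ->
  (u <= (beatty alpha beta n)%:~R) =
  (Num.ceil (((Num.ceil u)%:~R - beta) / alpha) <= n).
Proof.
move=> a0; rewrite -ceil_le_int floor_ge_int ceil_le_int.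
by rewrite ler_pdivrMr// lerBlDr.
Qed.

Lemma beatty_shift (R : realType) (alpha beta : R) (m n : int) :
  beatty alpha beta (m + n) = beatty alpha (m%:~R * alpha + beta) n.
Proof. by rewrite /beatty intrD mulrDl addrCA addrA. Qed.

Lemma beatty_inj (R : realType) (alpha beta : R) : 1 <= alpha ->
  injective (beatty alpha beta).
Proof.
move=> a1.
have lt m n : m < n -> beatty alpha beta m < beatty alpha beta n.
  move=> mn; rewrite /beatty -lezD1 floor_ge_int intrD mulr1z.
  have h1 : (Num.floor (m%:~R * alpha + beta))%:~R <= m%:~R * alpha + beta.
    exact: floor_le.
  have h2 : m%:~R + 1 <= n%:~R :> R.
    by rewrite -[1]/(1%:~R) -intrD ler_int lezD1.
  have h3 : (m%:~R + 1) * alpha <= n%:~R * alpha by rewrite ler_wpM2r// (le_trans ler01).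
  by move: h3 h1 a1; rewrite mulrDl mul1r; lra.
by move=> m n; case: (ltgtP m n) => [/lt h e|/lt h e|//]; move: h; rewrite e ltxx.
Qed.

Definition pattern_at (R : realType) (L : nat) (omega : L.-tuple bool)
    (alpha beta : R) (n : int) : bool :=
  [forall l : 'I_L, (binary_digit_sum `|beatty alpha beta (n + l%:Z)|%N
     == tnth omega l %[mod 2])%N].

Lemma beatty_pattern_setE (R : realType) (L : nat) (omega : L.-tuple bool)
    (y z alpha beta : R) (n0 : int) (M : nat) :
  0 < alpha -> 
  Num.ceil (((Num.ceil y)%:~R - beta) / alpha) = n0 ->
  Num.ceil (((Num.ceil z)%:~R - beta) / alpha) = n0 + M%:Z ->
  beatty_pattern_set omega y z alpha beta =
  [set` [seq beatty alpha beta (n0 + i%:Z) | i <- iota 0 M &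
      pattern_at omega alpha beta (n0 + i%:Z)]].
Proof.
move=> a0 hy hz; apply/seteqP; split => [m /= [myz [n [mE hn]]]|m /=].
  move: myz; rewrite mE beatty_ge// hy ltNge beatty_ge// hz -ltNge => /andP[n0n nM].
  have nE : n = n0 + `|n - n0|%N%:Z by lia.
  apply/mapP; exists `|n - n0|%N; last by rewrite -nE.
  rewrite mem_filter mem_iota -nE; apply/andP; split; last by lia.
  by apply/forallP => l; apply/eqP; apply: hn.
case/mapP => i; rewrite mem_filter mem_iota => /andP[/forallP hp iM] ->.
split; last by exists (n0 + i%:Z); split => // l; apply/eqP; apply: hp.
by rewrite beatty_ge// hy ltNge beatty_ge// hz -ltNge; lia.
Qed.

Lemma beatty_pattern_countE (R : realType) (L : nat) (omega : L.-tuple bool)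
    (y z alpha beta : R) (n0 : int) (M : nat) :
  1 <= alpha ->
  Num.ceil (((Num.ceil y)%:~R - beta) / alpha) = n0 ->
  Num.ceil (((Num.ceil z)%:~R - beta) / alpha) = n0 + M%:Z ->
  (beatty_pattern_count omega y z alpha beta)%:R =
  \sum_(i < M) (pattern_at omega alpha beta (n0 + i%:Z))%:R :> R.
Proof.
move=> a1 hy hz; have a0 : 0 < alpha by apply: lt_le_trans a1.
rewrite /beatty_pattern_count (beatty_pattern_setE _ a0 hy hz).
set s := [seq _ | _ <- _ & _].
have us : uniq s.
  rewrite map_inj_uniq ?filter_uniq ?iota_uniq// => i j /(beatty_inj a1).
  by move/addrI => [].
have -> : [set` s] = [set` [fset x in s]%fset].
  by apply/seteqP; split => x /=; rewrite !inE.
rewrite set_fsetK card_fseq undup_id// size_map size_filter -sum1_count.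
rewrite natr_sum big_mkcond /=.
rewrite -(big_mkord xpredT (fun i => (pattern_at omega alpha beta (n0 + i%:Z))%:R)).
by rewrite /index_iota subn0; apply: eq_bigr => i _; case: pattern_at.
Qed.

Lemma sign_indicator (R : realType) (w : bool) (b : nat) :
  (1 + (-1) ^+ w * (-1) ^+ b) / 2 = ((b == w %[mod 2])%N)%:R :> R.
Proof.
rewrite -(signr_odd _ b) !modn2; case: w; case: (odd b) => /=; rewrite ?expr0 ?expr1.
all: by lra.
Qed.

Lemma tm_binary_digit_sum (R : realType) n : tm R n = (-1) ^+ binary_digit_sum n.
Proof. by rewrite /tm /sg big_mkord. Qed.

Definition subset_seq (L : nat) (E : {set 'I_L}) : seq nat := [seq val l | l <- enum E].

(** The starting index [n] is absorbed into the offset, so that the signs are always read from index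
    [0]. The empty set yields the density [2 ^ - L], the other sets yield the error. *)
Lemma pattern_expand (R : realType) (L : nat) (omega : L.-tuple bool)
    (alpha beta : R) (n : int) (i : nat) :
  (pattern_at omega alpha beta (n + i%:Z))%:R =
  (2 ^+ L)^-1 * \sum_(E : {set 'I_L}) (\prod_(l in E) (-1) ^+ (tnth omega l)) *
     beatty_sg (subset_seq E) alpha (n%:~R * alpha + beta) i :> R.
Proof.
pose v (l : 'I_L) : R := tm R `|beatty alpha (n%:~R * alpha + beta) (i + l)%N%:Z|%N.
have -> : (pattern_at omega alpha beta (n + i%:Z))%:R =
   \prod_(l < L) ((1 + (-1) ^+ (tnth omega l) * v l) / 2) :> R.
  have vE l : (1 + (-1) ^+ (tnth omega l) * v l) / 2 =
     ((binary_digit_sum `|beatty alpha beta (n + i%:Z + l%:Z)|%N == tnth omega l %[mod 2])%N)%:R.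
    by rewrite /v tm_binary_digit_sum sign_indicator -beatty_shift PoszD addrA.
  under eq_bigr do rewrite vE.
  case: (boolP (pattern_at _ _ _ _)) => [/forallP h|].
    by rewrite big1// => l _; rewrite h.
  by rewrite negb_forall => /existsP[l hl]; rewrite (bigD1 l)//= (negPf hl) mul0r.
rewrite big_split /= prodr_const card_ord exprVn mulrC; congr (_ * _).
under eq_bigr do rewrite addrC.
rewrite bigA_distr; apply: eq_bigr => E _.
rewrite -big_mkcond /= big_split /=; congr (_ * _).
by rewrite /beatty_sg /subset_seq big_map big_enum.
Qed.

Lemma subset_seqP (L : nat) (E : {set 'I_L}) : E != finset.set0 ->
  [/\ subset_seq E != [::], uniq (subset_seq E) &
      forall l, l \in subset_seq E -> (l < L)%N].
Proof.
move=> E0; split.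
- rewrite -size_eq0 size_map -cardE finset.cards_eq0//.
- by rewrite map_inj_uniq ?enum_uniq//; apply: val_inj.
- by move=> l /mapP[i _ ->]; exact: ltn_ord.
Qed.

(** The sum is cut into blocks of length [N]. Passing to the next block replaces [beta] by
    [N * alpha + beta], still nonnegative, so the uniform bound [g] holds on each; the last
    incomplete block costs at most [N]. *)
Lemma sum_beatty_sg_le (R : realType) (s : seq nat) (alpha g : R) N M :
  0 <= alpha -> 0 <= g -> (0 < N)%N ->
  (forall beta, 0 <= beta -> `|avg N (beatty_sg s alpha beta)| <= g) ->
  forall beta, 0 <= beta ->
  `|\sum_(i < M) beatty_sg s alpha beta i| <= M%:R * g + N%:R.
Proof.
move=> a0 g0 N0 hg; have NR : 0 < N%:R :> R by rewrite ltr0n.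
elim: M {-2}M (leqnn M) => [|K IHK] M MK beta b0.
  by move: MK; rewrite leqn0 => /eqP ->; rewrite big_ord0 normr0 mul0r add0r.
have [MN|NM] := ltnP M N.
  apply: (@le_trans _ _ M%:R).
    apply: le_trans (ler_norm_sum _ _ _) _.
    rewrite -[M in leRHS]card_ord -sumr_const; apply: ler_sum => i _.
    exact: beatty_sg_le1.
  by apply: (@le_trans _ _ N%:R); [rewrite ler_nat ltnW | rewrite lerDr mulr_ge0].
have [j ME] : exists j, M = (N + j)%N by exists (M - N)%N; lia.
rewrite {}ME in MK NM *; rewrite big_split_ord /=.
pose beta' := N%:R * alpha + beta.
have -> : \sum_(i < j) beatty_sg s alpha beta (N + i) =
    \sum_(i < j) beatty_sg s alpha beta' i.
  apply: eq_bigr => i _; apply: eq_bigr => l _; congr (tm R `|_|%N).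
  by rewrite -addnA PoszD beatty_shift.
have jK : (j <= K)%N by lia.
have b'0 : 0 <= beta' by rewrite addr_ge0// mulr_ge0.
apply: le_trans (ler_normD _ _) _.
have h1 := IHK _ jK _ b'0.
have h2 : `|\sum_(i < N) beatty_sg s alpha beta i| <= N%:R * g.
  have := hg _ b0; rewrite /avg normrM normfV (ger0_norm (ltW NR)).
  by rewrite ler_pdivrMr// mulrC.
by rewrite natrD mulrDl -addrA lerD.
Qed.

Lemma discrepancy_le (R : realType) (L : nat) (omega : L.-tuple bool)
    (y z alpha beta : R) (N : nat) (g : {set 'I_L} -> R) :
  1 <= alpha -> 0 <= beta -> 0 <= y -> y <= z -> (0 < N)%N ->
  (forall E, 0 <= g E) ->
  (forall E beta, E != finset.set0 -> 0 <= beta ->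
     `|avg N (beatty_sg (subset_seq E) alpha beta)| <= g E) ->
  discrepancy omega y z alpha beta <=
  2 + \sum_(E : {set 'I_L} | E != finset.set0)
        (((z - y) / alpha + 2) * g E + N%:R).
Proof.
move=> a1 b0 y0 yz N0 g0 hg; have a0 : 0 < alpha by apply: lt_le_trans a1.
pose n0 := Num.ceil (((Num.ceil y)%:~R - beta) / alpha).
pose n1 := Num.ceil (((Num.ceil z)%:~R - beta) / alpha).
have n01 : n0 <= n1.
  apply: le_ceil; rewrite ler_pM2r ?invr_gt0// lerD2r ler_int.
  exact: le_ceil.
pose M := `|n1 - n0|%N.
have n1E : n1 = n0 + M%:Z by rewrite /M; lia.
rewrite /discrepancy (beatty_pattern_countE omega a1 (erefl n0) n1E).
(* [n0] may be negative, but the offset moved to it is at least [y], hence nonnegative. *)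
pose beta' : R := n0%:~R * alpha + beta.
have hb' : (Num.ceil y)%:~R <= beta'.
  have := ceil_ge (((Num.ceil y)%:~R - beta) / alpha); rewrite -/n0.
  by rewrite ler_pdivrMr// lerBlDr.
have b'0 : 0 <= beta' by apply: le_trans hb'; apply: le_trans (ceil_ge y).
have ME : M%:R = n1%:~R - n0%:~R :> R by rewrite n1E intrD addrAC subrr add0r -pmulrn.
(* The roundings of [y] and [z] contribute less than [1 / alpha <= 1] to the difference, those of
   the two indices less than [1]. *)
have Mlo : `|M%:R - (z - y) / alpha| <= 2.
  have /andP[p1 p2] := ceil_itv y; have /andP[p3 p4] := ceil_itv z.
  have /andP[p5 p6] := ceil_itv (((Num.ceil y)%:~R - beta) / alpha).
  have /andP[p7 p8] := ceil_itv (((Num.ceil z)%:~R - beta) / alpha).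
  move: p5 p6 p7 p8; rewrite -/n0 -/n1 => p5 p6 p7 p8.
  rewrite intrD in p1; rewrite intrD in p3; rewrite intrD in p5; rewrite intrD in p7.
  rewrite ltr_pdivlMr// in p5; rewrite ltr_pdivlMr// in p7.
  rewrite ler_pdivrMr// in p6; rewrite ler_pdivrMr// in p8.
  have -> : M%:R - (z - y) / alpha = (M%:R * alpha - (z - y)) / alpha.
    by field; rewrite gt_eqF.
  rewrite normrM normfV (gtr0_norm a0) ler_pdivrMr// ler_norml ME.
  move: p1 p2 p3 p4 p5 p6 p7 p8.
  rewrite (_ : (-1)%:~R = -1 :> R)// !mulrDl !mulNr mul1r.
  set u := n0%:~R * alpha; set v := n1%:~R * alpha.
  by move: a1; lra.
have Mhi : M%:R <= (z - y) / alpha + 2 by have := ler_norm (M%:R - (z - y) / alpha); lra.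
pose c (E : {set 'I_L}) : R := \prod_(l in E) (-1) ^+ (tnth omega l).
have c1 E : `|c E| = 1 by rewrite normr_prod big1// => l _; rewrite normr_sign.
pose SE (E : {set 'I_L}) := \sum_(i < M) beatty_sg (subset_seq E) alpha beta' i.
have -> : \sum_(i < M) (pattern_at omega alpha beta (n0 + i%:Z))%:R =
    (2 ^+ L)^-1 * \sum_(E : {set 'I_L}) c E * SE E.
  under eq_bigr do rewrite pattern_expand.
  rewrite -mulr_sumr exchange_big /=; congr (_ * _); apply: eq_bigr => E _.
  by rewrite -mulr_sumr.
rewrite (bigD1 finset.set0)//=.
have -> : c finset.set0 * SE finset.set0 = M%:R.
  rewrite /c finset.big_set0 mul1r /SE (eq_bigr (fun=> 1)) ?sumr_const ?card_ord// => i _.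
  by rewrite /beatty_sg /subset_seq finset.enum_set0 big_nil.
set T := \sum_(E | _) c E * _.
have L0 : 0 < 2 ^+ L :> R by rewrite exprn_gt0.
have L1 : (2 ^+ L)^-1 <= 1 :> R by rewrite invf_le1// exprn_ege1// ler1n.
have -> : (2 ^+ L)^-1 * (M%:R + T) - (z - y) / (2 ^+ L * alpha) =
    (2 ^+ L)^-1 * ((M%:R - (z - y) / alpha) + T).
  by field; rewrite !gt_eqF.
rewrite normrM gtr0_norm ?invr_gt0//.
apply: le_trans (ler_piMl (normr_ge0 _) L1) _.
apply: le_trans (ler_normD _ _) _; rewrite lerD//.
apply: le_trans (ler_norm_sum _ _ _) _; apply: ler_sum => E E0.
rewrite normrM c1 mul1r.
have h := @sum_beatty_sg_le R (subset_seq E) alpha (g E) N M (ltW a0) (g0 E) N0.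
apply: le_trans (h _ _ b'0) _; first by move=> b hb; apply: hg.
by rewrite lerD2r ler_wpM2r.
Qed.

(** * Choice of parameters *)

Lemma pow2_floor (R : realType) (u : R) : 1 <= u ->
  exists k : nat, 2 ^+ k <= u < 2 ^+ k.+1.
Proof.
move=> u1; have u0 : 0 <= u by apply: le_trans u1.
have /andP[h1 h2] := truncn_itv u0; set m := Num.truncn u in h1 h2.
have m0 : (0 < m)%N.
  by rewrite lt0n; apply/eqP => m0; move: h2; rewrite m0 ltNge u1.
have /andP[h3 h4] := trunc_log_bounds (ltnSn 1) m0.
exists (trunc_log 2 m); rewrite -!natrX; apply/andP; split.
  by apply: le_trans h1; rewrite ler_nat.
by apply: lt_le_trans h2 _; rewrite ler_nat.
Qed.

Lemma max_discrepancy_ge0 (R : realType) (L : nat) (omega : L.-tuple bool)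
    (x alpha : R) : 0 <= x -> (0 <= max_discrepancy omega x alpha)%E.
Proof.
move=> x0; apply: (@le_trans _ _ (ereal_sup [set (discrepancy omega 0 0 alpha beta)%:E
   | beta in [set beta : R | 0 <= beta]])).
  apply: (@le_trans _ _ (discrepancy omega 0 0 alpha 0)%:E).
    by rewrite lee_fin normr_ge0.
  by apply: ereal_sup_ubound; exists 0 => //=.
by apply: ereal_sup_ubound; exists (0, 0) => //=; rewrite lexx subrr.
Qed.

Lemma max_discrepancy_le (R : realType) (L : nat) (omega : L.-tuple bool)
    (x D alpha : R) (N : nat) (g : {set 'I_L} -> R) :
  0 <= x -> 1 <= D -> D <= alpha -> (0 < N)%N ->
  (forall E, 0 <= g E) ->
  (forall E beta, E != finset.set0 -> 0 <= beta ->
     `|avg N (beatty_sg (subset_seq E) alpha beta)| <= g E) ->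
  (max_discrepancy omega x alpha <=
   (2 + \sum_(E : {set 'I_L} | E != finset.set0) ((x / D + 2) * g E + N%:R))%:E)%E.
Proof.
move=> x0 D1 Da N0 g0 hg; have D0 : 0 < D by apply: lt_le_trans D1.
have a1 : 1 <= alpha by apply: le_trans Da.
apply: ge_ereal_sup => _ [[y z] /= [/andP[y0 yz] zx] <-].
apply: ge_ereal_sup => _ [beta /= b0 <-]; rewrite lee_fin.
apply: le_trans (discrepancy_le omega a1 b0 y0 yz N0 g0 hg) _.
rewrite lerD2l; apply: ler_sum => E _; rewrite lerD2r ler_wpM2r// lerD2r.
apply: ler_pM => //; rewrite ?subr_ge0//.
  by rewrite invr_ge0 (le_trans _ a1).
by rewrite lef_pV2 ?posrE// (lt_le_trans D0).
Qed.

(** [2 ^ T] and [2 ^ n] are the largest powers of two not above [x ^ xi] and [x / (D * 2 ^ T)], and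
    [2 ^ d] is the one between [2 * D] and [4 * D]. Up to constants, [d + c * T <= 2 * n] says
    [D ^ 3 * 2 ^ ((c + 2) * T) <= x ^ 2], which is where [3 * delta2 < 2] is used. *)
Lemma dyadic_parameters (R : realType) (c : nat) (delta1 delta2 xi x D : R) :
  0 < delta1 -> delta2 < 2 / 3 -> 0 < xi ->
  c%:R * xi <= delta1 -> (c%:R + 6) * xi <= 2 - 3 * delta2 -> xi <= 1 / 3 ->
  1 <= x -> x `^ delta1 <= D -> D <= x `^ delta2 ->
  exists T d n : nat, [/\ (c * T <= d)%N, (0 < T)%N -> (d + c * T <= 2 * n)%N,
    [/\ 2 * D < 2 ^+ d, 2 ^+ d <= 4 * D & (2 ^ n)%:R * D <= x / 2 ^+ T],
    D <= x / 2 ^+ T & (2 ^+ T)^-1 <= 2 * x `^ (- xi)].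
Proof.
move=> d1 d2 xi0 c1 c6 xi3 x1 D1 D2.
have x0 : 0 <= x by apply: le_trans x1.
have xgt0 : 0 < x by apply: lt_le_trans x1.
have pw u v : u <= v -> x `^ u <= x `^ v by move=> uv; apply: ler_powR.
have pw1 u : 0 <= u -> 1 <= x `^ u by move=> /pw; rewrite powRr0.
have D1' : 1 <= D by apply: le_trans D1; apply/pw1/ltW.
have D0 : 0 < D by apply: lt_le_trans D1'.
have [T /andP[T1 T2]] := pow2_floor (pw1 _ (ltW xi0)).
have [k /andP[k1 k2]] := pow2_floor D1'.
have TXk e : (2 ^+ T) ^+ e <= x `^ (e%:R * xi).
  rewrite mulrC powRrM powR_mulrn ?powR_ge0//.
  by rewrite lerXn2r ?nnegrE ?powR_ge0// exprn_ge0.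
have T0 : 0 < 2 ^+ T :> R by rewrite exprn_gt0.
have xE : x = x `^ 1 by rewrite powRr1.
(* [delta2 + xi <= 1], by [delta2 < 2 / 3] and [xi <= 1 / 3]. *)
have DT : D * 2 ^+ T <= x.
  apply: (@le_trans _ _ (x `^ delta2 * x `^ xi)).
    by apply: ler_pM => //; apply: ltW.
  rewrite -powRD ?(gt_eqF xgt0) ?implybT// [leRHS]xE; apply: pw; lra.
have u1 : 1 <= x / (D * 2 ^+ T) by rewrite ler_pdivlMr ?mulr_gt0// mul1r.
have [n /andP[n1 n2]] := pow2_floor u1.
have two1 : 1 < 2 :> R by rewrite ltr1n.
exists T, (k + 2)%N, n; split.
- rewrite -ltnS -(@ltr_eXn2l R 2)//.
  apply: (@le_lt_trans _ _ (x `^ (c%:R * xi))); first by rewrite mulnC exprM TXk.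
  apply: (@le_lt_trans _ _ D); first by apply: le_trans (pw _ _ c1) D1.
  by apply: lt_le_trans k2 _; rewrite ler_eXn2l// ltnS leq_addr.
- move=> Tp.
  suff : 2 ^+ (k + 2 + c * T) < 2 ^+ (2 * n).+1 :> R.
    by rewrite ltr_eXn2l// ltnS.
  (* For [T > 0] the constant [16] is absorbed into [2 ^ (4 * T)]; with the exponent [c + 2] this
     makes the [c + 6] of the hypothesis. *)
  have h16 : 16 <= (2 ^+ T) ^+ 4 :> R.
    have : 2 <= 2 ^+ T :> R by rewrite -[leLHS]expr1 ler_eXn2l.
    move=> h; have := lerXn2r 4 _ _ h; rewrite !nnegrE => /(_ _ _) hh.
    have -> : 16 = 2 ^+ 4 :> R by rewrite -natrX.
    by apply: hh => //; apply: ltW.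
  have big : 16 * D ^+ 3 * (2 ^+ T) ^+ (c + 2) <= x ^+ 2.
    apply: (@le_trans _ _ (x `^ (4%:R * xi) * x `^ (3%:R * delta2) * x `^ ((c + 2)%:R * xi))).
      apply: ler_pM => //; rewrite ?mulr_ge0 ?exprn_ge0 ?(ltW T0) ?(ltW D0)//.
      apply: ler_pM => //; rewrite ?exprn_ge0 ?(ltW D0)//.
        exact: le_trans h16 (TXk 4%N).
      rewrite [3%:R * _]mulrC powRrM powR_mulrn ?powR_ge0//.
      by rewrite lerXn2r ?nnegrE ?powR_ge0// ltW.
    rewrite -!powRD ?(gt_eqF xgt0) ?implybT// -powR_mulrn//; apply: pw.
    by rewrite natrD; lra.
  have n3 : x ^+ 2 < (D * 2 ^+ T) ^+ 2 * (2 ^+ n.+1) ^+ 2.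
    rewrite -exprMn ltrXn2r ?nnegrE ?mulr_ge0 ?(ltW D0) ?(ltW T0)//.
    by rewrite mulrC -ltr_pdivrMr ?mulr_gt0.
  have : 4 * 2 ^+ k * (2 ^+ T) ^+ c * (D ^+ 2 * (2 ^+ T) ^+ 2 * 4) <
     4 * (2 ^+ n) ^+ 2 * (D ^+ 2 * (2 ^+ T) ^+ 2 * 1).
    apply: (@le_lt_trans _ _ (16 * D ^+ 3 * (2 ^+ T) ^+ (c + 2))).
      have -> : 4 * 2 ^+ k * (2 ^+ T) ^+ c * (D ^+ 2 * (2 ^+ T) ^+ 2 * 4) =
        2 ^+ k * (16 * D ^+ 2 * (2 ^+ T) ^+ (c + 2)).
        rewrite (exprD _ c 2); move: (((2 : R) ^+ T) ^+ c) ((2 : R) ^+ T) ((2 : R) ^+ k) => y w u; ring.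
      have -> : 16 * D ^+ 3 * (2 ^+ T) ^+ (c + 2) =
        D * (16 * D ^+ 2 * (2 ^+ T) ^+ (c + 2)).
        by move: (((2 : R) ^+ T) ^+ (c + 2)) => y; ring.
      apply: ler_wpM2r => //; apply: mulr_ge0; last exact/exprn_ge0/ltW.
      by apply: mulr_ge0 => //; apply/exprn_ge0/ltW.
    apply: le_lt_trans big _; apply: lt_le_trans n3 _.
    rewrite le_eqVlt; apply/orP; left; apply/eqP; rewrite (exprS _ n).
    by move: ((2 : R) ^+ T) ((2 : R) ^+ n) => w u; ring.
  have P0 : 0 < D ^+ 2 * (2 ^+ T) ^+ 2 by rewrite mulr_gt0// exprn_gt0.
  rewrite mulr1 [X in X < _]mulrA (mulrAC _ _ 4) ltr_pM2r// => h.
  have -> : 2 ^+ (k + 2 + c * T) = 4 * 2 ^+ k * (2 ^+ T) ^+ c :> R.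
    rewrite (exprD _ (k + 2)) (exprD _ k 2) (mulnC c) exprM.
    by move: (((2 : R) ^+ T) ^+ c) ((2 : R) ^+ k) => y u; ring.
  rewrite exprS (mulnC 2 n) exprM.
  move: h; have := sqr_ge0 ((2 : R) ^+ n).
  set y := _ * (2 ^+ T) ^+ c; set z := (2 ^+ n) ^+ 2; lra.
- have p0 : 0 < 2 ^+ k :> R by rewrite exprn_gt0.
  rewrite exprD; move: k1 k2; rewrite exprS; split.
  + by rewrite expr2; lra.
  + by rewrite expr2; lra.
  + rewrite natrX; move: n1; rewrite ler_pdivlMr ?mulr_gt0//.
    by rewrite ler_pdivlMr// mulrA.
- by rewrite ler_pdivlMr.
- rewrite powRN -ler_pdivrMl// mulrC -invfM lef_pV2 ?posrE ?mulr_gt0 ?powR_gt0//.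
  by rewrite mulrC -exprS ltW.
Qed.

Theorem theorem2p4 (R : realType) (L : nat) (hL : (1 <= L)%N)
    (omega : L.-tuple bool) (delta1 delta2 : R)
    (hdelta1 : 0 < delta1) (hdelta12 : delta1 <= delta2)
    (hdelta2 : delta2 < 2 / 3) :
  exists eta C : R, 0 < eta /\
    forall x D : R, 1 <= x -> x `^ delta1 <= D -> D <= x `^ delta2 ->
      (\int[lebesgue_measure]_(alpha in `[D, (2 * D)%R])
          max_discrepancy omega x alpha <= (C * x `^ (1 - eta))%:E)%E.
Proof.
have [c Hc] := @beatty_model R L.
(* The empty set receives the constant [0], so that a choice can be made over all subsets. *)
have ex E : exists Cst : R, 0 <= Cst /\ (E != finset.set0 ->
    forall T n d q, (c * T <= d)%N -> ((0 < T)%N -> (d + c * T <= 2 * n)%N) ->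
  (2 * n + d + c * T + L < q)%N ->
  exists G : nat -> R, [/\ forall a, 0 <= G a,
    forall alpha beta : R, 0 <= alpha < 2 ^+ d -> 0 <= beta ->
      `|avg (2 ^ n) (beatty_sg (@subset_seq L E) alpha beta)| <=
         Cst / (2 ^ T)%:R + G (Num.truncn (2 ^+ q * alpha))
    & avg (2 ^ (q + d)) G <= Cst / (2 ^ T)%:R]).
  have [->|E0] := eqVneq E finset.set0; first by exists 0; rewrite lexx.
  have [e1 e2 e3] := subset_seqP E0.
  by have [Cst [C0 H]] := Hc _ e1 e2 e3; exists Cst.
have [Cs HCs] := choice ex; have {ex} Cs0 E : 0 <= Cs E by have [] := HCs E.
(* The two terms are what [c * T <= d] and [d + c * T <= 2 * n] demand of the exponents; [c + 1]
   keeps the first denominator positive. *)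
pose xi := Num.min (delta1 / (c%:R + 1)) ((2 - 3 * delta2) / (c%:R + 6)).
have cR : 0 <= c%:R :> R by [].
have c1 : 0 < c%:R + 1 :> R by lra.
have c6 : 0 < c%:R + 6 :> R by lra.
have d23 : 0 < 2 - 3 * delta2 by lra.
have xi0 : 0 < xi by rewrite lt_min !divr_gt0.
have xi1 : (c%:R + 1) * xi <= delta1.
  by rewrite mulrC -ler_pdivlMr// ge_min lexx.
have xi2 : (c%:R + 6) * xi <= 2 - 3 * delta2.
  by rewrite mulrC -ler_pdivlMr// ge_min lexx orbT.
have xi3 : c%:R * xi <= delta1 by move: xi1; rewrite mulrDl; lra.
have cxi : 0 <= c%:R * xi by rewrite mulr_ge0// ltW.
have xi4 : xi <= 1 / 3 by move: xi2; rewrite mulrDl; lra.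
pose SC : R := \sum_(E : {set 'I_L} | E != finset.set0) (24 * Cs E + 4).
exists xi, (2 * (8 + SC)); split=> // x D x1 D1 D2.
have x0 : 0 <= x by apply: le_trans x1.
have D1' : 1 <= D.
  by apply: le_trans D1; rewrite -(powRr0 x); apply: ler_powR => //; apply: ltW.
have D0 : 0 < D by apply: lt_le_trans D1'.
have [T [d [n [cT dn [Dd dD nD] DT Tx]]]] :=
  dyadic_parameters hdelta1 hdelta2 xi0 xi3 xi2 xi4 x1 D1 D2.
pose N := (2 ^ n)%N; have N0 : (0 < N)%N by rewrite expn_gt0.
pose q := (2 * n + d + c * T + L).+1; pose t : R := (2 ^+ T)^-1.
have t0 : 0 < t by rewrite invr_gt0 exprn_gt0.
have Gex E : exists G : nat -> R, (forall a, 0 <= G a) /\ (E != finset.set0 ->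
    (forall alpha beta : R, 0 <= alpha < 2 ^+ d -> 0 <= beta ->
      `|avg N (beatty_sg (@subset_seq L E) alpha beta)| <=
         Cs E * t + G (Num.truncn (2 ^+ q * alpha))) /\
    avg (2 ^ (q + d)) G <= Cs E * t).
  have [->|E0] := eqVneq E finset.set0; first by exists (fun=> 0); split.
  have [_ /(_ E0 T n d q cT dn (ltnSn _)) [G [G0 GS GA]]] := HCs E.
  have tE : t = ((2 ^ T)%:R)^-1 by rewrite /t natrX.
  by exists G; split => // _; rewrite tE; split.
have [G HG] := choice Gex.
have G0 E a : 0 <= G E a by have [] := HG E.
pose g a E := Cs E * t + G E a.
have g0 a E : 0 <= g a E by rewrite addr_ge0// mulr_ge0// ltW.
have xD0 : 0 <= x / D + 2 by rewrite addr_ge0// divr_ge0// ltW.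
pose h a := 2 + \sum_(E : {set 'I_L} | E != finset.set0) ((x / D + 2) * g a E + N%:R).
have h0 a : 0 <= h a.
  by rewrite addr_ge0// sumr_ge0// => E _; rewrite addr_ge0// mulr_ge0.
apply: (@le_trans _ _ (2 ^+ d * avg (2 ^ (q + d)) h)%:E).
  apply: integral_le_step => //; first exact: ltW.
  move=> alpha /andP[Da aD]; rewrite max_discrepancy_ge0//=.
  apply: max_discrepancy_le => // E beta E0 b0.
  have [_ /(_ E0) [+ _]] := HG E; apply => //.
  by rewrite (le_trans (ltW D0) Da) (le_lt_trans aD Dd).
rewrite lee_fin.
have Ah : avg (2 ^ (q + d)) h <= 2 + \sum_(E : {set 'I_L} | E != finset.set0)
    ((x / D + 2) * (2 * (Cs E * t)) + N%:R).
  have pos : (0 < 2 ^ (q + d))%N by rewrite expn_gt0.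
  rewrite /h avgD avg_const// lerD2l.
  rewrite avg_sum; apply: ler_sum => E E0.
  rewrite avgD avgZ avg_const// lerD2r ler_wpM2l// avgD avg_const//.
  by have [_ /(_ E0) [_ h1]] := HG E; move: h1; lra.
have ah0 : 0 <= avg (2 ^ (q + d)) h by apply: avg_ge0.
apply: (@le_trans _ _ (4 * D * (2 + \sum_(E : {set 'I_L} | E != finset.set0)
    ((x / D + 2) * (2 * (Cs E * t)) + N%:R)))).
  by apply: ler_pM => //; rewrite exprn_ge0.
have DT' : D <= x * t by [].
have xx : x * t * 2 * x `^ (- xi) = 2 * (x * t) * x `^ (- xi) by ring.
(* [D <= x * t], [N * D <= x * t] and [x + 2 * D <= 3 * x] bring every term below a multiple of
   [x * t]; then [t <= 2 * x ^ (- xi)] gives the outer factor [2]. *)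
apply: (@le_trans _ _ (8 * (x * t) + \sum_(E : {set 'I_L} | E != finset.set0) (24 * Cs E + 4) * (x * t))).
  rewrite mulrDr; apply: lerD; first by lra.
  rewrite mulr_sumr; apply: ler_sum => E _.
  have hN : N%:R * D <= x * t by [].
  have Dx : D <= x by apply: le_trans DT' _; rewrite ler_piMr// /t invf_le1 ?exprn_gt0// exprn_ege1// ler1n.
  have -> : 4 * D * ((x / D + 2) * (2 * (Cs E * t)) + N%:R) =
     8 * (x + 2 * D) * (Cs E * t) + 4 * (N%:R * D) by field; rewrite gt_eqF.
  have Ct : 0 <= Cs E * t by rewrite mulr_ge0// ltW.
  have h1 : 8 * (x + 2 * D) * (Cs E * t) <= 24 * x * (Cs E * t).
    by apply: ler_wpM2r => //; lra.
  by move: h1 hN; lra.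
rewrite -mulr_suml -/SC -mulrDl powRD; last by rewrite (gt_eqF (lt_le_trans ltr01 x1)) implybT.
rewrite powRr1// [leRHS](_ : _ = (8 + SC) * (x * (2 * x `^ (- xi)))); last by ring.
apply: ler_wpM2l.
  by rewrite addr_ge0// /SC sumr_ge0// => E _; rewrite addr_ge0// mulr_ge0.
exact: ler_wpM2l.
Qed.
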